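(* Let $n,k,j$ be integers with $0\leq j\leq n-k-1\leq n-1$ and let $K$ be a centrally symmetric convex body in $\mathbb{R}^n$. Then $$\alpha_{n,k,j}\binom{n}{k}^{-1}\frac{W_j(K)}{|K|}\leq\int_{G_{n,n-k}}\frac{W_j(K\cap F)}{|K\cap F|}\,d\nu_{n,n-k}(F)\leq \alpha_{n,k,j}\binom{n-j}{k}\frac{W_j(K)}{|K|},$$ where $\alpha_{n,k,j}=\dfrac{\omega_{n-k}\,\omega_{n-j}}{\omega_{n-k-j}\,\omega_n}$.
   Context: A convex body in $\mathbb{R}^n$ is a compact convex set with non-empty interior; it is centrally symmetric if $x\in K$ implies $-x\in K$. $|\cdot|$ denotes volume in the appropriate dimension, $B_2^m$ is the Euclidean unit ball of $\mathbb{R}^m$ and $\omega_m=|B_2^m|$ ($\omega_0=1$). $G_{n,m}$ is the Grassmann manifold of $m$-dimensional linear subspaces of $\mathbb{R}^n$ with its rotation-invariant (Haar) probability measure $\nu_{n,m}$. For a convex body $L$ in an $m$-dimensional Euclidean space, the quermassintegrals $W_0(L),\ldots,W_m(L)$ are defined by Steiner's formula $|L+\lambda B|=\sum_{i=0}^m\binom{m}{i}W_i(L)\lambda^i$ for $\lambda\geq 0$, where $B$ is the Euclidean unit ball of that space; equivalently $W_i(L)$ is the mixed volume of $m-i$ copies of $L$ and $i$ copies of $B$. Here $W_j(K)$ and $|K|$ are taken in dimension $n$, and for $F\in G_{n,n-k}$ the quantities $W_j(K\cap F)$ and $|K\cap F|$ are taken in the $(n-k)$-dimensional space $F$. *)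

(* Defs.v *)
From HB Require Import structures.
From mathcomp Require Import all_boot all_order all_algebra.
From mathcomp Require Import all_classical all_reals all_analysis.

Set Implicit Arguments.
Unset Strict Implicit.
Unset Printing Implicit Defensive.

Import Order.TTheory GRing.Theory Num.Theory numFieldNormedType.Exports.

Local Open Scope classical_set_scope.
Local Open Scope ring_scope.

Section volume.
Context {R : realType}.

(* n-dimensional Lebesgue measure as the n-fold product of the Lebesgue measure
   on the line: the successor case is the library's formula for a product
   measure, the integral of the measures of the sections; R^0 carries the unit
   point mass. *)
Fixpoint vol (n : nat) : set 'rV[R]_n -> \bar R :=
  match n with
  | 0 => fun A => (\1_A (0 : 'rV[R]_0))%:E
  | n'.+1 => fun A => (\int[lebesgue_measure]_(x in [set: R])
      vol [set y : 'rV[R]_n' | A (row_mx (x%:M : 'rV[R]_1) y)])%E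
  end.

Definition volume (n : nat) (A : set 'rV[R]_n) : R := fine (vol A).

(* The library norm on 'rV_n is the sup norm, hence the explicit formula. *)
Definition euclidean_ball (n : nat) : set 'rV[R]_n :=
  [set x | Num.sqrt (\sum_(i < n) x 0 i ^+ 2) <= 1].
Arguments euclidean_ball : clear implicits.

Definition omega (n : nat) : R := volume (euclidean_ball n).

Definition convex_body (n : nat) (K : set 'rV[R]_n) : Prop :=
  [/\ compact K, convex_set K & K° !=set0].

Definition centrally_symmetric (n : nat) (K : set 'rV[R]_n) : Prop :=
  forall x, K x -> K (- x).

Definition steiner_formula (m : nat) (L : set 'rV[R]_m) (W : nat -> R) : Prop :=
  forall lambda : R, 0 <= lambda ->
    vol [set x + lambda *: u | x in L & u in euclidean_ball m] =
    (\sum_(i < m.+1) 'C(m, i)%:R * W i * lambda ^+ i)%:E.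

(* [quermassintegral L i] is W_i(L). Steiner's formula determines W_0, ..., W_m;
   the values beyond m are unspecified. *)
Definition quermassintegral (m : nat) (L : set 'rV[R]_m) : nat -> R :=
  get (steiner_formula L).

End volume.

(* The Grassmannian G_{n,n-k}, indexed by the codimension k so that the type is
   never empty. *)
Definition grassmannian (R : realType) (n k : nat) : Type :=
  {F : {vspace 'rV[R]_n} | \dim F == (n - k)%N}.

Section grassmannian.
Context {R : realType} {n k : nat}.
Local Notation G := (grassmannian R n k).

Lemma grassmannian_inhabited :
  exists F : {vspace 'rV[R]_n}, \dim F == (n - k)%N.
Proof.
pose b := vbasis {: 'rV[R]_n}.
have freeb : free b by exact: basis_free (vbasisP _).
exists <<take (n - k) b>>%VS.
have : free (take (n - k) b).
  by move: freeb; rewrite -{1}(cat_take_drop (n - k) b) => /catl_free.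
rewrite /free => /eqP ->.
by rewrite size_takel// size_tuple dimvf /dim/= mul1n leq_subr.
Qed.

HB.instance Definition _ := Choice.on G.
HB.instance Definition _ := isPointed.Build G
  (exist _ (projT1 (cid grassmannian_inhabited))
           (projT2 (cid grassmannian_inhabited))).

(* The rows of [frame F] form an orthonormal basis of F. *)
Definition frame (F : G) : 'M[R]_(n - k, n) :=
  get [set U : 'M[R]_(n - k, n) |
    U *m U^T = 1%:M /\ forall x : 'rV[R]_n, (x \in val F) = (x <= U)%MS].

(* Matrix of the orthogonal projection onto F; it does not depend on the
   orthonormal basis. *)
Definition orthproj (F : G) : 'M[R]_n := (frame F)^T *m frame F.

(* The usual topology of the Grassmannian, that of the metric
   |orthproj E - orthproj F|. *)
HB.instance Definition _ := Topological.copy G (initial_topology orthproj).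

(* K `&` F as a subset of R^(n-k), through the isometry from R^(n-k) onto F
   given by an orthonormal basis of F. *)
Definition slice (K : set 'rV[R]_n) (F : G) : set 'rV[R]_(n - k) :=
  [set y | K (y *m frame F)].

(* The set of the subspaces F Q for F in A; vectors are rows. *)
Definition rotate (Q : 'M[R]_n) (A : set G) : set G :=
  [set F | exists2 E, A E & val F = (linfun (mulmxr Q) @: val E)%VS].

End grassmannian.

Definition borel_grassmannian (R : realType) (n k : nat) :=
  g_sigma_algebraType (@open (grassmannian R n k)).

Definition rotation_invariant (R : realType) (n k : nat)
    (nu : probability (borel_grassmannian R n k) R) : Prop :=
  forall (Q : 'M[R]_n) (A : set (borel_grassmannian R n k)),
    Q *m Q^T = 1%:M -> measurable A -> nu (rotate Q A) = nu A.

Definition alpha (R : realType) (n k j : nat) : R :=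
  omega (n - k) * omega (n - j) / (omega (n - k - j) * omega n).

(* Main.v *)
(* Let g(F) be the mixed volume of n - j copies of K and j copies of the unit ball
   of F, up to the factor C(n, j).  For fixed F both bounds hold with g(F) in place
   of W_j(K), up to a factor depending on n, k and j only: approximating the ball
   of F by sums of segments, it suffices to treat the mixed volumes of K with j
   segments of F, and each segment projects the body along its direction.
   For a projection the comparison is that of the volumes of a symmetric body, of
   its section and of its shadow on the orthogonal space:
   |K| <= |P K| |K n F| by symmetry and |P K| |K n F| <= C(n, k) |K| by Rogers and
   Shephard.

   It remains to integrate g, by rotation invariance.  As in von Neumann's
   construction of the mean, some finite averages over rotations of the mixed
   volume of K with j orthonormal segments are almost constant; expanding the ball
   into segments, the same averages of Q |-> g(F Q) are close to a constant, common
   to all F, times the value for the ball.  Taking the whole space instead of F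
   identifies the constant as W_j(K) / omega_n, so the integral of g is an explicit
   multiple of W_j(K), which gives the factor alpha. *)

Require Import Defs.
From HB Require Import structures.
From mathcomp Require Import all_boot all_order all_algebra.
From mathcomp Require Import all_classical all_reals all_analysis.
From mathcomp Require Import perm measurable_realfun ring lra.

Set Implicit Arguments.
Unset Strict Implicit.
Unset Printing Implicit Defensive.

Import Order.TTheory GRing.Theory Num.Theory numFieldNormedType.Exports.

Local Open Scope classical_set_scope.
Local Open Scope ring_scope.

(** * Volume of compact sets *)

Section topology.
Context {R : realType}.

(** Volumes are iterated integrals, so what must be measurable is the volume of a section as a
    function of one coordinate; for compact sets this follows from upper semicontinuity, by
    induction on the dimension. The two binomials come from one inequality used in two dimensions.
    The body K and its projection L along j segments of F have the same shadow on the orthogonal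
    space, which can thus be eliminated between them: Rogers and Shephard for L, in dimension n - j,
    gives C(n - j, k), and for K, in dimension n, gives C(n, k). The passage from segments to the
    ball uses zonotopes, produced by the same finite averaging, applied to the absolute value of one
    matrix entry. Coefficients converge because p + 1 values determine a polynomial of degree p.
    Finite families of rotations suffice since each single rotation preserves the integral over the
    Grassmannian. When K is the unit ball, g is the same for all F: up to C(n - k, j) it is
    omega_(n-k) omega_(n-j) / omega_(n-k-j), and the omega_n of alpha comes from identifying the
    constant on the whole space. *)

Lemma mx_continuous (T : topologicalType) m n (f : T -> 'M[R]_(m, n)) :
  (forall i j, continuous (fun t => f t i j)) -> continuous f.
Proof.
move=> cf t A [P nP PA]; rewrite /nbhs /=.
have : \forall s \near t, forall i j, P i j (f s i j).
  apply: filter_forall => i; apply: filter_forall => j.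
  exact: cf (nP i j).
by apply: filterS => s Ps; apply: PA.
Qed.

Lemma sum_continuous (T : topologicalType) (I : Type) (r : seq I)
    (P : pred I) (f : I -> T -> R) :
  (forall i, continuous (f i)) ->
  continuous (fun t => \sum_(i <- r | P i) f i t).
Proof.
move=> cf; elim: r => [|i r IH].
  by under eq_fun do rewrite big_nil; move=> x; exact: cvg_cst.
under eq_fun do rewrite big_cons; case: (P i) => //.
move=> x; exact: cvgD (cf i x) (IH x).
Qed.

Lemma contM (T : topologicalType) (f g : T -> R) :
  continuous f -> continuous g -> continuous (fun t => f t * g t).
Proof. by move=> cf cg x; exact: cvgM (cf x) (cg x). Qed.

Lemma contD (T : topologicalType) (V : normedModType R) (f g : T -> V) :
  continuous f -> continuous g -> continuous (fun t => f t + g t).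
Proof. by move=> cf cg x; exact: cvgD (cf x) (cg x). Qed.

Lemma contZ (T : topologicalType) (V : normedModType R) (f : T -> R) (g : T -> V) :
  continuous f -> continuous g -> continuous (fun t => f t *: g t).
Proof. by move=> cf cg x; exact: cvgZ (cf x) (cg x). Qed.

Lemma cont_comp (T U V : topologicalType) (f : T -> U) (g : U -> V) :
  continuous f -> continuous g -> continuous (fun t => g (f t)).
Proof. by move=> cf cg x; exact: (@continuous_comp _ _ _ f g x (cf x) (cg _)). Qed.

Lemma cont_pair (T U V : topologicalType) (f : T -> U) (g : T -> V) :
  continuous f -> continuous g -> continuous (fun t => (f t, g t)).
Proof. by move=> cf cg x; exact: cvg_pair (cf x) (cg x). Qed.

Lemma cont_cst (T U : topologicalType) (u : U) : continuous (fun _ : T => u).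
Proof. by move=> x; exact: cvg_cst. Qed.

Lemma cont_id (T : topologicalType) : continuous (fun t : T => t).
Proof. by move=> x; exact: cvg_id. Qed.

Lemma cont_coord m n i j : continuous (fun v : 'M[R]_(m, n) => v i j).
Proof. exact: coord_continuous. Qed.

Lemma cont_fst (T U : topologicalType) : continuous (fun p : T * U => p.1).
Proof. by move=> x; exact: cvg_fst. Qed.

Lemma cont_snd (T U : topologicalType) : continuous (fun p : T * U => p.2).
Proof. by move=> x; exact: cvg_snd. Qed.

Lemma cont_mulmx (T : topologicalType) m n p (f : T -> 'M[R]_(m, n))
    (g : T -> 'M[R]_(n, p)) :
  continuous f -> continuous g -> continuous (fun t => f t *m g t).
Proof.
move=> cf cg; apply: mx_continuous => i j; under eq_fun do rewrite mxE.
apply: sum_continuous => k.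
by apply: contM; [exact: (cont_comp cf (@cont_coord _ _ i k)) | exact: (cont_comp cg (@cont_coord _ _ k j))].
Qed.

Lemma closed_preimage (T U : topologicalType) (f : T -> U) (A : set U) :
  continuous f -> closed A -> closed (f @^-1` A).
Proof. by move=> cf; apply: closed_comp => x _; exact: cf. Qed.

(** A continuous left inverse [g] confines the closed preimage to the image of [A] under [g], which
    is compact. Compactness of sections, linear preimages and permuted sets is obtained in this
    way. *)
Lemma compact_preimage_cancel (T U : topologicalType) (f : T -> U) (g : U -> T)
    (A : set U) :
  hausdorff_space U -> continuous f -> continuous g -> cancel f g ->
  compact A -> compact (f @^-1` A).
Proof.
move=> hU cf cg fK cA.
apply: (@subclosed_compact _ _ (g @` A)).
- exact: closed_preimage cf (compact_closed hU cA).
- by apply: continuous_compact => //; exact: continuous_subspaceT.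
- by move=> x Afx; exists (f x) => //.
Qed.

Lemma compact_image (T U : topologicalType) (f : T -> U) (A : set T) :
  continuous f -> compact A -> compact (f @` A).
Proof. by move=> cf; apply: continuous_compact; exact: continuous_subspaceT. Qed.

End topology.

(** * Splitting off the first coordinate *)

Section cons_row.
Context {R : realType}.

Definition cons_row n (x : R) (y : 'rV[R]_n) : 'rV[R]_n.+1 :=
  row_mx (x%:M : 'rV_1) y.
Definition tail n (v : 'rV[R]_n.+1) : 'rV[R]_n := \row_i v 0 (lift ord0 i).

Lemma cons_row0 n x (y : 'rV[R]_n) : cons_row x y 0 0 = x.
Proof.
rewrite /cons_row (_ : 0 = lshift n (0 : 'I_1)); last exact: val_inj.
by rewrite (row_mxEl (x%:M : 'rV_1)) mxE eqxx mulr1n.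
Qed.

Lemma cons_rowS n x (y : 'rV[R]_n) i : cons_row x y 0 (lift ord0 i) = y 0 i.
Proof.
rewrite /cons_row (_ : lift ord0 i = rshift 1 i); last exact: val_inj.
by rewrite (row_mxEr (x%:M : 'rV_1)).
Qed.

Lemma tail_cons n x (y : 'rV[R]_n) : tail (cons_row x y) = y.
Proof. by apply/rowP => i; rewrite mxE cons_rowS. Qed.

Lemma cons_row_eta n (v : 'rV[R]_n.+1) : cons_row (v 0 0) (tail v) = v.
Proof.
apply/rowP => i; case: (unliftP 0 i) => [j|] ->; last by rewrite cons_row0.
by rewrite cons_rowS mxE.
Qed.

Lemma cons_row_inj n x x' (y y' : 'rV[R]_n) :
  cons_row x y = cons_row x' y' -> x = x' /\ y = y'.
Proof.
by move=> e; split; [rewrite -(cons_row0 x y) e cons_row0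
                    |rewrite -(tail_cons x y) e tail_cons].
Qed.

Lemma cons_rowD n x x' (y y' : 'rV[R]_n) :
  cons_row x y + cons_row x' y' = cons_row (x + x') (y + y').
Proof.
rewrite -[LHS]cons_row_eta; congr cons_row; first by rewrite mxE !cons_row0.
by apply/rowP => i; rewrite 2!mxE !cons_rowS mxE.
Qed.

Lemma cons_rowZ n a x (y : 'rV[R]_n) :
  a *: cons_row x y = cons_row (a * x) (a *: y).
Proof.
rewrite -[LHS]cons_row_eta; congr cons_row; first by rewrite mxE !cons_row0.
by apply/rowP => i; rewrite 2!mxE !cons_rowS mxE.
Qed.

Lemma cons_rowN n x (y : 'rV[R]_n) : - cons_row x y = cons_row (- x) (- y).
Proof. by rewrite -scaleN1r cons_rowZ mulN1r scaleN1r. Qed.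

Lemma tailD n (u v : 'rV[R]_n.+1) : tail (u + v) = tail u + tail v.
Proof. by apply/rowP => i; rewrite !mxE. Qed.

Lemma tailZ n a (u : 'rV[R]_n.+1) : tail (a *: u) = a *: tail u.
Proof. by apply/rowP => i; rewrite !mxE. Qed.

Lemma tailN n (u : 'rV[R]_n.+1) : tail (- u) = - tail u.
Proof. by apply/rowP => i; rewrite !mxE. Qed.

Lemma tail0 n : tail (0 : 'rV[R]_n.+1) = 0.
Proof. by apply/rowP => i; rewrite !mxE. Qed.

Lemma cons_row_continuous n (T : topologicalType) (f : T -> R) (g : T -> 'rV[R]_n) :
  continuous f -> continuous g -> continuous (fun t => cons_row (f t) (g t)).
Proof.
move=> cf cg; apply: mx_continuous => i j; rewrite ord1.
case: (unliftP 0 j) => [k|] ->.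
  under eq_fun do rewrite cons_rowS.
  exact: (cont_comp cg (@cont_coord _ _ _ 0 k)).
by under eq_fun do rewrite cons_row0.
Qed.

Lemma tail_continuous n : continuous (@tail n).
Proof.
apply: mx_continuous => i j; under eq_fun do rewrite mxE.
exact: cont_coord.
Qed.

Lemma coord_le_norm m n (v : 'M[R]_(m, n)) i j : `|v i j| <= `|v|.
Proof.
by rewrite [leRHS]/Num.norm /= mx_normrE (le_bigmax _ (fun p => `|v p.1 p.2|) (i, j)).
Qed.

Lemma norm_le_coord m n (v : 'M[R]_(m, n)) (e : R) : 0 <= e ->
  (forall i j, `|v i j| <= e) -> `|v| <= e.
Proof.
by move=> e0 h; rewrite [leLHS]/Num.norm /= mx_normrE; apply/bigmax_leP; split.
Qed.

Lemma compact_closed_rV n (K : set 'rV[R]_n) : compact K -> closed K.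
Proof. by apply: compact_closed; exact: norm_hausdorff. Qed.

Definition fiber n (A : set 'rV[R]_n.+1) (x : R) : set 'rV[R]_n :=
  [set y | A (cons_row x y)].

Lemma compact_fiber n (K : set 'rV[R]_n.+1) x : compact K -> compact (fiber K x).
Proof.
apply: (@compact_preimage_cancel _ _ (cons_row x) (@tail n)).
- exact: norm_hausdorff.
- by apply: cons_row_continuous; [exact: cont_cst | exact: cont_id].
- exact: tail_continuous.
- exact: tail_cons.
Qed.

End cons_row.

(** * Monotonicity and finiteness of the volume *)

Section vol_basics.
Context {R : realType}.
Local Open Scope ereal_scope.

(** The integral of a nonnegative function is a supremum over the simple functions below it, so
    monotonicity holds for arbitrary functions. This gives [le_vol] for all sets, whatever the
    regularity of their sections. *)
Lemma ge0_le_integralT d (T : measurableType d) (mu : {measure set T -> \bar R})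
    (f g : T -> \bar R) :
  (forall x, 0 <= f x) -> (forall x, f x <= g x) ->
  \int[mu]_x f x <= \int[mu]_x g x.
Proof.
move=> f0 fg; rewrite !ge0_integralTE//; last by move=> x; exact: le_trans (f0 x) (fg x).
apply: le_ereal_sup => _ [h hf <-]; exists h => // x.
exact: le_trans (hf x) (fg x).
Qed.

Lemma volS n (A : set 'rV[R]_n.+1) :
  vol A = \int[lebesgue_measure]_(x in [set: R]) vol (fiber A x).
Proof. by []. Qed.

Lemma vol_ge0 n (A : set 'rV[R]_n) : 0 <= vol A.
Proof.
elim: n A => [|n IH] A /=; first by rewrite lee_fin indicE ler0n.
by apply: integral_ge0 => x _; exact: IH.
Qed.

Lemma le_vol n (A B : set 'rV[R]_n) : A `<=` B -> vol A <= vol B.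
Proof.
elim: n A B => [|n IH] A B AB /=.
  by rewrite lee_fin !indicE ler_nat; case: (boolP (_ \in A)) => // /set_mem/AB/mem_set ->.
by apply: ge0_le_integralT => x; [exact: vol_ge0 | apply: IH => y; exact: AB].
Qed.

Lemma vol0 n : vol (set0 : set 'rV[R]_n) = 0.
Proof.
elim: n => [|n IH] /=; first by rewrite indic0.
rewrite -[RHS](@integral0 _ _ R lebesgue_measure setT).
by apply: eq_integral => x _; exact: IH.
Qed.

Definition box n (M : R) : set 'rV[R]_n := [set v | forall i, `[(- M)%R, M]%classic (v 0%R i)].

Lemma fiber_box n (M x : R) :
  fiber (@box n.+1 M) x = if x \in `[(- M)%R, M]%R then @box n M else set0.
Proof.
case: ifPn => [xM|/negP xM]; apply/seteqP; split => y.
- by move=> h i; have := h (lift ord0 i); rewrite cons_rowS.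
- move=> h i; case: (unliftP 0%R i) => [j|] ->; first by rewrite cons_rowS; exact: h.
  by rewrite cons_row0.
- by move=> h; have := h 0%R; rewrite cons_row0.
- by [].
Qed.

Lemma vol_box n (M : R) : (0 <= M)%R -> vol (@box n M) = ((M *+ 2) ^+ n)%:E.
Proof.
move=> M0; elim: n => [|n IH].
  by rewrite /= expr0 indicE mem_set// => -[].
rewrite volS.
under eq_integral => x _.
  rewrite fiber_box (_ : vol _ = ((M *+ 2) ^+ n)%:E * (\1_(`[(- M)%R, M]%classic) x)%:E).
    over.
  rewrite indicE mem_setE; case: ifPn => _; first by rewrite mule1.
  by rewrite vol0 mule0.
rewrite ge0_integralZl//=; last 2 first.
- by apply/measurable_EFinP; exact: measurable_indic.
- by rewrite lee_fin exprn_ge0// mulrn_wge0.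
rewrite integral_indic//= setIT lebesgue_measure_itv/= lte_fin.
case: ltP => [_|M0'].
  by rewrite -EFinB -EFinM exprSr opprK -mulr2n.
have -> : M = 0%R by lra.
by rewrite mul0rn exprS mul0r mule0.
Qed.

Lemma compact_box n (K : set 'rV[R]_n) : compact K ->
  exists2 M : R, (0 <= M)%R & K `<=` box M.
Proof.
move=> /compact_bounded [M [Mr h]]; exists (`|M| + 1)%R; first by rewrite addr_ge0.
move=> v Kv i; rewrite /= in_itv/= -ler_norml.
apply: le_trans (coord_le_norm v 0%R i) _.
apply: h => //; rewrite (le_lt_trans (ler_norm _))// ltrDl//.
Qed.

Lemma vol_lty n (K : set 'rV[R]_n) : compact K -> vol K < +oo.
Proof.
move=> /compact_box[M M0 KM]; apply: le_lt_trans (le_vol KM) _.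
by rewrite vol_box// ltry.
Qed.

Lemma volumeE n (K : set 'rV[R]_n) : compact K -> vol K = (volume K)%:E.
Proof. by move=> cK; rewrite fineK// ge0_fin_numE ?vol_ge0 ?vol_lty. Qed.

End vol_basics.

(** * Measurability of section volumes of compact sets *)

Section semicontinuity.
Context {R : realType}.
Local Open Scope ereal_scope.

Lemma measurable_sublevel d (T : measurableType d) (f : T -> \bar R) :
  (forall a : R, measurable [set t | f t < a%:E]) -> measurable_fun setT f.
Proof.
move=> mf; apply: (measurability _ (ErealGenInftyO.measurableE R)).
move=> /= _ [_ [a ->]] <-; apply: measurableI => //.
by rewrite preimage_itvNyo; exact: mf.
Qed.

(** An open subset of the plane is the union of the rational squares that it contains, a countable
    family of products of intervals. *)
Lemma open_measurable2 (A : set (R * R)) : open A -> measurable A.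
Proof.
move=> oA.
pose B (a b e : rat) : set (R * R) :=
  `](ratr a - ratr e)%R, (ratr a + ratr e)%R[%classic `*`
  `](ratr b - ratr e)%R, (ratr b + ratr e)%R[%classic.
pose B' a b e := if `[< B a b e `<=` A >] then B a b e else set0.
have -> : A = \bigcup_a \bigcup_b \bigcup_e B' a b e.
  apply/seteqP; split; last first.
    move=> p [a _ [b _ [e _]]]; rewrite /B'.
    by case: asboolP => // h; exact: h.
  move=> [x y] Axy; have := open_nbhs_nbhs (conj oA Axy).
  move=> /nbhs_ballP[r /= r0 rA].
  have r20 : (0 < r / 2)%R by rewrite divr_gt0.
  have [e] := rat_in_itvoo r20; rewrite in_itv/= => /andP[e0 er].
  have [a] := @rat_in_itvoo R (x - ratr e)%R (x + ratr e)%R ltac:(lra).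
  rewrite in_itv/= => /andP[a1 a2].
  have [b] := @rat_in_itvoo R (y - ratr e)%R (y + ratr e)%R ltac:(lra).
  rewrite in_itv/= => /andP[b1 b2].
  exists a => //; exists b => //; exists e => //; rewrite /B' asboolT.
    by split => /=; rewrite in_itv/=; apply/andP; split; lra.
  move=> [u v] [/=]; rewrite !in_itv/= => /andP[u1 u2] /andP[v1 v2].
  by apply: rA; split => /=; rewrite /ball/= ltr_norml; apply/andP; split; lra.
apply: bigcupT_measurable_rat => a; apply: bigcupT_measurable_rat => b.
apply: bigcupT_measurable_rat => e; rewrite /B'; case: ifP => // _.
by apply: measurableX; exact: measurable_itv.
Qed.

(** Continuity from above along compact sets. It has a name because it is proved jointly with
    measurability: in dimension n it makes the section volumes in dimension n.+1 measurable, which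
    dominated convergence then needs to reach n.+1. *)
Definition vol_decreasing n := forall A : nat -> set 'rV[R]_n,
  (forall i, compact (A i)) -> (forall i, A i.+1 `<=` A i) ->
  vol (A i) @[i --> \oo] --> vol (\bigcap_i A i).

(** The unions of the sections over closed balls around [t] are compact and decrease to the section
    at [t], so some union already has volume below [a], and it contains all nearby sections. [T] is
    the line for [measurable_fiber] and the plane for [measurable_fiber2]. *)
Lemma vol_usc_of n (T : normedModType R) (G : set (T * 'rV[R]_n)) a :
  vol_decreasing n -> compact G ->
  open [set t | vol [set y | G (t, y)] < a].
Proof.
move=> dec cG; rewrite openE => t /= Ha.
pose C i := closure (ball t (i.+1%:R^-1 : R)).
pose A i := snd @` (G `&` (C i `*` setT)).
have hTV : hausdorff_space (T * 'rV[R]_n)%type by exact: norm_hausdorff.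
have cA i : compact (A i).
  apply: compact_image; first exact: cont_snd.
  apply: compact_closedI => //.
  rewrite (_ : _ `*` _ = fst @^-1` C i); last by apply/seteqP; split => -[] ? ? // [].
  by apply: closed_preimage; [exact: cont_fst | exact: closed_closure].
have dA i : A i.+1 `<=` A i.
  move=> y [[s z] [Gsz [/= Cs _]] /= zy]; exists (s, z) => //; split => //.
  split => //=; move: Cs; apply: closure_subset; apply: le_ball.
  by rewrite lef_pV2 ?posrE// ler_nat.
have capA : \bigcap_i A i `<=` [set y | G (t, y)].
  move=> y hy; apply: (compact_closed hTV cG) => U.
  move=> [[U1 U2] [/= /nbhs_ballP[e /= e0 U1e] nU2] U12].
  have e20 : (0 < e / 2)%R by rewrite divr_gt0.
  pose i := Num.truncn (e / 2)^-1.
  have [] := hy i Logic.I => -[s z] [Gsz [/= Cs _]] /= zy.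
  exists (s, z); split => //; apply: U12; split => /=; last first.
    by rewrite zy; exact: nbhs_singleton.
  apply: U1e.
  have [w [bw bsw]] := Cs (ball s (e / 2)) (nbhsx_ballx _ _ e20).
  rewrite (splitr e); apply: (@ball_triangle _ _ w); last by apply: ball_sym.
  apply: le_ball bw; rewrite invf_ple ?posrE//; apply: ltW.
  by rewrite Num.Theory.truncnS_gt.
have := dec A cA dA; set c := vol (\bigcap_i A i) => Ac.
have ca : c < a by apply: le_lt_trans Ha; exact: le_vol.
have [i _ hi] : \forall i \near \oo, vol (A i) < a.
  exact: (Ac _ (open_nbhs_nbhs (conj (@open_ereal_lt_ereal R a) ca))).
suff : nbhs t [set t | vol [set y | G (t, y)] < a] by [].
apply/nbhs_ballP; exists (i.+1%:R^-1)%R => /=; first by rewrite invr_gt0.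
move=> s ts /=; apply: le_lt_trans (hi i (leqnn i)).
apply: le_vol => y /= Gsy; exists (s, y) => //; split => //; split => //=.
exact: subset_closure.
Qed.

Lemma fiber_usc_of n (K : set 'rV[R]_n.+1) :
  vol_decreasing n -> compact K -> measurable_fun [set: R] (fun x => vol (fiber K x)).
Proof.
move=> dec cK; apply: measurable_sublevel => a; apply: open_measurable.
pose G : set (R * 'rV[R]_n) := [set p | K (cons_row p.1 p.2)].
have := @vol_usc_of n R^o G a%:E dec; apply.
apply: (@compact_preimage_cancel _ _ (fun p : R^o * 'rV[R]_n => cons_row p.1 p.2)
   (fun v : 'rV[R]_n.+1 => (v 0 0, tail v)%R)) => //.
- by apply: cons_row_continuous; [exact: cont_fst | exact: cont_snd].
- by apply: cont_pair; [exact: cont_coord | exact: tail_continuous].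
- by move=> [x y] /=; rewrite cons_row0 tail_cons.
Qed.

Lemma vol_decr n : vol_decreasing n.
Proof.
elim: n => [|n IH] A cA dA.
  (* In dimension 0 the volume only records whether the origin belongs to the set, so the sequence
     is eventually constant. *)
  have [[i nAi]|hA] := pselect (exists i, ~ A i 0%R).
    have -> : vol (\bigcap_i A i) = 0.
      by rewrite /= indicE memNset//= => /(_ i Logic.I).
    apply: cvg_near_cst; exists i => // j /= ij; rewrite indicE memNset//.
    move=> Aj; apply: nAi; move: ij Aj; elim: j => [|j IHj].
      by rewrite leqn0 => /eqP ->.
    by rewrite leq_eqVlt => /predU1P[<-//|]; rewrite ltnS => ij /dA; exact: IHj.
  have hA' i : A i 0%R by apply: contrapT => nA; apply: hA; exists i.
  have -> : vol (\bigcap_i A i) = 1 by rewrite /= indicE mem_set.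
  by apply: cvg_near_cst; exists 0%N => // i _ /=; rewrite indicE mem_set.
have mf (K : set 'rV[R]_n.+1) : compact K -> measurable_fun [set: R] (fun x => vol (fiber K x)).
  exact: fiber_usc_of.
have A0 i : A i `<=` A 0%N by elim: i => // i h; exact: subset_trans (dA i) h.
have cap x : fiber (\bigcap_i A i) x = \bigcap_i fiber (A i) x by [].
have cc : compact (\bigcap_i A i).
  apply: (@subclosed_compact _ _ (A 0%N)) => //; last by move=> x; exact.
  by apply: closed_bigI => i _; exact: compact_closed_rV.
have [] := @dominated_convergence _ _ R (@lebesgue_measure R) setT measurableT
  (fun i x => vol (fiber (A i) x)) (fun x => vol (fiber (\bigcap_i A i) x))
  (fun x => vol (fiber (A 0%N) x)) => //.
- by move=> i; exact: mf.
- exact: mf.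
- apply: aeW => x _; rewrite cap; apply: IH.
    by move=> i; exact: compact_fiber.
  by move=> i y; exact: dA.
- apply/integrableP; split; first exact: mf.
  under eq_integral do rewrite gee0_abs ?vol_ge0//.
  have := vol_lty (cA 0%N); rewrite volS; exact.
- apply: aeW => x i _; rewrite gee0_abs ?vol_ge0//.
  by apply: le_vol => y; exact: A0.
Qed.

Lemma measurable_fiber n (K : set 'rV[R]_n.+1) :
  compact K -> measurable_fun [set: R] (fun x => vol (fiber K x)).
Proof. by move=> cK; apply: fiber_usc_of => //; exact: vol_decr. Qed.

Lemma measurable_fiber2 n (K : set 'rV[R]_n.+2) : compact K ->
  measurable_fun [set: R * R] (fun p => vol (fiber (fiber K p.1) p.2)).
Proof.
move=> cK; apply: measurable_sublevel => a; apply: open_measurable2.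
pose G : set (R^o * R^o * 'rV[R]_n) := [set p | K (cons_row p.1.1 (cons_row p.1.2 p.2))].
have := @vol_usc_of n (R^o * R^o)%type G a%:E (@vol_decr n); apply.
apply: (@compact_preimage_cancel _ _
   (fun p : R^o * R^o * 'rV[R]_n => cons_row p.1.1 (cons_row p.1.2 p.2))
   (fun v : 'rV[R]_n.+2 => (v 0 0, tail v 0 0, tail (tail v))%R)) => //.
- have c1 : continuous (fun p : R^o * R^o * 'rV[R]_n => p.1) by exact: cont_fst.
  apply: cons_row_continuous; first exact: (cont_comp c1 (@cont_fst _ _)).
  by apply: cons_row_continuous; [exact: (cont_comp c1 (@cont_snd _ _)) | exact: cont_snd].
- apply: cont_pair.
    apply: cont_pair; first exact: cont_coord.
    exact: (cont_comp (@tail_continuous _ _) (@cont_coord _ _ _ _ _)).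
  exact: (cont_comp (@tail_continuous _ _) (@tail_continuous _ _)).
- by move=> [[x y] z] /=; rewrite !(cons_row0, tail_cons).
Qed.

End semicontinuity.

Arguments vol : simpl never.

(** * Affine substitutions, translations and exchange of coordinates *)

Section linear_change_of_variables.
Context {R : realType}.
Local Open Scope ereal_scope.

Let mu := @lebesgue_measure R.

Lemma measurable_affine (a b : R) :
  measurable_fun [set: measurableTypeR R] (fun x : measurableTypeR R => (a * x + b)%R : measurableTypeR R).
Proof.
apply: (@continuous_measurable_fun R).
apply: contD; last exact: cont_cst.
by apply: contM; [exact: cont_cst | exact: cont_id].
Qed.

(** The pushforward of Lebesgue measure by x |-> a x + b, multiplied by |a|, gives each half-open
    interval its length, hence is Lebesgue measure by uniqueness. The signs of [a] are separated
    because a negative [a] moves the closed end of the interval. *)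
Lemma integral_affine (a b : R) (f : R -> \bar R) : (a != 0)%R ->
  measurable_fun [set: R] f -> (forall x, 0 <= f x) ->
  `|a|%:E * \int[mu]_x f (a * x + b)%R = \int[mu]_x f x.
Proof.
move=> a0 mf f0.
pose phi (x : measurableTypeR R) : measurableTypeR R := (a * x + b)%R.
have mphi : measurable_fun setT phi by exact: measurable_affine.
pose m0 := measure_function_pushforward__canonical__measure_function_Measure mu mphi.
pose m := mscale (NngNum (normr_ge0 a)) m0.
transitivity (\int[m]_x f x).
  by rewrite /m ge0_integral_mscale//= ge0_integral_pushforward.
apply: eq_measure_integral => A mA _.
apply/esym/(@lebesgue_measure_unique R m) => //= _ [[c d] _ <-].
rewrite /m /mscale/= /pushforward/=.
have agt0 : (0 < `|a|)%R by rewrite normr_gt0.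
have := a0; rewrite neq_lt => /orP[an|ap].
- have -> : phi @^-1` `]c, d]%classic = `[((d - b) / a)%R, ((c - b) / a)%R[%classic.
    apply/seteqP; split => x; rewrite /phi/= !in_itv/= => /andP[x1 x2]; apply/andP; split.
    + by rewrite ler_ndivrMr// mulrC; lra.
    + by rewrite ltr_ndivlMr// mulrC; lra.
    + by move: x2; rewrite ltr_ndivlMr// mulrC; lra.
    + by move: x1; rewrite ler_ndivrMr// mulrC; lra.
  rewrite !lebesgue_measure_itv/= !lte_fin ltr_nM2r ?invr_lt0// ltrD2r.
  case: ifPn => _; last by rewrite mule0.
  by rewrite -!EFinB -EFinM ltr0_norm//; congr EFin; field.
- have -> : phi @^-1` `]c, d]%classic = `]((c - b) / a)%R, ((d - b) / a)%R]%classic.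
    apply/seteqP; split => x; rewrite /phi/= !in_itv/= => /andP[x1 x2]; apply/andP; split.
    + by rewrite ltr_pdivrMr// mulrC; lra.
    + by rewrite ler_pdivlMr// mulrC; lra.
    + by move: x1; rewrite ltr_pdivrMr// mulrC; lra.
    + by move: x2; rewrite ler_pdivlMr// mulrC; lra.
  rewrite !lebesgue_measure_itv/= !lte_fin ltr_pM2r ?invr_gt0// ltrD2r.
  case: ifPn => _; last by rewrite mule0.
  by rewrite -!EFinB -EFinM gtr0_norm//; congr EFin; field.
Qed.

Lemma vol_translate n (A : set 'rV[R]_n) v : compact A ->
  vol [set y | A (y + v)%R] = vol A.
Proof.
elim: n A v => [|n IH] A v cA.
  have yv (y : 'rV[R]_0) : (y + v)%R = y by apply/rowP => -[].
  by congr vol; apply/seteqP; split => y /=; rewrite yv.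
rewrite !volS -(@integral_affine 1 (v 0%R 0%R) (fun x => vol (fiber A x))) ?oner_neq0//.
- rewrite normr1 mul1e; apply: eq_integral => x _.
  rewrite -[RHS](IH _ (tail v)); last exact: compact_fiber.
  have e y : (cons_row x y + v)%R = cons_row (1 * x + v 0%R 0%R)%R (y + tail v)%R.
    by rewrite -[in LHS](cons_row_eta v) cons_rowD mul1r.
  by congr vol; apply/seteqP; split => y; rewrite /fiber/= e.
- exact: measurable_fiber.
- by move=> x; exact: vol_ge0.
Qed.

Lemma vol_swap n (A B : set 'rV[R]_n.+2) : compact A ->
  (forall x y, fiber (fiber B x) y = fiber (fiber A y) x) -> vol B = vol A.
Proof.
move=> cA AB.
transitivity (\int[mu]_x \int[mu]_y vol (fiber (fiber A y) x)).
  rewrite volS; apply: eq_integral => x _; rewrite volS.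
  by apply: eq_integral => y _; rewrite AB.
rewrite -(@fubini_tonelli _ _ _ _ _ mu mu (fun p => vol (fiber (fiber A p.1) p.2)))//.
- exact: measurable_fiber2.
- by move=> x; exact: vol_ge0.
Qed.

End linear_change_of_variables.

(** * Volume and determinants *)

Section linear_invariance.
Context {R : realType}.

Lemma compact_preimage_mulmx n p (M : 'M[R]_(n, p)) (N : 'M[R]_(p, n))
    (K : set 'rV[R]_p) :
  M *m N = 1%:M -> compact K -> compact [set y : 'rV_n | K (y *m M)].
Proof.
move=> MN; apply: (@compact_preimage_cancel 'rV[R]_n 'rV[R]_p (fun y => y *m M) (fun y => y *m N)).
- exact: norm_hausdorff.
- by apply: cont_mulmx; [exact: cont_id | exact: cont_cst].
- by apply: cont_mulmx; [exact: cont_id | exact: cont_cst].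
- by move=> y; rewrite -mulmxA MN mulmx1.
Qed.

Definition scales_vol n (M : 'M[R]_n) := forall K : set 'rV[R]_n, compact K ->
  (vol K = `|\det M|%:E * vol [set y | K (y *m M)])%E.

Lemma scales_vol1 n : scales_vol (1%:M : 'M[R]_n).
Proof.
move=> K cK; rewrite det1 normr1 mul1e; congr vol.
by apply/seteqP; split => y /=; rewrite mulmx1.
Qed.

(** The determinant is multiplicative, and the preimage under [A *m M] is the preimage under [A] of
    the preimage under [M]. This strips elementary factors off the left of a matrix. *)
Lemma scales_vol_cancel n (A M : 'M[R]_n) : M \in unitmx ->
  scales_vol A -> scales_vol (A *m M) -> scales_vol M.
Proof.
move=> uM gA gAM K cK; rewrite (gAM K cK) det_mulmx normrM EFinM.
have cK' : compact [set y | K (y *m M)].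
  by apply: (@compact_preimage_mulmx _ _ _ (invmx M)) => //; rewrite mulmxV.
rewrite (gA _ cK') muleA [(`|\det M|%:E * _)%E]muleC; congr (_ * vol _)%E.
by apply/seteqP; split => y /=; rewrite mulmxA.
Qed.

Lemma cons_row_mul_block n (a : R) (r : 'rV[R]_n) (M : 'M[R]_n) x y :
  cons_row x y *m (block_mx (a%:M : 'M[R]_1) r 0 M : 'M[R]_n.+1) =
  cons_row (a * x) (y *m M + x *: r).
Proof.
rewrite /cons_row (mul_row_block (x%:M : 'M[R]_1) y (a%:M : 'M[R]_1) r 0 M) mulmx0 addr0.
by rewrite -scalar_mxM mulrC mul_scalar_mx addrC.
Qed.

(** The fiber of the preimage at x is, up to a translation depending on x, the preimage under [M] of
    the fiber of [K] at a x: the first coordinate contributes |a|, the others the determinant of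
    [M]. *)
Lemma scales_vol_block n (a : R) (r : 'rV[R]_n) (M : 'M[R]_n) : a != 0 ->
  M \in unitmx -> scales_vol M ->
  scales_vol (block_mx (a%:M : 'M[R]_1) r 0 M : 'M[R]_n.+1).
Proof.
move=> a0 uM gM K cK.
rewrite !volS (det_ublock (a%:M : 'M[R]_1)) det_scalar expr1 normrM EFinM.
rewrite -(@integral_affine _ a 0 (fun x => vol (fiber K x)))//; last 2 first.
- exact: measurable_fiber.
- by move=> x; exact: vol_ge0.
rewrite -muleA; congr (_ * _)%E.
have mK : measurable_fun [set: R]
    (fun x => vol (fiber [set y | K (y *m (block_mx (a%:M : 'M[R]_1) r 0 M : 'M[R]_n.+1))] x)).
  apply: measurable_fiber.
  apply: (@compact_preimage_mulmx _ _ _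
    (invmx (block_mx (a%:M : 'M[R]_1) r 0 M : 'M[R]_n.+1))) => //.
  rewrite mulmxV// unitmxE (det_ublock (a%:M : 'M[R]_1)) det_scalar expr1 unitrM.
  by rewrite unitfE a0 -unitmxE.
rewrite -ge0_integralZl//; last by move=> x _; exact: vol_ge0.
apply: eq_integral => x _; rewrite addr0.
have cf := @compact_fiber _ _ K (a * x) cK.
rewrite (gM _ cf); congr (_ * _)%E.
rewrite -[LHS](vol_translate (x *: r *m invmx M)); last first.
  by apply: (@compact_preimage_mulmx _ _ _ (invmx M)) => //; rewrite mulmxV.
congr vol; apply/seteqP; split => y; rewrite /fiber/= cons_row_mul_block;
  by rewrite mulmxDl mulmxKV.
Qed.

Lemma tperm_mxE n (x : R) (y : R) (z : 'rV[R]_n) :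
  cons_row x (cons_row y z) *m tperm_mx 0 (lift 0 0) = cons_row y (cons_row x z).
Proof.
rewrite -xcolE; apply/rowP => i; rewrite mxE.
case: (unliftP 0 i) => [j|] ->; last first.
  by rewrite tpermL cons_rowS !cons_row0.
case: (unliftP 0 j) => [k|] ->; last by rewrite tpermR cons_rowS !cons_row0.
by rewrite tpermD ?cons_rowS// -?val_eqE.
Qed.

Lemma scales_vol_swap n : scales_vol (tperm_mx 0 (lift 0 0) : 'M[R]_n.+2).
Proof.
move=> K cK; rewrite det_perm odd_tperm/= expr1 normrN normr1 mul1e.
apply/esym/vol_swap => // x y; apply/seteqP.
by split => z; rewrite /fiber/= tperm_mxE.
Qed.

(** Gaussian elimination on the first column: block triangular matrices are treated by induction,
    and any other matrix becomes one after left multiplication by [D], [E] and a transposition,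
    which all scale volumes by their determinants. *)
Lemma vol_linear_preimage n (M : 'M[R]_n) : M \in unitmx -> scales_vol M.
Proof.
elim: n M => [|n IH] M uM.
  move=> K cK; rewrite det_mx00 normr1 mul1e; congr vol.
  have e (y : 'rV[R]_0) : y *m M = y by apply/rowP => -[].
  by apply/seteqP; split => y /=; rewrite e.
have up (N : 'M[R]_(1 + n)) : N \in unitmx -> dlsubmx N = 0 -> scales_vol (N : 'M[R]_n.+1).
  move=> uN N0; rewrite -(submxK N) N0 in uN *.
  rewrite [ulsubmx N]mx11_scalar in uN *.
  move: uN; rewrite unitmxE (det_ublock (_%:M : 'M[R]_1)) det_scalar expr1 unitrM.
  move=> /andP[]; rewrite unitfE => u1 u2.
  by apply: scales_vol_block => //; apply: IH; rewrite unitmxE.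
have [d0|d0] := eqVneq (dlsubmx (M : 'M[R]_(1 + n))) 0; first exact: up.
case: n => [|m] in M uM IH up d0 *.
  by case/eqP: d0; apply/matrixP => -[].
set a := ulsubmx (M : 'M[R]_(1 + m.+1)); set d := dlsubmx (M : 'M[R]_(1 + m.+1)).
(* The part [d] of the first column below the corner is nonzero, hence of rank 1; its rank
   factorization gives an invertible [B] that sends it to a multiple of the first basis column. *)
have [B [uB [u [u0 Bd]]]] : exists B : 'M[R]_m.+1, B \in unitmx /\
    exists u : R, u != 0 /\ B *m d = u *: delta_mx 0 0.
  exists (invmx (col_ebase d)); rewrite unitmx_inv col_ebase_unit; split => //.
  exists (row_ebase d 0 0).
  have rd : \rank d = 1%N.
    apply/eqP; rewrite eqn_leq rank_leq_col/= lt0n mxrank_eq0//.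
  split.
    apply: contra_neq d0 => e; rewrite -/d -(mulmx_ebase d).
    by rewrite [row_ebase d]mx11_scalar e raddf0 mulmx0.
  rewrite -{2}(mulmx_ebase d) -mulmxA mulKmx ?col_ebase_unit// rd.
  rewrite [row_ebase d]mx11_scalar mul_mx_scalar mxE eqxx mulr1n; congr (_ *: _).
  apply/matrixP => i j; rewrite !mxE ord1 /= eqxx andbT.
  by rewrite -val_eqE/=; case: (nat_of_ord i).
pose D : 'M[R]_m.+2 := block_mx (1%:M : 'M[R]_1) 0 0 B.
(* [E] adds the multiple of the second row that cancels the corner [a]; the swap [S] then moves the
   only nonzero entry [u] of the first column to the top. *)
pose E : 'M[R]_m.+2 := block_mx (1%:M : 'M[R]_1) ((- (a 0 0) / u) *: delta_mx 0 0) 0 1%:M.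
pose S : 'M[R]_m.+2 := tperm_mx 0 (lift 0 0).
have gD : scales_vol D by apply: scales_vol_block; rewrite ?oner_neq0//; exact: IH.
have gE : scales_vol E.
  by apply: scales_vol_block; rewrite ?oner_neq0 ?unitmx1//; exact: scales_vol1.
have uD : D \in unitmx by rewrite unitmxE (det_ublock (1%:M : 'M[R]_1)) det1 mul1r -unitmxE.
have uE : E \in unitmx by rewrite unitmxE (det_ublock (1%:M : 'M[R]_1)) !det1 mul1r unitr1.
have uS : S \in unitmx by rewrite /S unitmx_perm.
apply: (scales_vol_cancel uM gD).
have uDM : D *m M \in unitmx by rewrite unitmx_mul uD.
apply: (scales_vol_cancel uDM gE).
have uEDM : E *m (D *m M) \in unitmx by rewrite unitmx_mul uE.
apply: (scales_vol_cancel uEDM (@scales_vol_swap m)).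
apply: up; first by rewrite unitmx_mul uS.
set b := ursubmx (M : 'M[R]_(1 + m.+1)); set e := drsubmx (M : 'M[R]_(1 + m.+1)).
have DM : D *m M = block_mx a b (u *: delta_mx 0 0) (B *m e).
  rewrite -(submxK (M : 'M[R]_(1 + m.+1))) -/a -/b -/d -/e.
  rewrite [LHS](mulmx_block (1%:M : 'M[R]_1) 0 0 B a b d e).
  by rewrite !mul1mx !mul0mx !addr0 !add0r Bd.
have [b' [e' EDM]] : exists b' e', E *m (D *m M) = block_mx (0 : 'M[R]_1) b' (u *: delta_mx 0 0) e'.
  set s : 'rV[R]_m.+1 := (- a 0 0 / u) *: delta_mx 0 0.
  exists (1%:M *m b + s *m (B *m e)), (0 *m b + 1%:M *m (B *m e)).
  rewrite DM [LHS](mulmx_block (1%:M : 'M[R]_1) s 0 1%:M a b (u *: delta_mx 0 0) (B *m e)).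
  rewrite mul0mx add0r [1%:M *m (u *: _)]mul1mx.
  suff -> : 1%:M *m a + s *m (u *: delta_mx 0 0) = 0 by [].
  apply/matrixP => i j; rewrite !ord1 mul1mx !mxE big_ord_recl big1 => [|k _].
    by rewrite !mxE !eqxx/= !mulr1 addr0 mulfVK// addrN.
  by rewrite !mxE/= mulr0 mul0r.
rewrite -/S -xrowE; move: EDM; move: (E *m (D *m M)) => Y {uEDM} EDM.
have l0 : lshift m.+1 (0 : 'I_1) = 0 :> 'I_m.+2 by exact: val_inj.
have Y0 : Y 0 0 = 0 by rewrite -l0 EDM (block_mxEul (0 : 'M[R]_1)) mxE.
have YS (k : 'I_m) : Y (lift 0 (lift 0 k)) 0 = 0.
  have -> : lift 0 (lift 0 k) = rshift 1 (lift 0 k) :> 'I_m.+2 by exact: val_inj.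
  rewrite -l0 EDM.
  by rewrite (block_mxEdl (0 : 'M[R]_1)) !mxE/= mulr0.
apply/matrixP => i j; rewrite ord1 4!mxE.
rewrite (_ : rshift 1 i = lift 0 i); last exact: val_inj.
rewrite l0.
case: (unliftP 0 i) => [k|] ->; last by rewrite tpermR.
by rewrite tpermD// -?val_eqE//.
Qed.

(** The equation [e] admits matrices whose two sizes are equal but not convertible, such as k + m
    and m + k. *)
Lemma vol_isometry n p (e : n = p) (N : 'M[R]_(n, p)) (K : set 'rV[R]_p) :
  N *m N^T = 1%:M -> compact K -> vol [set y | K (y *m N)] = vol K.
Proof.
case: p / e N K => N K NN cK.
have uN : N \in unitmx by case/mulmx1_unit: NN.
rewrite (vol_linear_preimage uN cK).
have : \det N * \det N = 1 by rewrite -{2}det_tr -det_mulmx NN det1.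
move=> dN; have -> : `|\det N| = 1; last by rewrite mul1e.
by apply/eqP; rewrite -sqr_norm_eq1 ?expr2 ?dN//.
Qed.

End linear_invariance.

(** * Integration along lines in the first direction *)

Section lines.
Context {R : realType}.
Local Notation mu := (@lebesgue_measure R).
Local Open Scope ereal_scope.

Definition line n (A : set 'rV[R]_n.+1) (y : 'rV[R]_n) : set R :=
  [set t | A (cons_row t y)].

(** Exchanges the first two coordinates: the lines of [A] in the first direction become lines of the
    fibers of [flip A], which is how the induction of [vol_lines] descends. *)
Definition flip n (A : set 'rV[R]_n.+2) : set 'rV[R]_n.+2 :=
  [set v | A (cons_row (tail v 0%R 0%R) (cons_row (v 0%R 0%R) (tail (tail v))))].

Lemma flipE n (A : set 'rV[R]_n.+2) x t z :
  flip A (cons_row x (cons_row t z)) = A (cons_row t (cons_row x z)).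
Proof. by rewrite /flip/= !(cons_row0, tail_cons). Qed.

Lemma compact_flip n (A : set 'rV[R]_n.+2) : compact A -> compact (flip A).
Proof.
pose f (v : 'rV[R]_n.+2) := cons_row (tail v 0%R 0%R) (cons_row (v 0%R 0%R) (tail (tail v))).
have cf : continuous f.
  apply: cons_row_continuous.
    exact: (cont_comp (@tail_continuous _ _) (@cont_coord _ _ _ _ _)).
  apply: cons_row_continuous; first exact: cont_coord.
  exact: (cont_comp (@tail_continuous _ _) (@tail_continuous _ _)).
apply: (@compact_preimage_cancel 'rV[R]_n.+2 'rV[R]_n.+2 f f) => //.
move=> v; rewrite /f !(cons_row0, tail_cons).
by rewrite -[RHS]cons_row_eta -[tail v in RHS]cons_row_eta.
Qed.

Lemma vol_flip n (A : set 'rV[R]_n.+2) : compact A -> vol (flip A) = vol A.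
Proof.
move=> cA; apply: vol_swap => // x y; apply/seteqP.
by split => z; rewrite /fiber/= flipE.
Qed.

(* Fubini with the first coordinate integrated last, for two bodies whose lines
   in that direction have comparable lengths. *)
Lemma vol_lines n (K K' : set 'rV[R]_n.+1) (C : set 'rV[R]_n) (a : R) :
  (0 <= a)%R -> compact K -> compact K' -> compact C ->
  (forall y, mu (line K' y) = mu (line K y) + (a * \1_C y)%:E) ->
  vol K' = vol K + a%:E * vol C.
Proof.
move=> a0; elim: n K K' C => [|n IH] K K' C cK cK' cC KK'.
  have vol1 (A : set 'rV[R]_1) : compact A -> vol A = mu (line A 0%R).
    move=> cA; transitivity (\int[mu]_x (\1_(line A 0%R) x)%:E).
      rewrite volS; apply: eq_integral => x _; rewrite /vol !indicE.
      by congr (_%:R%:E); apply/idP/idP => /set_mem h; apply/mem_set.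
    rewrite integral_indic//= ?setIT//; apply: (@compact_measurable R).
    apply: (@compact_preimage_cancel R 'rV[R]_1 (fun t => cons_row t 0%R)
      (fun v => v 0%R 0%R)) => //.
    + by apply: cons_row_continuous; [exact: cont_id | exact: cont_cst].
    + exact: cont_coord.
    + by move=> t; rewrite cons_row0.
  by rewrite !vol1// KK' EFinM.
rewrite -(vol_flip cK) -(vol_flip cK') !volS.
rewrite -ge0_integralZl//; last 2 first.
- exact: measurable_fiber.
- by move=> x _; exact: vol_ge0.
rewrite -ge0_integralD//; last 4 first.
- by move=> x _; exact: vol_ge0.
- by apply: measurable_fiber; exact: compact_flip.
- by move=> x _; rewrite mule_ge0// vol_ge0.
- by apply: measurable_funeM; exact: measurable_fiber.
apply: eq_integral => x _; apply: IH.
- exact/compact_fiber/compact_flip.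
- exact/compact_fiber/compact_flip.
- exact/compact_fiber.
- move=> z.
  have e (A : set 'rV[R]_n.+2) : line (fiber (flip A) x) z = line A (cons_row x z).
    by apply/seteqP; split => t; rewrite /line/fiber/= flipE.
  by rewrite !e KK'.
Qed.

End lines.

(** * Convex bodies and their sections *)

Section convex_compacts.
Context {R : realType}.
Local Notation mu := (@lebesgue_measure R).

Definition cvx n (K : set 'rV[R]_n) := forall x y a b,
  K x -> K y -> 0 <= a -> 0 <= b -> a + b = 1 -> K (a *: x + b *: y).

(** Possibly flat or empty, so that the class is stable under sections, projections and sums with
    segments, along which the inductions on the dimension run. *)
Definition cbody n (K : set 'rV[R]_n) := compact K /\ cvx K.

Lemma convex_set_cvx n (K : set 'rV[R]_n) : convex_set K -> cvx K.
Proof.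
move=> cK x y a b Kx Ky a0 b0 ab.
have a1 : a <= 1 by lra.
have := cK x y (Itv01 a0 a1) (mem_set Kx) (mem_set Ky).
by move/set_mem; rewrite /conv/= /unstable.onem -ab addrAC subrr add0r.
Qed.

Lemma compact_interval (A : set R) : compact A -> A !=set0 ->
  (forall x y z, A x -> A y -> x <= z <= y -> A z) ->
  exists a b, a <= b /\ A = `[a, b]%classic.
Proof.
move=> cA A0 iA.
have [b /set_mem Ab hb] := @compact_EVT_max R R id A A0 cA
  (continuous_subspaceT (@cont_id R)).
have [a /set_mem Aa ha] := @compact_EVT_min R R id A A0 cA
  (continuous_subspaceT (@cont_id R)).
exists a, b; split; first exact: (ha _ (mem_set Ab)).
apply/seteqP; split => x /=; rewrite in_itv/=.
  by move=> /mem_set Ax; rewrite (ha _ Ax) (hb _ Ax).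
by move=> h; exact: (iA a b).
Qed.

Lemma compact_line n (K : set 'rV[R]_n.+1) y : compact K -> compact (line K y).
Proof.
apply: (@compact_preimage_cancel R 'rV[R]_n.+1 (fun t => cons_row t y)
  (fun v => v 0 0)) => //.
- by apply: cons_row_continuous; [exact: cont_id | exact: cont_cst].
- exact: cont_coord.
- by move=> t; rewrite cons_row0.
Qed.

Lemma cbody_line n (K : set 'rV[R]_n.+1) y : cbody K -> line K y !=set0 ->
  exists a b, a <= b /\ line K y = `[a, b]%classic.
Proof.
move=> [cK vK] l0; apply: compact_interval => //; first exact: compact_line.
move=> s t z Ks Kt /andP[sz zt]; rewrite /line/=.
have [st|st] := eqVneq s t; first by have -> : z = s by lra.
have ts : 0 < t - s by rewrite subr_gt0 lt_neqAle st (le_trans sz zt).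
have := @vK (cons_row s y) (cons_row t y) ((t - z) / (t - s)) ((z - s) / (t - s)) Ks Kt.
rewrite !cons_rowZ cons_rowD -(scalerDl y).
have -> : (t - z) / (t - s) + (z - s) / (t - s) = 1 by field; rewrite gt_eqF.
have -> : (t - z) / (t - s) * s + (z - s) / (t - s) * t = z by field; rewrite gt_eqF.
by rewrite scale1r; apply => //; apply: divr_ge0; lra.
Qed.

Lemma mu_itv (a b : R) : a <= b -> mu `[a, b]%classic = (b - a)%:E.
Proof.
rewrite le_eqVlt => /predU1P[->|ab]; rewrite lebesgue_measure_itv/= lte_fin.
  by rewrite ltxx subrr.
by rewrite ab EFinB.
Qed.

Definition seg n (K : set 'rV[R]_n) (u : 'rV[R]_n) : set 'rV[R]_n :=
  (fun p : 'rV[R]_n * R => p.1 + p.2 *: u) @` (K `*` `[0, 1]%classic).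

Lemma segP n (K : set 'rV[R]_n) u v :
  seg K u v <-> exists x t, [/\ K x, 0 <= t <= 1 & v = x + t *: u].
Proof.
split.
  move=> [[x t] [/= Kx]]; rewrite in_itv/= => t01 <-; by exists x, t.
by move=> [x [t [Kx t01 ->]]]; exists (x, t) => //; split => //=; rewrite in_itv.
Qed.

Lemma compact_seg n (K : set 'rV[R]_n) u : compact K -> compact (seg K u).
Proof.
move=> cK; apply: compact_image.
  apply: contD; first exact: cont_fst.
  by apply: contZ; [exact: cont_snd | exact: cont_cst].
by apply: compact_setX => //; exact: segment_compact.
Qed.

Lemma cvx_seg n (K : set 'rV[R]_n) u : cvx K -> cvx (seg K u).
Proof.
move=> vK x y a b /segP[x' [s [Kx /andP[s0 s1] ->]]] /segP[y' [t [Ky /andP[t0 t1] ->]]] a0 b0 ab.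
apply/segP; exists (a *: x' + b *: y'), (a * s + b * t); split.
- exact: vK.
- by apply/andP; split; nra.
- by rewrite !scalerDr !scalerA scalerDl addrACA.
Qed.

Lemma cbody_seg n (K : set 'rV[R]_n) u : cbody K -> cbody (seg K u).
Proof. by move=> [cK vK]; split; [exact: compact_seg | exact: cvx_seg]. Qed.

Definition proj_tail n (K : set 'rV[R]_n.+1) : set 'rV[R]_n := @tail R n @` K.

Lemma proj_tailP n (K : set 'rV[R]_n.+1) y : proj_tail K y <-> line K y !=set0.
Proof.
split; first by move=> [v Kv <-]; exists (v 0 0); rewrite /line/= cons_row_eta.
by move=> [t Kt]; exists (cons_row t y) => //; exact: tail_cons.
Qed.

Lemma cbody_proj_tail n (K : set 'rV[R]_n.+1) : cbody K -> cbody (proj_tail K).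
Proof.
move=> [cK vK]; split; first by apply: compact_image => //; exact: tail_continuous.
move=> _ _ a b [x Kx <-] [y Ky <-] a0 b0 ab.
by exists (a *: x + b *: y); [exact: vK | rewrite tailD !tailZ].
Qed.

Lemma cbody_fiber n (K : set 'rV[R]_n.+1) x : cbody K -> cbody (fiber K x).
Proof.
move=> [cK vK]; split; first exact: compact_fiber.
move=> y z a b Ky Kz a0 b0 ab; rewrite /fiber/=.
have -> : cons_row x (a *: y + b *: z) = a *: cons_row x y + b *: cons_row x z.
  by rewrite !cons_rowZ cons_rowD -mulrDl ab mul1r.
exact: vK.
Qed.

Lemma line_seg n (K : set 'rV[R]_n.+1) c y s :
  line (seg K (cons_row c 0)) y s <->
  exists r t, [/\ line K y r, 0 <= t <= 1 & s = r + t * c].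
Proof.
split.
  move=> /segP[x [t [Kx t01]]]; rewrite -{1}(cons_row_eta x) cons_rowZ cons_rowD.
  rewrite scaler0 addr0 => /cons_row_inj[-> ->]; exists (x 0 0), t; split => //.
  by rewrite /line/= cons_row_eta.
move=> [r [t [Kr t01 ->]]]; apply/segP; exists (cons_row r y), t; split => //.
by rewrite cons_rowZ cons_rowD scaler0 addr0.
Qed.

(** Each nonempty line [a, b] of [K] in the first direction grows by |c|, at its upper or lower end
    according to the sign of [c], and the nonempty lines are those over the projection. This is how
    a segment turns into a projection. *)
Lemma vol_seg n (K : set 'rV[R]_n.+1) c : cbody K ->
  (vol (seg K (cons_row c 0)) = vol K + `|c|%:E * vol (proj_tail K))%E.
Proof.
move=> bK; have [cK vK] := bK.
apply: vol_lines => //; [exact: compact_seg | by case: (cbody_proj_tail bK) |].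
move=> y; have [/proj_tailP l0|nl] := pselect (proj_tail K y); last first.
  rewrite indicE memNset// mulr0 adde0; congr (mu _).
  have l0 : line K y = set0.
    by apply/seteqP; split => // t Kt; apply: nl; apply/proj_tailP; exists t.
  rewrite l0; apply/seteqP; split => // s /line_seg[r [t [+ _ _]]].
  by rewrite l0.
have [a [b [ab labE]]] := cbody_line bK l0.
rewrite indicE mem_set; last exact/proj_tailP.
rewrite mulr1 labE mu_itv//.
have [c0|c0] := leP 0 c.
  have -> : line (seg K (cons_row c 0)) y = `[a, b + c]%classic.
    apply/seteqP; split => s.
      move=> /line_seg[r [t]]; rewrite labE/= !in_itv/= => -[/andP[? ?] /andP[? ?] ->].
      by apply/andP; split; nra.
    rewrite /= in_itv/= => /andP[as' sbc]; apply/line_seg; rewrite labE.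
    have [sb|sb] := leP s b.
      by exists s, 0; rewrite /= in_itv/= as' sb lexx ler01 mul0r addr0.
    have cp : 0 < c by lra.
    exists b, ((s - b) / c); rewrite /= in_itv/= ab lexx; split => //.
      by rewrite divr_ge0 ?subr_ge0 ?(ltW sb)//= ler_pdivrMr// mul1r; lra.
    by rewrite divfK ?gt_eqF// addrC subrK.
  by rewrite mu_itv ?ler_wpDr// -EFinD ger0_norm//; congr EFin; lra.
have -> : line (seg K (cons_row c 0)) y = `[a + c, b]%classic.
  apply/seteqP; split => s.
    move=> /line_seg[r [t]]; rewrite labE/= !in_itv/= => -[/andP[? ?] /andP[? ?] ->].
    by apply/andP; split; nra.
  rewrite /= in_itv/= => /andP[as' sbc]; apply/line_seg; rewrite labE.
  have [sb|sb] := leP a s.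
    by exists s, 0; rewrite /= in_itv/= sbc sb lexx ler01 mul0r addr0.
  exists a, ((s - a) / c); rewrite /= in_itv/= ab lexx; split => //.
    rewrite -mulrNN -invrN divr_ge0/= ?ler_pdivrMr ?mul1r; lra.
  by rewrite divfK ?lt_eqF// addrC subrK.
rewrite mu_itv; last by lra.
by rewrite -EFinD ltr0_norm//; congr EFin; lra.
Qed.

(** Steiner symmetrization in the first direction. The length of a line of [K] enters through two of
    its points rather than through a measure, which makes convexity direct and presents the set as
    the image of a compact one. *)
Definition steiner n (K : set 'rV[R]_n.+1) : set 'rV[R]_n.+1 :=
  [set v | exists a b, [/\ line K (tail v) a, line K (tail v) b & `|v 0 0| *+ 2 <= b - a]].

Lemma cbody_steiner n (K : set 'rV[R]_n.+1) : cbody K -> cbody (steiner K).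
Proof.
move=> bK; have [cK vK] := bK; split; last first.
  move=> x y a b [p [q [Kp Kq pq]]] [p' [q' [Kp' Kq' pq']]] a0 b0 ab.
  exists (a * p + b * p'), (a * q + b * q').
  have h s s' : line K (tail x) s -> line K (tail y) s' ->
      line K (tail (a *: x + b *: y)) (a * s + b * s').
    rewrite /line/= tailD !tailZ => Ks Ks'.
    by rewrite -cons_rowD -!cons_rowZ; exact: vK.
  split; [exact: h | exact: h|].
  rewrite !mxE; apply: le_trans (_ : (a * `|x 0 0| + b * `|y 0 0|) *+ 2 <= _).
    rewrite lerMn2r/=; apply: le_trans (ler_normD _ _) _.
    by rewrite !normrM (ger0_norm a0) (ger0_norm b0).
  by rewrite mulrnDl -!mulrnAr; nra.
(* Pairs of points of [K] on a common line, of heights a and b, with a parameter t in [-1, 1]: the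
   symmetrized line consists of the heights t (b - a) / 2. *)
pose D : set ('rV[R]_n.+1 * 'rV[R]_n.+1 * R) :=
  ((K `*` K) `&` [set p | tail p.1 - tail p.2 = 0]) `*` `[(-1)%R, 1%R]%classic.
pose f (p : 'rV[R]_n.+1 * 'rV[R]_n.+1 * R) : 'rV[R]_n.+1 :=
  cons_row (p.2 * ((p.1.2 0 0 - p.1.1 0 0) * 2^-1)) (tail p.1.1).
have c1 : continuous (fun p : 'rV[R]_n.+1 * 'rV[R]_n.+1 * R => p.1.1).
  exact: (cont_comp (@cont_fst _ _) (@cont_fst _ _)).
have c2 : continuous (fun p : 'rV[R]_n.+1 * 'rV[R]_n.+1 * R => p.1.2).
  exact: (cont_comp (@cont_fst _ _) (@cont_snd _ _)).
have -> : steiner K = f @` D.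
  apply/seteqP; split => v.
    move=> [a [b [Ka Kb ab]]].
    have [e|ba] := eqVneq b a.
      exists (cons_row a (tail v), cons_row b (tail v), 0) => /=.
        by split; [split => //=; rewrite !tail_cons subrr | rewrite /= in_itv/=; apply/andP; split; lra].
      rewrite /f/= mul0r tail_cons -[RHS]cons_row_eta; congr cons_row.
      apply/esym/eqP; rewrite -normr_le0; move: ab; rewrite e mulr2n; lra.
    have ba0 : 0 < b - a.
      by rewrite lt_neqAle eq_sym subr_eq0 ba/=; apply: le_trans ab; rewrite mulrn_wge0.
    exists (cons_row a (tail v), cons_row b (tail v), v 0 0 *+ 2 / (b - a)) => /=.
      split; first by split => //=; rewrite !tail_cons subrr.
      rewrite /= in_itv/= -ler_norml normrM normfV (gtr0_norm ba0) ler_pdivrMr// mul1r.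
      by rewrite normrMn.
    rewrite /f/= !cons_row0 tail_cons -[RHS]cons_row_eta; congr cons_row.
    rewrite -mulr_natr; field; rewrite gt_eqF//.
  move=> [[[p q] t] [/= [[/= Kp Kq] /eqP]]]; rewrite subr_eq0 => /eqP pq + <-.
  rewrite in_itv/= -ler_norml => t1.
  have h w : K w -> tail w = tail p -> line K (tail p) (w 0 0).
    by move=> Kw <-; rewrite /line/= cons_row_eta.
  rewrite /steiner /f/= tail_cons cons_row0 normrM normrM [`|2^-1|]ger0_norm//.
  have [pq0|pq0] := leP (p 0 0) (q 0 0).
    exists (p 0 0), (q 0 0); split; [exact: h|exact: h|].
    rewrite (@ger0_norm _ (q 0 0 - p 0 0)) ?subr_ge0// -[_ *+ 2]mulr_natr.
    have : 0 <= `|t| by []. nra.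
  exists (q 0 0), (p 0 0); split; [exact: h|exact: h|].
  move/ltW in pq0; rewrite distrC (@ger0_norm _ (p 0 0 - q 0 0)) ?subr_ge0//.
  rewrite -[_ *+ 2]mulr_natr; have : 0 <= `|t| by []. nra.
apply: compact_image.
  apply: cons_row_continuous; last exact: (cont_comp c1 (@tail_continuous _ _)).
  apply: contM; first exact: cont_snd.
  apply: contM; last exact: cont_cst.
  apply: contD; first exact: (cont_comp c2 (@cont_coord _ _ _ _ _)).
  move=> p; apply: cvgN; exact: (cont_comp c1 (@cont_coord _ _ _ _ _)).
apply: compact_setX; last exact: segment_compact.
apply: compact_closedI; first exact: compact_setX.
apply: (@closed_preimage _ _ (fun p : 'rV[R]_n.+1 * 'rV[R]_n.+1 => tail p.1 - tail p.2) [set 0]).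
  apply: contD; first exact: (cont_comp (@cont_fst _ _) (@tail_continuous _ _)).
  move=> p; apply: cvgN; exact: (cont_comp (@cont_snd _ _) (@tail_continuous _ _)).
by apply: compact_closed_rV; exact: compact_set1.
Qed.

Lemma vol_steiner n (K : set 'rV[R]_n.+1) : cbody K -> vol (steiner K) = vol K.
Proof.
move=> bK; have [cK vK] := bK.
rewrite (@vol_lines _ _ K _ set0 0)//; last 3 first.
- by case: (cbody_steiner bK).
- exact: compact0.
- move=> y; rewrite mul0r adde0.
  have [l0|nl] := pselect (line K y !=set0); last first.
    congr (mu _); apply/seteqP; split => t.
      by rewrite {1}/line/= /steiner/= tail_cons => -[a [b [Ka _ _]]]; case: nl; exists a.
    by move=> Kt; case: nl; exists t.
  have [a [b [ab labE]]] := cbody_line bK l0.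
  have -> : line (steiner K) y = `[(- ((b - a) / 2))%R, ((b - a) / 2)%R]%classic.
    apply/seteqP; split => t; rewrite /= in_itv/= -ler_norml /line/= /steiner/= tail_cons cons_row0.
      rewrite -/(line K y) labE => -[a' [b' []]]; rewrite /= !in_itv/= => /andP[? ?] /andP[? ?].
      by rewrite mulr2n; lra.
    move=> tab; exists a, b; rewrite -/(line K y) labE/= !in_itv/= !lexx ab.
    by split => //; rewrite mulr2n; lra.
  by rewrite labE !mu_itv//; [congr EFin; lra | lra].
by rewrite mul0e adde0.
Qed.

Definition halfdiff n (K : set 'rV[R]_n) : set 'rV[R]_n :=
  (fun p => 2^-1 *: (p.1 - p.2)) @` (K `*` K).

Lemma cbody_halfdiff n (K : set 'rV[R]_n) : cbody K -> cbody (halfdiff K).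
Proof.
move=> [cK vK]; split.
  apply: compact_image; last exact: compact_setX.
  apply: contZ; first exact: cont_cst.
  apply: contD; first exact: cont_fst.
  by move=> p; apply: cvgN; exact: cvg_snd.
move=> _ _ a b [[x x'] [/= Kx Kx'] <-] [[y y'] [/= Ky Ky'] <-] a0 b0 ab.
exists (a *: x + b *: y, a *: x' + b *: y'); first by split; exact: vK.
by apply/rowP => i; rewrite !mxE; ring.
Qed.

(* One Steiner symmetrization makes the fibers at x and -x coincide, which
   reduces the dimension. *)
Lemma vol_le_halfdiff n (K : set 'rV[R]_n) : cbody K -> (vol K <= vol (halfdiff K))%E.
Proof.
elim: n K => [|n IH] K bK.
  rewrite /vol lee_fin !indicE ler_nat; case: (boolP (_ \in K)) => // /set_mem K0.
  by rewrite mem_set//; exists (0, 0) => //; apply/rowP => -[].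
rewrite -(vol_steiner bK) -(vol_steiner (cbody_halfdiff bK)).
apply: (@le_trans _ _ (vol (halfdiff (steiner K)))).
  rewrite !volS; apply: ge0_le_integralT => x; first exact: vol_ge0.
  apply: le_trans (IH _ (cbody_fiber x (cbody_steiner bK))) _.
  apply: le_vol => _ [[y y'] [/= Ky Ky'] <-].
  exists (cons_row x y, cons_row (- x) y') => /=.
    split => //=; move: Ky'; rewrite /fiber/= /steiner/= !tail_cons !cons_row0.
    by rewrite normrN.
  rewrite cons_rowN opprK cons_rowD cons_rowZ; congr cons_row.
  by rewrite -mulr2n -[x *+ 2]mulr_natl mulKf.
(* Symmetrizing after taking half-differences gives the larger set: from [a, b] over the tail of x
   and [a', b'] over that of y, a line of [halfdiff K] receives (a - b') / 2 and (b - a') / 2, whose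
   difference is half the sum of the two lengths. *)
apply: le_vol => _ [[x y] [/= [a [b [Ka Kb ab]]] [a' [b' [Ka' Kb' ab']]]] <-].
exists (2^-1 * (a - b')), (2^-1 * (b - a')).
have h s s' : line K (tail x) s -> line K (tail y) s' ->
    line (halfdiff K) (tail (2^-1 *: (x - y))) (2^-1 * (s - s')).
  move=> Ks Ks'; exists (cons_row s (tail x), cons_row s' (tail y)) => //=.
  by rewrite cons_rowN cons_rowD cons_rowZ tailZ tailD tailN.
split; [exact: h | exact: h |].
rewrite -[_ *+ 2]mulr_natr in ab; rewrite -[_ *+ 2]mulr_natr in ab'.
rewrite !mxE normrM [`|2^-1|]ger0_norm// -[_ *+ 2]mulr_natr.
by have := ler_normB (x 0 0) (y 0 0); lra.
Qed.

End convex_compacts.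

(** * Sections over a block of coordinates, dilations and cones *)

Section block_fibers.
Context {R : realType}.
Local Notation mu := (@lebesgue_measure R).

Definition bfiber k m (K : set 'rV[R]_(k + m)) (y : 'rV[R]_k) : set 'rV[R]_m :=
  [set z | K (row_mx y z)].
Definition bproj k m (K : set 'rV[R]_(k + m)) : set 'rV[R]_k :=
  [set y | exists z, K (row_mx y z)].

Lemma row_mx_cons k m x (y : 'rV[R]_k) (z : 'rV[R]_m) :
  row_mx (cons_row x y) z = cons_row x (row_mx y z) :> 'rV[R]_(k.+1 + m).
Proof.
apply/rowP => i; rewrite -(fintype.splitK i); case: (fintype.split i) => j /=; last first.
  rewrite row_mxEr (_ : rshift k.+1 j = lift 0 (rshift k j) :> 'I_(k + m).+1); last exact: val_inj.
  by rewrite cons_rowS row_mxEr.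
rewrite row_mxEl; case: (unliftP 0 j) => [l|] ->.
  rewrite cons_rowS (_ : lshift m (lift 0 l) = lift 0 (lshift m l) :> 'I_(k + m).+1); last exact: val_inj.
  by rewrite cons_rowS row_mxEl.
rewrite cons_row0 (_ : lshift m 0 = 0 :> 'I_(k + m).+1); last exact: val_inj.
by rewrite cons_row0.
Qed.

Lemma row_mx_nil m (y : 'rV[R]_0) (z : 'rV[R]_m) : row_mx y z = z :> 'rV[R]_(0 + m).
Proof.
by apply/rowP => i; rewrite -[in LHS](_ : rshift 0 i = i) ?row_mxEr//; exact: val_inj.
Qed.

Lemma bfiberS k m (K : set 'rV[R]_(k.+1 + m)) x y :
  bfiber K (cons_row x y) = @bfiber k m (fiber (K : set 'rV[R]_(k + m).+1) x) y.
Proof. by apply/seteqP; split => z; rewrite /bfiber/fiber/= row_mx_cons. Qed.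

Lemma bfiber0 m (K : set 'rV[R]_(0 + m)) y : bfiber K y = K.
Proof. by apply/seteqP; split => z; rewrite /bfiber/= row_mx_nil. Qed.

Lemma row_mx_continuous k m (T : topologicalType) (f : T -> 'rV[R]_k) (g : T -> 'rV[R]_m) :
  continuous f -> continuous g -> continuous (fun t => row_mx (f t) (g t)).
Proof.
move=> cf cg; apply: mx_continuous => i j; rewrite ord1 -(fintype.splitK j).
case: (fintype.split j) => l /=.
  by under eq_fun do rewrite row_mxEl; exact: (cont_comp cf (@cont_coord _ _ _ _ _)).
by under eq_fun do rewrite row_mxEr; exact: (cont_comp cg (@cont_coord _ _ _ _ _)).
Qed.

Lemma rsubmx_continuous k m : continuous (@rsubmx R 1 k m).
Proof. by apply: mx_continuous => i j; under eq_fun do rewrite mxE; exact: cont_coord. Qed.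

Lemma lsubmx_continuous k m : continuous (@lsubmx R 1 k m).
Proof. by apply: mx_continuous => i j; under eq_fun do rewrite mxE; exact: cont_coord. Qed.

Lemma cbody_bfiber k m (K : set 'rV[R]_(k + m)) y : cbody K -> cbody (bfiber K y).
Proof.
move=> [cK vK]; split.
  apply: (@compact_preimage_cancel 'rV[R]_m 'rV[R]_(k + m) (row_mx y) rsubmx) => //.
  - by apply: row_mx_continuous; [exact: cont_cst | exact: cont_id].
  - exact: rsubmx_continuous.
  - exact: row_mxKr.
move=> u v a b Ku Kv a0 b0 ab; rewrite /bfiber/=.
have -> : row_mx y (a *: u + b *: v) = a *: row_mx y u + b *: row_mx y v.
  by rewrite !scale_row_mx add_row_mx -scalerDl ab scale1r.
exact: vK.
Qed.

Lemma cbody_bproj k m (K : set 'rV[R]_(k + m)) : cbody K -> cbody (bproj K).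
Proof.
move=> [cK vK]; split.
  rewrite (_ : bproj K = lsubmx @` K).
    by apply: compact_image => //; exact: lsubmx_continuous.
  apply/seteqP; split => [y [z Kyz]|_ [v Kv <-]].
    by exists (row_mx y z); rewrite ?row_mxKl.
  by exists (rsubmx v); rewrite hsubmxK.
move=> u v a b [z Ku] [z' Kv] a0 b0 ab; exists (a *: z + b *: z').
by rewrite -add_row_mx -!scale_row_mx; exact: vK.
Qed.

Local Open Scope ereal_scope.

Lemma vol_le_base k m (K : set 'rV[R]_(k + m)) (C : set 'rV[R]_k) (c : R) :
  (0 <= c)%R -> compact K -> compact C ->
  (forall y, vol (bfiber K y) <= (c * \1_C y)%:E) -> vol K <= c%:E * vol C.
Proof.
move=> c0; elim: k K C => [|k IH] K C cK cC h.
  by have := h 0%R; rewrite bfiber0 EFinM.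
rewrite (volS (K : set 'rV[R]_(k + m).+1)) volS -ge0_integralZl//; last 2 first.
- exact: measurable_fiber.
- by move=> x _; exact: vol_ge0.
apply: ge0_le_integralT => x; first exact: vol_ge0.
apply: IH.
- exact: compact_fiber.
- exact: compact_fiber.
- by move=> y; rewrite -bfiberS; apply: le_trans (h _) _; rewrite lee_fin !indicE.
Qed.

Lemma vol_ge_fibers k m (K D : set 'rV[R]_(k + m)) (c : R) :
  (0 <= c)%R -> compact K -> compact D ->
  (forall y, c%:E * vol (bfiber D y) <= vol (bfiber K y)) -> c%:E * vol D <= vol K.
Proof.
move=> c0; elim: k K D => [|k IH] K D cK cD h.
  by have := h 0%R; rewrite !bfiber0.
rewrite (volS (K : set 'rV[R]_(k + m).+1)) (volS (D : set 'rV[R]_(k + m).+1)).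
rewrite -ge0_integralZl//; last 2 first.
- by apply: measurable_fiber.
- by move=> x _; exact: vol_ge0.
apply: ge0_le_integralT => x; first by rewrite mule_ge0// vol_ge0.
apply: IH.
- exact: compact_fiber.
- exact: compact_fiber.
- by move=> y; rewrite -!bfiberS.
Qed.

Lemma vol_scale n (A : set 'rV[R]_n) (s : R) : (0 <= s)%R -> compact A -> A !=set0 ->
  vol [set (s *: x)%R | x in A] = (s ^+ n)%:E * vol A.
Proof.
rewrite le_eqVlt => /predU1P[<-|s0] cA A0.
  have -> : [set (0 *: x)%R | x in A] = [set 0%R].
    case: A0 => p Ap; apply/seteqP; split => x.
      by move=> [q _ <-]; rewrite scale0r.
    by move=> ->; exists p => //; rewrite scale0r.
  case: n => [|n] in A cA A0 *.
    have vol1 (B : set 'rV[R]_0) : B 0%R -> vol B = 1.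
      by move=> B0; rewrite /vol indicE mem_set.
    rewrite expr0 mul1e !vol1//.
    by case: A0 => p; have -> : p = 0%R by apply/rowP => -[].
  rewrite expr0n/= mul0e; apply/eqP; rewrite eq_le vol_ge0 andbT.
  apply: (@le_trans _ _ (vol (@box R n.+1 0))).
    by apply: le_vol => _ -> i; rewrite mxE /= in_itv/= oppr0 lexx.
  by rewrite vol_box// mul0rn expr0n.
have su : (s^-1)%:M \in @unitmx R n.
  by rewrite unitmxE det_scalar unitfE expf_neq0// invr_neq0// gt_eqF.
rewrite [in RHS](vol_linear_preimage su cA) det_scalar muleA -EFinM.
rewrite normrX normfV (gtr0_norm s0) -exprMn divff ?gt_eqF// expr1n mul1e.
congr vol; apply/seteqP; split => y /=.
  by move=> [x Ax <-]; rewrite mul_mx_scalar scalerA mulVf ?gt_eqF// scale1r.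
rewrite mul_mx_scalar => Ay; exists (s^-1 *: y)%R => //.
by rewrite scalerA divff ?gt_eqF// scale1r.
Qed.

Lemma integral_exprn (r : R) N : (0 <= r)%R ->
  \int[mu]_(x in `[0%R, r]) ((r - x) ^+ N)%:E = (r ^+ N.+1 / N.+1%:R)%:E.
Proof.
rewrite le_eqVlt => /predU1P[<-|r0].
  by rewrite set_itv1 integral_set1 expr0n mul0r.
pose F : R -> R := ((- N.+1%:R^-1) *: (cst r - id) ^+ N.+1)%R.
have FE (x : R) : F x = (- N.+1%:R^-1 * (r - x) ^+ N.+1)%R.
  by rewrite /F /GRing.scale/= fctE.
have dF (x : R) : is_derive x 1%R F ((r - x) ^+ N)%R.
  apply: is_derive_eq; rewrite /GRing.scale/= sub0r fctE -mulr_natr.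
  by field; rewrite addrC natr1 pnatr_eq0.
have cF : continuous F.
  by move=> x; apply/differentiable_continuous/derivable1_diffP.
rewrite (@continuous_FTC2 _ _ F)//.
- rewrite !FE subrr expr0n/= mulr0 subr0 -EFinB; congr EFin.
  by field; rewrite addrC natr1 pnatr_eq0.
- apply: continuous_subspaceT.
  have cr : continuous (fun x : R => (r - x)%R).
    by apply: contD; [exact: cont_cst | move=> x; apply: cvgN; exact: cvg_id].
  exact: (cont_comp cr (@exprn_continuous _ N)).
- split => //.
  + by apply: cvg_at_right_filter; exact: cF.
  + by apply: cvg_at_left_filter; exact: cF.
- by move=> x _; rewrite derive1E derive_val.
Qed.

(** Integrates the volumes (r - x)^N v of shrinking sections; simplices and the iterated cones over
    a body are both instances. *)
Lemma vol_cone N (A : set 'rV[R]_N.+1) (B : R -> set 'rV[R]_N) (v r : R) :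
  (0 <= r)%R -> (0 <= v)%R ->
  (forall x, (0 <= x <= r)%R -> fiber A x = B (r - x)%R) ->
  (forall x, ~~ (0 <= x <= r)%R -> fiber A x = set0) ->
  (forall s, (0 <= s)%R -> vol (B s) = (s ^+ N * v)%:E) ->
  vol A = (r ^+ N.+1 * (v / N.+1%:R))%:E.
Proof.
move=> r0 v0 AB A0 hB; rewrite volS.
transitivity (\int[mu]_(x in `[0%R, r]) (v%:E * ((r - x) ^+ N)%:E)).
  rewrite [RHS]integral_mkcond; apply: eq_integral => x _.
  rewrite patchE mem_setE; case: ifPn => xr.
    move: (xr); rewrite in_itv/= => xr'; rewrite (AB _ xr') hB -?EFinM 1?mulrC//.
    by rewrite subr_ge0; case/andP: xr'.
  by rewrite A0 ?vol0//; move: xr; rewrite in_itv.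
rewrite ge0_integralZl//=.
- by rewrite integral_exprn// -EFinM; congr EFin; rewrite mulrCA mulrA.
- apply: measurable_funTS; apply/measurable_EFinP; apply: (@continuous_measurable_fun R).
  have cr : continuous (fun x : R => (r - x)%R).
    by apply: contD; [exact: cont_cst | move=> x; apply: cvgN; exact: cvg_id].
  exact: (cont_comp cr (@exprn_continuous _ N)).
- by move=> x; rewrite in_itv/= => /andP[_ xr]; rewrite lee_fin exprn_ge0// subr_ge0.
Qed.

End block_fibers.

(** * Volumes of simplices and of iterated cones *)

Section rogers_shephard.
Context {R : realType}.
Local Notation mu := (@lebesgue_measure R).

Definition weight n (z : 'rV[R]_n) : R := \sum_i z 0 i.
Definition nonneg n (z : 'rV[R]_n) := forall i, 0 <= z 0 i.

Lemma weight_cons n x (z : 'rV[R]_n) : weight (cons_row x z) = x + weight z.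
Proof.
rewrite /weight big_ord_recl cons_row0; congr (_ + _).
by apply: eq_bigr => i _; rewrite cons_rowS.
Qed.

Lemma nonneg_cons n x (z : 'rV[R]_n) : nonneg (cons_row x z) <-> 0 <= x /\ nonneg z.
Proof.
split.
  move=> h; split; first by have := h 0; rewrite cons_row0.
  by move=> i; have := h (lift 0 i); rewrite cons_rowS.
move=> [x0 z0] i; case: (unliftP 0 i) => [j|] ->; first by rewrite cons_rowS.
by rewrite cons_row0.
Qed.

Lemma weight_ge0 n (z : 'rV[R]_n) : nonneg z -> 0 <= weight z.
Proof. by move=> z0; apply: sumr_ge0 => i _; exact: z0. Qed.

Definition simplex n (r : R) : set 'rV[R]_n := [set z | nonneg z /\ weight z <= r].

Lemma fiber_simplex n (r x : R) : 0 <= x -> fiber (@simplex n.+1 r) x = @simplex n (r - x).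
Proof.
move=> x0; apply/seteqP; split => z; rewrite /fiber/simplex/= weight_cons.
  by move=> [/nonneg_cons[_ z0] h]; split => //; lra.
by move=> [z0 h]; split; [exact/nonneg_cons | lra].
Qed.

Lemma vol_simplex n (r : R) : 0 <= r -> vol (@simplex n r) = (r ^+ n * n`!%:R^-1)%:E.
Proof.
elim: n r => [|n IH] r r0.
  rewrite /vol fact0 invr1 mulr1 expr0 indicE mem_set//; split; first by case.
  by rewrite /weight big_ord0.
rewrite (@vol_cone _ n _ (fun s => @simplex n s) n`!%:R^-1 r)//.
- by rewrite factS natrM invfM [X in (_ * X)%:E]mulrC.
- by move=> x /andP[x0 _]; exact: fiber_simplex.
- move=> x; rewrite negb_and -!ltNge => /orP xr; apply/seteqP; split => // z.
  rewrite /fiber/simplex/= weight_cons => -[/nonneg_cons[x0 z0] h].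
  have := weight_ge0 z0; case: xr; lra.
Qed.

(* Iterated cone over P: its fibers over P are homothetic simplices, and its
   fibers in the other direction are smaller cones of the same kind. *)
Definition cone m k (P : set 'rV[R]_k) (r : R) : set 'rV[R]_(m + k) :=
  [set v | nonneg (lsubmx v) /\ weight (lsubmx v) <= r /\
    exists2 p, P p & rsubmx v = (r - weight (lsubmx v)) *: p].

Lemma coneE m k (P : set 'rV[R]_k) r z y : @cone m k P r (row_mx z y) <->
  [/\ nonneg z, weight z <= r & exists2 p, P p & y = (r - weight z) *: p].
Proof. by rewrite /cone/= row_mxKl row_mxKr; split=> [[? [? ?]]|[? ? ?]]; split. Qed.

(** Starting from a dilate of [P], each added coordinate is one use of [vol_cone] and divides by the
    new dimension; the divisors k + 1, ..., m + k multiply to the quotient of factorials. *)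
Lemma vol_cone_body m k (P : set 'rV[R]_k) (r : R) : cbody P -> P !=set0 -> 0 <= r ->
  vol (@cone m k P r) = (r ^+ (m + k) * (volume P * k`!%:R / (m + k)`!%:R))%:E.
Proof.
move=> [cP vP] P0; elim: m r => [|m IH] r r0.
  have -> : @cone 0 k P r = [set r *: x | x in P].
    apply/seteqP; split => v.
      move=> [_ [_ [p Pp e]]]; exists p => //; move: e.
      rewrite /weight big_ord0 subr0 => <-; rewrite -[RHS](@hsubmxK _ 1 0 k v).
      by rewrite row_mx_nil.
    move=> [p Pp <-]; rewrite -[r *: p](row_mx_nil 0); apply/coneE; split.
    + by case.
    + by rewrite /weight big_ord0.
    + by exists p => //; rewrite /weight big_ord0 subr0.
  have fk : volume P * k`!%:R / (0 + k)`!%:R = volume P.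
    by apply: mulfK; rewrite pnatr_eq0 -lt0n fact_gt0.
  by rewrite vol_scale// volumeE//= -EFinM; congr EFin; congr (_ * _); rewrite fk.
have fac : (volume P * k`!%:R / (m.+1 + k)`!%:R) =
    (volume P * k`!%:R / (m + k)`!%:R) / (m + k).+1%:R.
  by rewrite addSn factS natrM invfM mulrA mulrAC.
rewrite fac; apply: (@vol_cone _ (m + k) _ (fun s => @cone m k P s)) => //.
- by rewrite divr_ge0// mulr_ge0// fine_ge0// vol_ge0.
- move=> x /andP[x0 xr]; apply/seteqP; split => v; rewrite /fiber/= -(hsubmxK v) -row_mx_cons.
    move=> /coneE[/nonneg_cons[_ z0]]; rewrite weight_cons => h [p Pp e].
    by apply/coneE; split => //; [lra | exists p => //; rewrite e; congr (_ *: _); lra].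
  move=> /coneE[z0 h [p Pp e]]; apply/coneE; rewrite weight_cons; split.
  + exact/nonneg_cons.
  + lra.
  + by exists p => //; rewrite e; congr (_ *: _); lra.
- move=> x; rewrite negb_and -!ltNge => /orP xr; apply/seteqP; split => // v.
  rewrite /fiber/= -(hsubmxK v) -row_mx_cons => /coneE[/nonneg_cons[x0 z0]].
  rewrite weight_cons => h _; have := weight_ge0 z0; case: xr; lra.
Qed.

End rogers_shephard.

(** * Volume of a body, of its central section and of its shadow *)

Section section_inequalities.
Context {R : realType}.

Definition swapmx k m : 'M[R]_(k + m, m + k) := block_mx 0 1%:M 1%:M 0.

Lemma mul_swapmx k m (y : 'rV[R]_k) (z : 'rV[R]_m) :
  row_mx y z *m swapmx k m = row_mx z y.
Proof. by rewrite mul_row_block !mulmx0 !mulmx1 add0r addr0. Qed.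

Lemma swapmxK k m : swapmx k m *m (swapmx k m)^T = 1%:M.
Proof.
rewrite /swapmx tr_block_mx !trmx0 !trmx1 mulmx_block !mulmx0 !mul0mx !mulmx1.
by rewrite !add0r addr0 -scalar_mx_block.
Qed.

Definition base m k (K : set 'rV[R]_(m + k)) : set 'rV[R]_m := [set z | K (row_mx z 0)].
Definition shadow m k (K : set 'rV[R]_(m + k)) : set 'rV[R]_k :=
  [set y | exists z, K (row_mx z y)].

(** Fibers are taken over leading coordinates, so the last block is put in front: [base] becomes the
    fiber over 0 and [shadow] the projection onto the leading block. *)
Definition swapset m k (K : set 'rV[R]_(m + k)) : set 'rV[R]_(k + m) :=
  [set w | K (w *m swapmx k m)].

Lemma swapsetE m k (K : set 'rV[R]_(m + k)) y z :
  swapset K (row_mx y z) = K (row_mx z y).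
Proof. by rewrite /swapset/= mul_swapmx. Qed.

Lemma bfiber_swapset m k (K : set 'rV[R]_(m + k)) : bfiber (swapset K) 0 = base K.
Proof. by apply/seteqP; split => z; rewrite /bfiber/= swapsetE. Qed.

Lemma bproj_swapset m k (K : set 'rV[R]_(m + k)) : bproj (swapset K) = shadow K.
Proof. by apply/seteqP; split => y [z]; rewrite ?swapsetE => h; exists z; rewrite ?swapsetE. Qed.

Lemma cbody_preimage_mulmx n p (M : 'M[R]_(n, p)) (N : 'M[R]_(p, n)) (K : set 'rV[R]_p) :
  M *m N = 1%:M -> cbody K -> cbody [set y : 'rV_n | K (y *m M)].
Proof.
move=> MN [cK vK]; split; first exact: (compact_preimage_mulmx MN).
move=> x y a b Kx Ky a0 b0 ab /=.
by rewrite mulmxDl -!scalemxAl; exact: vK.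
Qed.

Lemma cbody_swapset m k (K : set 'rV[R]_(m + k)) : cbody K -> cbody (swapset K).
Proof. by apply: cbody_preimage_mulmx; exact: swapmxK. Qed.

Lemma vol_swapset m k (K : set 'rV[R]_(m + k)) : cbody K -> vol (swapset K) = vol K.
Proof.
by move=> [cK _]; apply: vol_isometry => //; [exact: addnC | exact: swapmxK].
Qed.

Lemma cbody_base m k (K : set 'rV[R]_(m + k)) : cbody K -> cbody (base K).
Proof.
by move=> bK; rewrite -bfiber_swapset; apply: cbody_bfiber; exact: cbody_swapset.
Qed.

Lemma cbody_shadow m k (K : set 'rV[R]_(m + k)) : cbody K -> cbody (shadow K).
Proof.
by move=> bK; rewrite -bproj_swapset; apply: cbody_bproj; exact: cbody_swapset.
Qed.

Lemma volume_ge0 n (K : set 'rV[R]_n) : 0 <= volume K.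
Proof. by rewrite fine_ge0// vol_ge0. Qed.

(** Symmetry makes the central fiber the largest one: for (y, u) and (y, v) in the body, the
    midpoint of (y, u) and -(y, v) is (0, (u - v) / 2), so the central fiber contains the
    half-difference set of the fiber over y, and [vol_le_halfdiff] applies. *)
Lemma volume_le_section m k (K : set 'rV[R]_(m + k)) :
  cbody K -> (forall x, K x -> K (- x)) ->
  volume K <= volume (shadow K) * volume (base K).
Proof.
move=> bK sK; have bK' := cbody_swapset bK.
rewrite -lee_fin EFinM -(volumeE (proj1 bK)) -(volumeE (proj1 (cbody_shadow bK))).
rewrite -(vol_swapset bK) muleC.
apply: vol_le_base; first exact: volume_ge0.
- by case: bK'.
- by case: (cbody_shadow bK).
move=> y; have [[z Kyz]|nK] := pselect (bproj (swapset K) y); last first.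
  suff -> : bfiber (swapset K) y = set0.
    by rewrite vol0 lee_fin mulr_ge0// ?volume_ge0// indicE.
  by apply/seteqP; split => // z Kyz; apply: nK; exists z.
rewrite indicE mem_set; last by rewrite -bproj_swapset; exists z.
rewrite mulr1 -volumeE; last by case: (cbody_base bK).
apply: le_trans (vol_le_halfdiff (cbody_bfiber y bK')) _; apply: le_vol.
move=> _ [[u v] [/= Ku Kv] <-]; rewrite -bfiber_swapset /bfiber/=.
have [_ vK'] := bK'.
have -> : row_mx (0 : 'rV_k) (2^-1 *: (u - v)) =
    2^-1 *: row_mx y u + 2^-1 *: (- row_mx y v).
  rewrite opp_row_mx !scale_row_mx add_row_mx -!scalerDr subrr scaler0.
  by [].
apply: vK' => //; last by lra.
by rewrite opp_row_mx swapsetE -opp_row_mx; apply: sK; rewrite -swapsetE.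
Qed.

Lemma cbody_simplex n (r : R) : cbody (@simplex R n r).
Proof.
split.
  apply: (@subclosed_compact _ _ (box `|r|)).
  - rewrite (_ : simplex _ = (\bigcap_i [set z : 'rV[R]_n | 0 <= z 0 i]) `&` [set z | weight z <= r]).
      apply: closedI.
        apply: closed_bigI => i _.
        apply: (@closed_preimage _ _ (fun z : 'rV[R]_n => z 0 i) [set x | 0 <= x]).
          exact: cont_coord.
        exact: closed_ge.
      apply: (@closed_preimage _ _ (fun z : 'rV[R]_n => weight z) [set x | x <= r]).
        by apply: sum_continuous => i; exact: cont_coord.
      exact: closed_le.
    apply/seteqP; split => z [z0 zr]; split => //.
      by move=> i _; exact: z0.
    by move=> i; exact: z0.
  - apply: (@rV_compact _ _ (fun=> `[(- `|r|), `|r|]%classic)) => i.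
    exact: segment_compact.
  - move=> z [z0 zr] i; rewrite /= in_itv/= -ler_norml ger0_norm//.
    apply: le_trans (le_trans zr (ler_norm r)).
    by rewrite /weight (bigD1 i)//= lerDl sumr_ge0.
move=> x y a b [x0 xr] [y0 yr] a0 b0 ab; split.
  by move=> i; rewrite !mxE addr_ge0// mulr_ge0.
rewrite /weight; under eq_bigr do rewrite !mxE.
rewrite big_split/= -!mulr_sumr -/(weight x) -/(weight y).
have -> : r = a * r + b * r by rewrite -mulrDl ab mul1r.
by apply: lerD; exact: ler_wpM2l.
Qed.

Lemma compact_cone m k (P : set 'rV[R]_k) (r : R) : compact P -> compact (@cone R m k P r).
Proof.
move=> cP; pose f (p : 'rV[R]_m * 'rV[R]_k) := row_mx p.1 ((r - weight p.1) *: p.2).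
rewrite (_ : cone P r = f @` (@simplex R m r `*` P)).
  apply: compact_image; last by apply: compact_setX => //; case: (cbody_simplex m r).
  apply: row_mx_continuous; first exact: cont_fst.
  apply: contZ; last exact: cont_snd.
  apply: contD; first exact: cont_cst.
  have cw : continuous (fun p : 'rV[R]_m * 'rV[R]_k => weight p.1).
    by apply: sum_continuous => i; exact: (cont_comp (@cont_fst _ _) (@cont_coord _ _ _ _ _)).
  by move=> p; apply: cvgN; exact: cw.
apply/seteqP; split => v.
  rewrite -(hsubmxK v) => /coneE[z0 zr [p Pp ->]].
  by exists (lsubmx v, p).
by move=> [[z p] [[z0 zr] /= Pp] <-]; apply/coneE; split => //; exists p.
Qed.

(* K contains, over each y in its shadow P, a homothetic copy of its central
   section of ratio 1 - s, where s is the gauge of y with respect to P; the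
   fibers of the cone over P are simplices of the same ratio. *)
Lemma rogers_shephard m k (K : set 'rV[R]_(m + k)) : cbody K ->
  volume (shadow K) * volume (base K) <= 'C(m + k, k)%:R * volume K.
Proof.
move=> bK; have bK' := cbody_swapset bK; have [cK' vK'] := bK'.
have bP := cbody_shadow bK; have [cP vP] := bP.
have bB := cbody_base bK; have [cB vB] := bB.
have [[z0 Bz0]|nB] := pselect (base K !=set0); last first.
  have -> : base K = set0.
    by apply/seteqP; split => // z Bz; apply: nB; exists z.
  by rewrite /volume vol0 mulr0 mulr_ge0// fine_ge0// vol_ge0.
have P0 : shadow K 0 by exists z0.
pose D := swapset (@cone R m k (shadow K) 1).
have cD : compact D.
  by apply: (compact_preimage_mulmx (@swapmxK k m)); exact: compact_cone.
have vD : vol D = (volume (shadow K) * k`!%:R / (m + k)`!%:R)%:E.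
  rewrite (vol_isometry (addnC k m) (@swapmxK k m)); last exact: compact_cone.
  rewrite vol_cone_body//; [by rewrite expr1n mul1r | by exists 0].
have key : ((m`!%:R * volume (base K))%:E * vol D <= vol (swapset K))%E.
  apply: vol_ge_fibers => //; first by rewrite mulr_ge0// volume_ge0.
  move=> y; have [[z Dyz]|nD] := pselect (bfiber D y !=set0); last first.
    have -> : bfiber D y = set0.
      by apply/seteqP; split => // z Dz; apply: nD; exists z.
    by rewrite vol0 mule0 vol_ge0.
  (* The gauge of [y] is the least s with y = s p and p in the shadow; compactness of [S] provides a
     minimizer. *)
  pose S : set (R * 'rV[R]_k) :=
    (`[0, 1]%classic `*` shadow K) `&` [set p | p.1 *: p.2 = y].
  have cS : compact S.
    apply: compact_closedI; first by apply: compact_setX => //; exact: segment_compact.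
    apply: (@closed_preimage _ _ (fun p : R * 'rV[R]_k => p.1 *: p.2) [set y]).
      by apply: contZ; [exact: cont_fst | exact: cont_snd].
    by apply: compact_closed_rV; exact: compact_set1.
  have DS z' : bfiber D y z' ->
      exists2 p, S (1 - weight z', p) & nonneg z' /\ weight z' <= 1.
    rewrite /bfiber/= /D swapsetE => /coneE[z'0 z'1 [p Pp yp]]; exists p => //.
    split => //; split => //=; rewrite in_itv/= subr_ge0 z'1/=.
    by have := weight_ge0 z'0; lra.
  have S0 : S !=set0 by have [p Sp _] := DS _ Dyz; exists (1 - weight z, p).
  have [[s p] /set_mem[[/= s01 Pp] sp] smin] := @compact_EVT_min _ R (fun p => p.1) S S0 cS
    (continuous_subspaceT (@cont_fst _ _)).
  move: s01; rewrite in_itv/= => /andP[sge0 sle1].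
  (* A point z' of the cone fiber has y = (1 - weight z') p with p in the shadow, so minimality of
     [s] confines it to the simplex of size 1 - s; the factor m! cancels the volume of the unit
     simplex. *)
  apply: (@le_trans _ _ ((m`!%:R * volume (base K))%:E * vol (@simplex R m (1 - s)))%E).
    rewrite lee_wpmul2l// ?lee_fin ?mulr_ge0// ?volume_ge0//; apply: le_vol => z' /DS[q Sq [z'0 z'1]].
    by split => //; have := smin _ (mem_set Sq) => /=; lra.
  rewrite vol_simplex; last by lra.
  rewrite -EFinM (_ : _ * _ = (1 - s) ^+ m * volume (base K)); last first.
    by field; rewrite pnatr_eq0 -lt0n fact_gt0.
  (* Convex combinations with the point (w, p) of [K] put into the fiber over y = s p the central
     section scaled by 1 - s and translated by s w. *)
  have [w Kwp] := Pp.
  have s10 : 0 <= 1 - s by lra.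
  rewrite EFinM -volumeE// -vol_scale//.
  rewrite -[X in (X <= _)%E](vol_translate (- (s *: w))); last first.
    by apply: compact_image => //; apply: contZ; [exact: cont_cst|exact: cont_id].
  apply: le_vol => v /= [b Bb e]; rewrite /bfiber/=.
  have -> : row_mx y v = (1 - s) *: row_mx 0 b + s *: row_mx p w.
    rewrite !scale_row_mx add_row_mx scaler0 add0r sp e.
    by rewrite subrK.
  by apply: vK' => //; rewrite ?swapsetE//; lra.
move: key; rewrite vD vol_swapset// volumeE; last by case: bK.
rewrite -EFinM lee_fin => key.
have := ler_wpM2l (ler0n R 'C(m + k, k)) key.
apply: le_trans; rewrite le_eqVlt; apply/orP; left; apply/eqP.
have := bin_fact (leq_addl m k); rewrite addnK => <-; rewrite !natrM.
by field; rewrite !pnatr_eq0 -!lt0n !fact_gt0 bin_gt0 leq_addl.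
Qed.

End section_inequalities.

(** * Mixed volumes with segments *)

Section mixed_volumes.
Context {R : realType}.

Fixpoint zsum n (K : set 'rV[R]_n) (us : seq 'rV[R]_n) : set 'rV[R]_n :=
  if us is u :: us' then zsum (seg K u) us' else K.

(* [mixvol [:: u_1; ...; u_j] K] is n! / (n - j)! times the mixed volume of the
   segments [0, u_1], ..., [0, u_j] and n - j copies of K. *)
Fixpoint mixvol n (us : seq 'rV[R]_n) (K : set 'rV[R]_n) : R :=
  if us is u :: us' then mixvol us' (seg K u) - mixvol us' K else volume K.

Fixpoint subs (T : Type) (us : seq T) : seq (seq T) :=
  if us is u :: us' then subs us' ++ [seq u :: s | s <- subs us'] else [:: [::]].

Lemma subs_map (T U : Type) (f : T -> U) us : subs (map f us) = map (map f) (subs us).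
Proof.
elim: us => //= u us IH; rewrite IH map_cat -!map_comp; congr (_ ++ _).
Qed.

(** Each segment adds its difference term, so the volume expands over sublists; when the segments
    are scaled, the sublists of length j make up the coefficient of degree j. *)
Lemma volume_zsum n (K : set 'rV[R]_n) us :
  volume (zsum K us) = \sum_(s <- subs us) mixvol s K.
Proof.
elim: us K => [|u us IH] K /=; first by rewrite big_seq1.
rewrite big_cat/= big_map IH -big_split/=; apply: eq_bigr => s _.
by rewrite addrC subrK.
Qed.

Lemma seg0 n (K : set 'rV[R]_n) : seg K 0 = K.
Proof.
apply/seteqP; split => x.
  by move=> /segP[y [t [Ky _ ->]]]; rewrite scaler0 addr0.
by move=> Kx; apply/segP; exists x, 0; rewrite scaler0 addr0 lexx ler01.
Qed.

Lemma segC n (K : set 'rV[R]_n) u v : seg (seg K u) v = seg (seg K v) u.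
Proof.
have h a b : seg (seg K a) b `<=` seg (seg K b) a.
  move=> x /segP[y [t [/segP[z [s [Kz s01 ->]]] t01 ->]]].
  apply/segP; exists (z + t *: b), s; split => //; last by rewrite addrAC.
  by apply/segP; exists z, t.
by apply/seteqP; split; exact: h.
Qed.

Lemma mixvol_mem0 n (us : seq 'rV[R]_n) K : 0 \in us -> mixvol us K = 0.
Proof.
elim: us K => //= u us IH K; rewrite inE => /predU1P[<-|h].
  by rewrite seg0 subrr.
by rewrite !IH// subrr.
Qed.

Lemma seg_preimage n p (N : 'M[R]_(n, p)) (K : set 'rV[R]_p) u :
  seg [set y : 'rV_n | K (y *m N)] u = [set y : 'rV_n | seg K (u *m N) (y *m N)].
Proof.
apply/seteqP; split => y.
  move=> /segP[x [t [Kx t01 ->]]]; apply/segP; exists (x *m N), t.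
  by rewrite mulmxDl scalemxAl.
move=> /= /segP[x [t [Kx t01 e]]]; apply/segP; exists (y - t *: u), t; split => //.
  by rewrite /= mulmxBl e -scalemxAl addrK.
by rewrite subrK.
Qed.

Lemma mixvol_isometry n p (e : n = p) (N : 'M[R]_(n, p)) us (K : set 'rV[R]_p) :
  N *m N^T = 1%:M -> cbody K ->
  mixvol us [set y | K (y *m N)] = mixvol [seq u *m N | u <- us] K.
Proof.
move=> NN; elim: us K => [|u us IH] K bK /=.
  by rewrite /volume (vol_isometry e)//; case: bK.
by rewrite seg_preimage !IH//; exact: cbody_seg.
Qed.

Lemma proj_tail_seg n (K : set 'rV[R]_n.+1) u : proj_tail (seg K u) = seg (proj_tail K) (tail u).
Proof.
apply/seteqP; split => y.
  move=> [v /segP[x [t [Kx t01 ->]]] <-]; apply/segP; exists (tail x), t.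
  by rewrite tailD tailZ; split => //; exists x.
move=> /segP[_ [t [[x Kx <-] t01 ->]]]; exists (x + t *: u); last by rewrite tailD tailZ.
by apply/segP; exists x, t.
Qed.

Lemma volume_seg n (K : set 'rV[R]_n.+1) c : cbody K ->
  volume (seg K (cons_row c 0)) = volume K + `|c| * volume (proj_tail K).
Proof.
move=> bK; apply: EFin_inj; have [cK _] := bK.
rewrite EFinD EFinM -(volumeE (@compact_seg _ _ K (cons_row c 0) cK)) -(volumeE cK).
by rewrite -(volumeE (proj1 (cbody_proj_tail bK))) vol_seg.
Qed.

Lemma mixvol_seg n us (K : set 'rV[R]_n.+1) c : cbody K ->
  mixvol us (seg K (cons_row c 0)) =
  mixvol us K + `|c| * mixvol (map (@tail R n) us) (proj_tail K).
Proof.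
elim: us K => [|u us IH] K bK /=; first exact: volume_seg.
rewrite segC !IH//; last exact: cbody_seg.
by rewrite proj_tail_seg; ring.
Qed.

(** Adding segments commutes with projecting, and [vol_seg] is affine in |c|, so a segment on the
    first axis lowers the dimension by one. Rotating the first segment to that axis then yields the
    sign, the homogeneity and the vanishing of [mixvol]. *)
Lemma mixvol_cons n us (K : set 'rV[R]_n.+1) c : cbody K ->
  mixvol (cons_row c 0 :: us) K = `|c| * mixvol (map (@tail R n) us) (proj_tail K).
Proof. by move=> bK /=; rewrite mixvol_seg// addrC addKr. Qed.

Definition dot n (u v : 'rV[R]_n) : R := \sum_i u 0 i * v 0 i.

Lemma mulmx_dot n (u v : 'rV[R]_n) : u *m v^T = (dot u v)%:M.
Proof.
apply/matrixP => i j; rewrite !ord1 !mxE eqxx mulr1n.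
by apply: eq_bigr => k _; rewrite mxE.
Qed.

Lemma dot_ge0 n (u : 'rV[R]_n) : 0 <= dot u u.
Proof. by apply: sumr_ge0 => i _; rewrite -expr2 sqr_ge0. Qed.

Lemma dot_eq0 n (u : 'rV[R]_n) : dot u u = 0 -> u = 0.
Proof.
move=> /eqP; rewrite psumr_eq0 => [/allP h|i _]; last by rewrite -expr2 sqr_ge0.
apply/rowP => i; rewrite mxE; apply/eqP.
by have := h i (mem_index_enum i); rewrite /= mulf_eq0 orbb.
Qed.

Lemma dotC n (u v : 'rV[R]_n) : dot u v = dot v u.
Proof. by apply: eq_bigr => i _; rewrite mulrC. Qed.

Lemma dotDl n (u v w : 'rV[R]_n) : dot (u + v) w = dot u w + dot v w.
Proof. by rewrite /dot -big_split; apply: eq_bigr => i _; rewrite mxE mulrDl. Qed.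

Lemma dotZl n a (u v : 'rV[R]_n) : dot (a *: u) v = a * dot u v.
Proof. by rewrite /dot mulr_sumr; apply: eq_bigr => i _; rewrite mxE mulrA. Qed.

Lemma dotNl n (u v : 'rV[R]_n) : dot (- u) v = - dot u v.
Proof. by rewrite -scaleN1r dotZl mulN1r. Qed.

Lemma dot_mulmx n p (u : 'rV[R]_n) (v : 'rV[R]_p) (Q : 'M[R]_(n, p)) :
  dot (u *m Q) v = dot u (v *m Q^T).
Proof.
have : (dot (u *m Q) v)%:M = (dot u (v *m Q^T))%:M :> 'M[R]_1.
  by rewrite -!mulmx_dot trmx_mul trmxK mulmxA.
by move/matrixP/(_ 0 0); rewrite !mxE !eqxx !mulr1n.
Qed.

Lemma dot_cons n (u : 'rV[R]_n.+1) (c : R) : dot u (cons_row c 0) = u 0 0 * c.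
Proof.
rewrite /dot big_ord_recl cons_row0 big1 ?addr0// => i _.
by rewrite cons_rowS mxE mulr0.
Qed.

Definition isorth n (Q : 'M[R]_n) := Q *m Q^T = 1%:M.

Lemma isorthT n (Q : 'M[R]_n) : isorth Q -> isorth Q^T.
Proof. by rewrite /isorth trmxK => /mulmx1C. Qed.

Lemma isorth1 n : isorth (1%:M : 'M[R]_n).
Proof. by rewrite /isorth trmx1 mulmx1. Qed.

Lemma isorthM n (P Q : 'M[R]_n) : isorth P -> isorth Q -> isorth (P *m Q).
Proof.
rewrite /isorth => hP hQ.
by rewrite trmx_mul mulmxA -[P *m Q *m Q^T]mulmxA hQ mulmx1.
Qed.

Lemma isorth_block n p (P : 'M[R]_n) (Q : 'M[R]_p) :
  isorth P -> isorth Q -> isorth (block_mx P 0 0 Q).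
Proof.
rewrite /isorth => hP hQ; rewrite tr_block_mx !trmx0 mulmx_block.
by rewrite !mulmx0 !mul0mx !addr0 !add0r hP hQ -scalar_mx_block.
Qed.

(** The reflection in the hyperplane orthogonal to v = u - d e_0, where d is the norm of u,
    exchanges u and d e_0 because they have the same norm; this equality is what [sE] records. *)
Lemma householder n (u : 'rV[R]_n.+1) : exists Q : 'M[R]_n.+1,
  isorth Q /\ u *m Q = cons_row (Num.sqrt (dot u u)) 0.
Proof.
set d := Num.sqrt (dot u u); pose v := u - cons_row d 0.
have [v0|v0] := eqVneq v 0.
  exists 1%:M; split; first exact: isorth1.
  by rewrite mulmx1; apply/eqP; rewrite -subr_eq0 -/v v0.
pose s := dot v v.
have s0 : s != 0 by apply: contra_neq v0 => /dot_eq0.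
have d2 : d * d = dot u u by rewrite -expr2 sqr_sqrtr// dot_ge0.
have sE : s = 2 * dot u v.
  rewrite /s [in RHS]dotC /v !dotDl !dotNl ![dot _ (u - _)]dotC !dotDl !dotNl.
  rewrite [dot (cons_row d 0) u]dotC !dot_cons cons_row0 -d2; ring.
exists (1%:M - (2 / s) *: (v^T *m v)); split.
  set A := v^T *m v.
  have AT : A^T = A by rewrite trmx_mul trmxK.
  have AA : A *m A = s *: A.
    by rewrite /A mulmxA -[v^T *m v *m v^T]mulmxA mulmx_dot -/s mul_mx_scalar -scalemxAl.
  rewrite /isorth (_ : (_ - _)^T = 1%:M - (2 / s) *: A); last first.
    by rewrite [LHS]linearB /= trmx1 [X in _ - X]linearZ /= AT.
  rewrite mulmxBl mul1mx mulmxBr mulmx1 -scalemxAl -scalemxAr AA.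
  by apply/matrixP => i j; rewrite !mxE; move: (\sum_k _ * _) => x; field.
rewrite mulmxBr mulmx1 -scalemxAr mulmxA mulmx_dot mul_scalar_mx scalerA.
have -> : 2 / s * dot u v = 1 by rewrite mulrAC -sE divff.
by rewrite scale1r /v opprB addrC subrK.
Qed.

Lemma mixvol_rotate n (Q : 'M[R]_n) us (K : set 'rV[R]_n) : isorth Q -> cbody K ->
  mixvol us K = mixvol [seq u *m Q | u <- us] [set y | K (y *m Q^T)].
Proof.
move=> oQ bK; rewrite mixvol_isometry//; last exact: isorthT.
rewrite -map_comp -[in LHS](map_id us); congr mixvol; apply: eq_map => u /=.
by rewrite -mulmxA (oQ : _ = _) mulmx1.
Qed.

Lemma cbody_rotate n (Q : 'M[R]_n) (K : set 'rV[R]_n) : isorth Q ->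
  cbody K -> cbody [set y | K (y *m Q)].
Proof. by move=> oQ; exact: (cbody_preimage_mulmx (oQ : _ *m _ = _)). Qed.

Lemma mixvol_ge0 n us (K : set 'rV[R]_n) : cbody K -> 0 <= mixvol us K.
Proof.
elim: n us K => [|n IH] [|u us] K bK; try exact: volume_ge0.
  by rewrite mixvol_mem0// inE; apply/orP; left; apply/eqP/rowP => -[].
have [Q [oQ uQ]] := householder u.
have oQT := isorthT oQ.
have bK' : cbody [set y | K (y *m Q^T)] by exact: cbody_rotate.
by rewrite (mixvol_rotate _ oQ)// map_cons uQ mixvol_cons// mulr_ge0// IH//; exact: cbody_proj_tail.
Qed.

(** Each segment uses up one dimension, and in dimension 0 all segments are trivial. This bounds the
    degree of the volume of [K] plus a scaled zonotope. *)
Lemma mixvol_size_gt n us (K : set 'rV[R]_n) : cbody K -> (n < size us)%N ->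
  mixvol us K = 0.
Proof.
elim: n us K => [|n IH] [|u us] K bK// su.
  by rewrite mixvol_mem0// inE; apply/orP; left; apply/eqP/rowP => -[].
have [Q [oQ uQ]] := householder u.
have bK' : cbody [set y | K (y *m Q^T)] by apply: cbody_rotate => //; exact: isorthT.
rewrite (mixvol_rotate _ oQ)// map_cons uQ mixvol_cons// IH ?mulr0//; first exact: cbody_proj_tail.
by rewrite !size_map.
Qed.

Lemma mixvol_scale_head n u us (K : set 'rV[R]_n) (c : R) : cbody K ->
  mixvol (c *: u :: us) K = `|c| * mixvol (u :: us) K.
Proof.
case: n u us K => [|n] u us K bK.
  by rewrite !mixvol_mem0 ?mulr0// inE; apply/orP; left; apply/eqP/rowP => -[].
have [Q [oQ uQ]] := householder u.
have bK' : cbody [set y | K (y *m Q^T)] by apply: cbody_rotate => //; exact: isorthT.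
rewrite [LHS](mixvol_rotate _ oQ)// [in RHS](mixvol_rotate _ oQ)// !map_cons -scalemxAl uQ cons_rowZ scaler0.
by rewrite !mixvol_cons// normrM mulrA.
Qed.

Lemma mixvol_scale n us (K : set 'rV[R]_n) (c : R) : cbody K ->
  mixvol [seq c *: u | u <- us] K = `|c| ^+ size us * mixvol us K.
Proof.
elim: us K => [|u us IH] K bK; first by rewrite /= expr0 mul1r.
rewrite map_cons mixvol_scale_head//= !IH//; last exact: cbody_seg.
by rewrite exprS; ring.
Qed.

End mixed_volumes.

(** * Reduction of segments to coordinate directions *)

Section canonical_frames.
Context {R : realType}.

Definition stdrows m j : seq 'rV[R]_m := mkseq (fun i => \row_l (l == i :> nat)%:R) j.

Lemma stdrowsS m j :
  stdrows m.+1 j.+1 = cons_row 1 0 :: [seq cons_row 0 x | x <- stdrows m j].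
Proof.
rewrite /stdrows /mkseq /= (iotaDl 1) -!map_comp; congr (_ :: _).
  apply/rowP => i; rewrite mxE; case: (unliftP 0 i) => [l|] ->; last by rewrite cons_row0.
  by rewrite cons_rowS mxE.
apply: eq_map => i /=; apply/rowP => l; rewrite mxE.
case: (unliftP 0 l) => [p|] ->; last by rewrite cons_row0.
by rewrite cons_rowS mxE.
Qed.

Definition pad m k (x : 'rV[R]_m) : 'rV[R]_(m + k) := row_mx x 0.

Lemma pad_mul m k (x : 'rV[R]_m) (Q : 'M[R]_m) (P : 'M[R]_k) :
  pad k x *m block_mx Q 0 0 P = pad k (x *m Q).
Proof. by rewrite /pad mul_row_block !mul0mx !mulmx0 !addr0. Qed.

Lemma pad_cons m k c (x : 'rV[R]_m) : pad k (cons_row c x) = cons_row c (pad k x).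
Proof. exact: row_mx_cons. Qed.

Lemma pad0 m k : pad k 0 = 0 :> 'rV[R]_(m + k).
Proof. by rewrite /pad row_mx0. Qed.

Lemma cons_row_block m (c x : R) (y : 'rV[R]_m) (Q : 'M[R]_m) :
  cons_row x y *m (block_mx (c%:M : 'M[R]_1) 0 0 Q : 'M[R]_m.+1) = cons_row (c * x) (y *m Q).
Proof. by rewrite cons_row_mul_block scaler0 addr0. Qed.

Lemma isorth_cons m (Q : 'M[R]_m) : isorth Q ->
  isorth (block_mx (1%:M : 'M[R]_1) 0 0 Q : 'M[R]_m.+1).
Proof. by move=> oQ; apply: (@isorth_block _ 1 m) => //; exact: isorth1. Qed.

(* Gram-Schmidt: the factor c and the rotation Q depend only on X, so that the
   same ones serve K and its sections. *)
Lemma mixvol_canonical m (X : seq 'rV[R]_m) : exists c (Q : 'M[R]_m),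
  [/\ 0 <= c, isorth Q & forall k (K : set 'rV[R]_(m + k)), cbody K ->
    mixvol (map (pad k) X) K =
    c * mixvol [seq pad k (x *m Q) | x <- stdrows m (size X)] K].
Proof.
elim: m X => [|m IH] [|u X].
- exists 1, 1%:M; split => //; first exact: isorth1.
  by move=> k K bK; rewrite mul1r.
(* In dimension 0 a nonempty list consists of zero segments, whence the factor 0. *)
- exists 0, 1%:M; split => //; first exact: isorth1.
  move=> k K bK; rewrite mul0r mixvol_mem0// inE; apply/orP; left; apply/eqP.
  by rewrite (_ : u = 0) ?pad0//; apply/rowP => -[].
- exists 1, 1%:M; split => //; first exact: isorth1.
  by move=> k K bK; rewrite mul1r.
(* [H] puts [u] on the first axis, where it splits off its length [d] and a projection. The
   induction treats the projected segments, so the final factor is the product of the successive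
   residual lengths. *)
have [H [oH uH]] := householder u; set d := Num.sqrt _ in uH.
have [c [Q [c0 oQ hQ]]] := IH [seq tail (x *m H) | x <- X].
pose B : 'M[R]_m.+1 := block_mx (1%:M : 'M[R]_1) 0 0 Q.
exists (d * c), (B *m H^T); split.
- by rewrite mulr_ge0// sqrtr_ge0.
- by apply: isorthM; [exact: isorth_cons | exact: isorthT].
move=> k K bK.
pose H' : 'M[R]_(m.+1 + k) := block_mx H 0 0 1%:M.
have oH' : isorth H' by apply: isorth_block => //; exact: isorth1.
pose K' : set 'rV[R]_(m + k).+1 := [set y : 'rV[R]_(m.+1 + k) | K (y *m H'^T)].
have bK' : cbody K' by apply: cbody_rotate => //; exact: isorthT.
rewrite (mixvol_rotate _ oH' bK) -map_comp.
have -> : [seq (fun x => pad k x *m H') x | x <- u :: X] =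
    cons_row d 0 :: [seq pad k (x *m H) | x <- X] :> seq 'rV[R]_(m + k).+1.
  rewrite /= pad_mul uH pad_cons pad0; congr (_ :: _).
  by apply: eq_map => x; rewrite pad_mul.
rewrite (mixvol_cons _ _ bK') ger0_norm ?sqrtr_ge0// -mulrA; congr (_ * _).
have -> : [seq tail (x : 'rV[R]_(m + k).+1) | x <- [seq pad k (x *m H) | x <- X]] =
    [seq pad k x | x <- [seq tail (x *m H) | x <- X]].
  rewrite -!map_comp; apply: eq_map => x /=.
  by rewrite -{1}(cons_row_eta (x *m H)) pad_cons tail_cons.
rewrite hQ; last exact: cbody_proj_tail.
congr (_ * _); rewrite [in RHS](mixvol_rotate _ oH' bK).
have hx x : pad k (x *m (B *m H^T)) *m H' = pad k (x *m B).
  have HH : H^T *m H = 1%:M by rewrite -{2}[H]trmxK; exact: isorthT.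
  by rewrite pad_mul -!mulmxA HH mulmx1.
have -> : [seq y *m H' | y <- [seq pad k (x *m (B *m H^T)) | x <- stdrows m.+1 (size (u :: X))]] =
    cons_row 1 0 :: [seq cons_row 0 (pad k (x *m Q)) | x <- stdrows m (size X)]
    :> seq 'rV[R]_(m + k).+1.
  rewrite -map_comp [size (u :: X)]/= stdrowsS map_cons -map_comp [X in X :: _]/= hx cons_row_block.
  rewrite mul1r mul0mx pad_cons pad0; congr (_ :: _); apply: eq_map => x /=.
  by rewrite hx cons_row_block mul1r pad_cons.
rewrite (mixvol_cons _ _ bK') normr1 mul1r -map_comp size_map.
by congr mixvol; apply: eq_map => x /=; rewrite tail_cons.
Qed.

End canonical_frames.

(** * Section inequalities for mixed volumes *)

Section mixed_section_inequalities.
Context {R : realType}.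

Lemma base_proj_tail m k (K : set 'rV[R]_(m.+1 + k)) :
  base (proj_tail (K : set 'rV[R]_(m + k).+1) : set 'rV[R]_(m + k)) = proj_tail (base K).
Proof.
apply/seteqP; split => z.
  move=> [v Kv e]; exists (cons_row (v 0 0) z); last exact: tail_cons.
  by rewrite /base/= row_mx_cons -e cons_row_eta.
move=> [z' Kz' <-]; exists (row_mx z' 0 : 'rV[R]_(m.+1 + k)) => //.
by rewrite -{1}(cons_row_eta z') row_mx_cons tail_cons.
Qed.

Lemma shadow_proj_tail m k (K : set 'rV[R]_(m.+1 + k)) :
  shadow (proj_tail (K : set 'rV[R]_(m + k).+1) : set 'rV[R]_(m + k)) = shadow K.
Proof.
apply/seteqP; split => y.
  move=> [z [v Kv e]]; exists (cons_row (v 0 0) z).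
  by rewrite row_mx_cons -e cons_row_eta.
move=> [z Kz]; exists (tail z), (row_mx z y : 'rV[R]_(m.+1 + k)) => //.
by rewrite -{1}(cons_row_eta z) row_mx_cons tail_cons.
Qed.

(** [L] is [K] projected along its first j coordinates. These directions lie in the subspace of the
    section, so the shadow on the orthogonal space is unchanged, and projecting commutes with taking
    the section. *)
Lemma mixvol_stdrows j m k (K : set 'rV[R]_(j + m + k)) : cbody K ->
  (forall x, K x -> K (- x)) ->
  exists L : set 'rV[R]_(m + k),
    [/\ cbody L, (forall x, L x -> L (- x)), shadow L = shadow K,
      mixvol (map (pad k) (@stdrows R (j + m) j)) K = volume L &
      mixvol (@stdrows R (j + m) j) (base K) = volume (base L)].
Proof.
elim: j K => [|j IH] K bK sK; first by exists K.
have sK' x : proj_tail (K : set 'rV[R]_(j + m + k).+1) x ->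
    proj_tail (K : set 'rV[R]_(j + m + k).+1) (- x).
  by move=> [v Kv <-]; exists (- v); [exact: sK | rewrite tailN].
have [L [bL sL shL vL vbL]] := IH _ (cbody_proj_tail bK) sK'.
exists L; split => //.
- by rewrite shL shadow_proj_tail.
- rewrite -vL (stdrowsS (j + m) j) map_cons pad_cons pad0.
  rewrite (mixvol_cons _ _ bK) normr1 mul1r -!map_comp.
  by congr mixvol; apply: eq_map => x /=; rewrite pad_cons tail_cons.
- rewrite -vbL base_proj_tail (stdrowsS (j + m) j).
  rewrite mixvol_cons ?normr1 ?mul1r; last exact: cbody_base.
  by rewrite (mapK (@tail_cons R _ 0)).
Qed.

(** m + 0 is not convertible to m; this transport lets a statement on padded segments, taken at k =
    0, apply in R^m itself. *)
Lemma mixvol_pad0 m (X : seq 'rV[R]_m) (K : set 'rV[R]_m) : cbody K ->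
  exists2 K' : set 'rV[R]_(m + 0), cbody K' &
    forall X : seq 'rV[R]_m, mixvol X K = mixvol (map (pad 0) X) K'.
Proof.
move=> bK; pose N : 'M[R]_(m, m + 0) := row_mx 1%:M 0.
have NN : N *m N^T = 1%:M.
  by rewrite /N tr_row_mx mul_row_col trmx0 mulmx0 addr0 trmx1 mulmx1.
have NN' : N^T *m N = 1%:M.
  rewrite /N tr_row_mx mul_col_row trmx1 trmx0 !mul0mx !mul1mx.
  by rewrite (scalar_mx_block m 0 1); congr block_mx; apply/matrixP => -[].
exists [set w | K (w *m N^T)]; first exact: (cbody_preimage_mulmx NN').
move=> Y.
have -> : map (pad 0) Y = [seq y *m N | y <- Y].
  by apply: eq_map => y; rewrite /pad /N mul_mx_row mulmx1 mulmx0.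
rewrite -(mixvol_isometry (esym (addn0 m)) Y NN (cbody_preimage_mulmx NN' bK)).
congr mixvol; apply/seteqP.
by split => y /=; rewrite -mulmxA NN mulmx1.
Qed.

Lemma base_rotate m k (Q : 'M[R]_m) (K : set 'rV[R]_(m + k)) :
  base [set y | K (y *m block_mx Q 0 0 1%:M)] = [set z | base K (z *m Q)].
Proof. by apply/seteqP; split => z; rewrite /base/= [_ *m block_mx _ _ _ _]pad_mul. Qed.

Lemma volume_isometry n p (e : n = p) (N : 'M[R]_(n, p)) (K : set 'rV[R]_p) :
  N *m N^T = 1%:M -> cbody K -> volume [set y | K (y *m N)] = volume K.
Proof. by move=> NN [cK _]; rewrite /volume (vol_isometry e). Qed.

(** Let s be the volume of the common shadow, v and b the volumes of the rotated body and its
    section, l and bl those of [L]. Then v <= s b and s bl <= C(m + k, k) l give the first bound, l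
    <= s bl and s b <= C(j + m + k, k) v the second. *)
Lemma mixvol_base_bounds j m k (X : seq 'rV[R]_(j + m)) (K : set 'rV[R]_(j + m + k)) :
  size X = j -> cbody K -> (forall x, K x -> K (- x)) ->
  mixvol X (base K) * volume K <=
    'C(m + k, k)%:R * (mixvol (map (pad k) X) K * volume (base K)) /\
  mixvol (map (pad k) X) K * volume (base K) <=
    'C(j + m + k, k)%:R * (volume K * mixvol X (base K)).
Proof.
move=> sX bK sK; have [c [Q [c0 oQ hQ]]] := mixvol_canonical X.
have hX : mixvol X (base K) = c * mixvol [seq x *m Q | x <- @stdrows R (j + m) j] (base K).
  have [K' bK' e] := mixvol_pad0 X (cbody_base bK).
  by rewrite !e hQ// sX (map_comp (pad 0) (fun x => x *m Q)).
rewrite hX hQ// sX.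
pose Q' : 'M[R]_(j + m + k) := block_mx Q 0 0 1%:M.
have oQ' : isorth Q' by apply: isorth_block => //; exact: isorth1.
pose K' : set 'rV[R]_(j + m + k) := [set y | K (y *m Q')].
have bK' : cbody K' by exact: cbody_rotate.
have sK' x : K' x -> K' (- x) by rewrite /K'/= mulNmx; exact: sK.
have vK' : volume K' = volume K by rewrite volume_isometry.
have vB : volume (base K') = volume (base K).
  by rewrite base_rotate volume_isometry//; exact: cbody_base.
have -> : mixvol [seq x *m Q | x <- @stdrows R (j + m) j] (base K) =
    mixvol (@stdrows R (j + m) j) (base K').
  by rewrite base_rotate mixvol_isometry//; exact: cbody_base.
have -> : [seq pad k (x *m Q) | x <- @stdrows R (j + m) j] =
    [seq y *m Q' | y <- map (pad k) (@stdrows R (j + m) j)].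
  by rewrite -(map_comp (fun y => y *m Q') (pad k)); apply: eq_map => x /=; rewrite pad_mul.
rewrite -(mixvol_isometry erefl _ oQ' bK) -/K' -vK' -vB.
have [L [bL sL shL -> ->]] := mixvol_stdrows bK' sK'.
have A1 := volume_le_section bK' sK'; have B1 := rogers_shephard bK'.
have A2 := volume_le_section bL sL; have B2 := rogers_shephard bL.
rewrite shL in A2 B2.
have := volume_ge0 L; have := volume_ge0 (base L); have := volume_ge0 K'.
have := volume_ge0 (base K'); have := volume_ge0 (shadow K').
move: (volume L) (volume (base L)) (volume K') (volume (base K')) (volume (shadow K'))
  A1 B1 A2 B2 => l bl v b s A1 B1 A2 B2 s0 b0 v0 bl0 l0.
split.
  apply: le_trans (_ : c * (bl * (s * b)) <= _).
    by rewrite -[leLHS]mulrA; apply: (ler_wpM2l c0); exact: (ler_wpM2l bl0).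
  rewrite [leLHS](_ : _ = (c * b) * (s * bl)); last by ring.
  rewrite [leRHS](_ : _ = (c * b) * ('C(m + k, k)%:R * l)); last by ring.
  by apply: ler_wpM2l; rewrite ?mulr_ge0.
apply: le_trans (_ : c * ((s * bl) * b) <= _).
  by rewrite -[leLHS]mulrA; apply: (ler_wpM2l c0); exact: (ler_wpM2r b0).
rewrite [leLHS](_ : _ = (c * bl) * (s * b)); last by ring.
rewrite [leRHS](_ : _ = (c * bl) * ('C(j + m + k, k)%:R * v)); last by ring.
by apply: ler_wpM2l; rewrite ?mulr_ge0.
Qed.

Lemma eq_mulmxr m n (A B : 'M[R]_(m, n)) : (forall x : 'rV_m, x *m A = x *m B) -> A = B.
Proof. by move=> h; apply/row_matrixP => i; rewrite !rowE h. Qed.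

(** Reduces sections by any subspace to sections by a coordinate subspace. A reflection moves the
    first row to the first axis, orthogonality then clears the rest of the first column, and the
    remaining block is treated by induction. *)
Lemma frame_completion m k (F : 'M[R]_(m, m + k)) : F *m F^T = 1%:M ->
  exists2 Q : 'M[R]_(m + k), isorth Q & F = row_mx 1%:M 0 *m Q.
Proof.
elim: m F => [|m IH] F FF.
  by exists 1%:M; [exact: isorth1 | apply/matrixP => -[]].
pose r : 'rV[R]_(m + k).+1 := row 0 F.
have [H [oH rH]] := householder r.
pose G : 'M[R]_(m.+1, (m + k).+1) := F *m H.
have GG : G *m G^T = 1%:M.
  by rewrite /G trmx_mul mulmxA -[F *m H *m H^T]mulmxA (oH : _ *m _ = _) mulmx1.
have rr : dot r r = 1.
  have : (F *m F^T) 0 0 = 1 by rewrite FF mxE eqxx.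
  by rewrite mxE => <-; apply: eq_bigr => i _; rewrite !mxE.
have FG : F = G *m H^T by rewrite /G -mulmxA (oH : _ *m _ = _) mulmx1.
have r0 : row 0 G = cons_row 1 0 by rewrite row_mul -/r rH rr sqrtr1.
clearbody G; have G0 i : G 0 i = (cons_row 1 0 : 'rV[R]_(m + k).+1) 0 i by rewrite -r0 [RHS]mxE.
have GS i : G (lift 0 i) 0 = 0.
  have : (G *m G^T) (lift 0 i) 0 = 0 by rewrite GG mxE.
  rewrite mxE big_ord_recl big1 => [|l _].
    by rewrite addr0 [_^T _ _]mxE G0 cons_row0 mulr1.
  by rewrite [_^T _ _]mxE G0 cons_rowS [X in _ * X]mxE mulr0.
pose F' : 'M[R]_(m, m + k) := drsubmx (G : 'M[R]_(1 + m, 1 + (m + k))).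
have GF x (y : 'rV[R]_m) : cons_row x y *m G = cons_row x (y *m F').
  have -> : G = block_mx (1%:M : 'M[R]_1) 0 0 F' :> 'M[R]_(1 + m, 1 + (m + k)).
    rewrite -[LHS](@submxK _ 1 m 1 (m + k)); congr block_mx.
    - apply/matrixP => a b; rewrite !ord1 [RHS]mxE eqxx mulr1n.
      have := G0 0; rewrite cons_row0 => <-.
      by rewrite 2!mxE; congr (G _ _); exact: val_inj.
    - apply/matrixP => a b; rewrite !ord1 [RHS]mxE.
      have := G0 (lift 0 b); rewrite cons_rowS [RHS]mxE => <-.
      by rewrite 2!mxE; congr (G _ _); exact: val_inj.
    - apply/matrixP => a b; rewrite !ord1 [RHS]mxE -(GS a).
      by rewrite 2!mxE; congr (G _ _); exact: val_inj.
  rewrite /cons_row [LHS](mul_row_block (x%:M : 'M[R]_1) y (1%:M : 'M[R]_1) 0 0 F').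
  by rewrite !mulmx1 !mulmx0 addr0 add0r.
(* [F'] preserves inner products because [G] does so on vectors of first coordinate 0; the
   difference between y F' F'^T and y is thus orthogonal to every vector. *)
have FF' : F' *m F'^T = 1%:M.
  apply: eq_mulmxr => y; apply/eqP; rewrite mulmx1 -subr_eq0; apply/eqP.
  have h (x : 'rV[R]_m) : dot (y *m F') (x *m F') = dot y x.
    have : dot (cons_row 0 y *m G) (cons_row 0 x *m G) = dot (cons_row 0 y) (cons_row 0 x).
      by rewrite dot_mulmx -mulmxA GG mulmx1.
    by rewrite !GF /dot !big_ord_recl !cons_row0 !mul0r !add0r;
      under eq_bigr do rewrite !cons_rowS; move=> ->;
      under eq_bigr do rewrite !cons_rowS.
  by apply: dot_eq0; rewrite dotDl dotNl mulmxA dot_mulmx trmxK h subrr.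
have [Q oQ FQ] := IH F' FF'.
pose B : 'M[R]_((m + k).+1) := block_mx (1%:M : 'M[R]_1) 0 0 Q.
exists (B *m H^T); first by apply: isorthM; [exact: isorth_cons | exact: isorthT].
rewrite FG mulmxA; congr (_ *m _); apply: eq_mulmxr => x; rewrite -(cons_row_eta x) GF FQ.
rewrite [RHS]mulmxA.
have -> : cons_row (x 0 0) (tail x) *m (row_mx 1%:M 0 : 'M[R]_(m.+1, m.+1 + k)) =
    cons_row (x 0 0) (row_mx (tail x) 0).
  by rewrite mul_mx_row mulmx1 mulmx0 row_mx_cons.
by rewrite cons_row_block mul1r mulmxA mul_mx_row mulmx1 mulmx0.
Qed.

Lemma mixvol_slice_bounds n j m k (e : n = (j + m + k)%N) (F : 'M[R]_(j + m, n))
    (X : seq 'rV[R]_(j + m)) (K : set 'rV[R]_n) :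
  size X = j -> F *m F^T = 1%:M -> cbody K -> (forall x, K x -> K (- x)) ->
  let S := [set y | K (y *m F)] in
  mixvol X S * volume K <=
    'C(m + k, k)%:R * (mixvol [seq x *m F | x <- X] K * volume S) /\
  mixvol [seq x *m F | x <- X] K * volume S <=
    'C(n, k)%:R * (volume K * mixvol X S).
Proof.
subst n => sX FF bK sK S; have [Q oQ FQ] := frame_completion FF.
pose K' : set 'rV[R]_(j + m + k) := [set y | K (y *m Q)].
have bK' : cbody K' by exact: cbody_rotate.
have sK' x : K' x -> K' (- x) by rewrite /K'/= mulNmx; exact: sK.
have -> : S = base K'.
  by apply/seteqP; split => y; rewrite /S /base /K'/= FQ mulmxA mul_mx_row mulmx1 mulmx0.
have -> : [seq x *m F | x <- X] = [seq y *m Q | y <- map (pad k) X].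
  by rewrite -map_comp; apply: eq_map => x /=; rewrite FQ mulmxA mul_mx_row mulmx1 mulmx0.
rewrite -(mixvol_isometry erefl _ oQ bK) -/K' -(volume_isometry erefl oQ bK).
exact: mixvol_base_bounds.
Qed.

End mixed_section_inequalities.

(** * Averages over rotations *)

Section orthogonal_mean.
Context {R : realType}.

Lemma isorth_entry n (Q : 'M[R]_n) i j : isorth Q -> `|Q i j| <= 1.
Proof.
move=> oQ; have : (Q *m Q^T) i i = 1 by rewrite (oQ : _ *m _ = _) mxE eqxx.
rewrite mxE (bigD1 j)//= mxE => h.
have : Q i j ^+ 2 <= 1.
  rewrite -h expr2 lerDl; apply: sumr_ge0 => k _; rewrite mxE -expr2; exact: sqr_ge0.
by rewrite -real_normK ?num_real// expr_le1.
Qed.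

Lemma norm_mulmxl_le m n (A : 'M[R]_(m, n)) (Q : 'M[R]_n) : isorth Q ->
  `|A *m Q| <= n.+1%:R * `|A|.
Proof.
move=> oQ; apply: norm_le_coord => [|i j]; first by rewrite mulr_ge0.
rewrite mxE; apply: le_trans (ler_norm_sum _ _ _) _.
apply: le_trans (_ : \sum_(k < n) `|A| <= _).
  apply: ler_sum => k _; rewrite normrM -[leRHS]mulr1.
  by apply: ler_pM => //; [exact: coord_le_norm | exact: isorth_entry].
by rewrite sumr_const card_ord -[leLHS]mulr_natl ler_wpM2r// ler_nat.
Qed.

Lemma norm_trmx m n (A : 'M[R]_(m, n)) : `|A^T| = `|A|.
Proof.
apply/le_anti/andP; split; apply: norm_le_coord => // i j.
  by rewrite mxE coord_le_norm.
by have := coord_le_norm A^T j i; rewrite mxE.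
Qed.

Lemma norm_mulmxr_le m n (A : 'M[R]_(m, n)) (Q : 'M[R]_m) : isorth Q ->
  `|Q *m A| <= m.+1%:R * `|A|.
Proof.
move=> oQ; rewrite -norm_trmx trmx_mul -[`|A|]norm_trmx.
by apply: norm_mulmxl_le; exact: isorthT.
Qed.

(** Entries of a rotation lie in [-1, 1]. Cutting this interval into pieces of length r / 2 leaves
    finitely many cells of matrices; one rotation is chosen in each cell that contains some, and the
    identity stands in for the others. *)
Lemma isorth_net n (r : R) : 0 < r -> exists s : seq 'M[R]_n,
  [/\ (0 < size s)%N, (forall P, P \in s -> isorth P) &
    forall Q, isorth Q -> exists2 P, P \in s & `|P - Q| < r].
Proof.
move=> r0; pose N := Num.truncn (2 / (r / 2)).
pose cell (Q : 'M[R]_n) : {ffun 'I_n * 'I_n -> 'I_N.+1} :=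
  [ffun ij => inord (Num.truncn ((Q ij.1 ij.2 + 1) / (r / 2)))].
pose rep c : 'M[R]_n := if pselect (exists Q, isorth Q /\ cell Q = c) is left e
  then projT1 (cid e) else 1%:M.
exists [seq rep c | c <- enum {ffun 'I_n * 'I_n -> 'I_N.+1}]; split.
- by rewrite size_map -cardE card_ffun expn_gt0 card_ord.
- move=> _ /mapP[c _ ->]; rewrite /rep; case: pselect => [e|_]; last exact: isorth1.
  by have [] := projT2 (cid e).
- move=> Q oQ; exists (rep (cell Q)); first by apply/mapP; exists (cell Q) => //; exact: mem_enum.
  rewrite /rep; case: pselect => [e|[]]; last by exists Q.
  have [oP cP] := projT2 (cid e); set P := projT1 _ in oP cP *.
  apply: le_lt_trans (_ : r / 2 < _); last by lra.
  have r20 : 0 < r / 2 by lra.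
  apply: norm_le_coord => [|i j]; first exact: ltW.
  have := congr1 (fun c : {ffun 'I_n * 'I_n -> 'I_N.+1} => val (c (i, j))) cP.
  rewrite /cell !ffunE /=.
  have bnd (M : 'M[R]_n) : isorth M -> 0 <= (M i j + 1) / (r / 2) /\
      (Num.truncn ((M i j + 1) / (r / 2)) < N.+1)%N.
    move=> oM; have := isorth_entry i j oM; rewrite ler_norml => /andP[m1 m2].
    have h : 0 <= (M i j + 1) / (r / 2) by apply: divr_ge0; lra.
    split => //; rewrite ltnS; apply: le_truncn.
    by rewrite ler_pM2r ?invr_gt0//; lra.
  have [P0 PN] := bnd _ oP; have [Q0 QN] := bnd _ oQ.
  rewrite !inordK// => e'.
  have /andP[p1 p2] := truncn_itv P0; have /andP[q1 q2] := truncn_itv Q0.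
  rewrite e' in p1 p2; rewrite !mxE.
  have d : `|(P i j + 1) / (r / 2) - (Q i j + 1) / (r / 2)| <= 1.
    by rewrite ler_norml -natr1 in p2 q2 *; apply/andP; split; lra.
  rewrite -mulrBl normrM normfV (gtr0_norm r20) ler_pdivrMr// mul1r in d.
  by apply: le_trans d; rewrite opprD addrACA subrr addr0.
Qed.

Definition avg n (f : 'M[R]_n -> R) (s : seq 'M[R]_n) (Q : 'M[R]_n) : R :=
  (\sum_(P <- s) f (Q *m P)) / (size s)%:R.

Definition orth_family n (s : seq 'M[R]_n) :=
  (0 < size s)%N /\ forall P, P \in s -> isorth P.

Lemma avg_comp n (f : 'M[R]_n -> R) s t Q :
  avg f [seq T *m P | T <- t, P <- s] Q = (\sum_(T <- t) avg f s (Q *m T)) / (size t)%:R.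
Proof.
rewrite /avg size_allpairs big_allpairs_dep natrM invfM -mulr_suml mulrA mulrAC.
congr (_ / _ / _); apply: eq_bigr => T _; apply: eq_bigr => P _.
by rewrite mulmxA.
Qed.

Lemma orth_family_allpairs n (s t : seq 'M[R]_n) :
  orth_family s -> orth_family t -> orth_family [seq T *m P | T <- t, P <- s].
Proof.
move=> [s0 hs] [t0 ht]; split; first by rewrite size_allpairs muln_gt0 t0.
by move=> _ /allpairsP[[T P] [/= Tt Ps ->]]; apply: isorthM; [exact: ht | exact: hs].
Qed.

(** Uniform continuity on the orthogonal group: exchanging [P] and [Q] gives the other half of the
    estimate. *)
Definition orth_uniform n (f : 'M[R]_n -> R) := forall e, 0 < e ->
  exists2 r, 0 < r & forall P Q, isorth P -> isorth Q -> `|P - Q| < r -> f P <= f Q + e.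

Lemma orth_uniform_bounded n (f : 'M[R]_n -> R) : orth_uniform f ->
  exists a b, forall Q, isorth Q -> a <= f Q <= b.
Proof.
move=> uf; have [r r0 hr] := uf 1 ltr01.
have [s [_ hs hn]] := isorth_net n r0.
pose B := \sum_(P <- s) `|f P|.
have hB P : P \in s -> `|f P| <= B.
  move=> Ps; rewrite /B (big_rem _ Ps)/= lerDl; exact: sumr_ge0.
exists (- B - 1), (B + 1) => Q oQ; have [P Ps PQ] := hn _ oQ.
have := hB _ Ps; rewrite ler_norml => /andP[b1 b2].
have h1 := hr _ _ (hs _ Ps) oQ PQ.
rewrite distrC in PQ; have h2 := hr _ _ oQ (hs _ Ps) PQ.
by apply/andP; split; lra.
Qed.

(* von Neumann's construction of the mean: averaging over a fine enough net of
   rotations decreases the oscillation by a fixed amount. *)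
Lemma osc_decrease n (f : 'M[R]_n -> R) e : orth_uniform f -> 0 < e ->
  exists2 h, 0 < h & forall s a b, orth_family s ->
    (forall Q, isorth Q -> a <= avg f s Q <= b) -> e < b - a ->
    exists s' a' b', [/\ orth_family s',
      forall Q, isorth Q -> a' <= avg f s' Q <= b' & b' - a' <= b - a - h].
Proof.
move=> uf e0; have e40 : 0 < e / 4 by lra.
have [r r0 hr] := uf _ e40.
(* The net is used between two rotations, and multiplying by a rotation may enlarge the sup norm by
   a factor n.+1 on each side. *)
pose rho := r / (n.+1%:R * n.+1%:R).
have rho0 : 0 < rho by rewrite divr_gt0// mulr_gt0.
have [t [t0 ht tn]] := isorth_net n rho0.
have N0 : 0 < (size t)%:R :> R by rewrite ltr0n.
exists (e / 4 / (size t)%:R); first exact: divr_gt0.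
move=> s a b os hs eab.
have hN : e / 4 / (size t)%:R <= e / 4.
  by rewrite ler_pdivrMr// -[leLHS]mulr1; apply: ler_wpM2l; [exact: ltW | rewrite ler1n].
(* If the averages stay above the midpoint, the lower bound rises by more than e / 2. Otherwise some
   [Q0] is below it, and each Q has a translate Q T near [Q0] with T in the net; that single term is
   at most b - e / 4, which lowers the new average by e / 4 divided by the size of the net. *)
have [[Q0 [oQ0 hQ0]]|nQ0] := pselect (exists Q, isorth Q /\ avg f s Q <= (a + b) / 2); last first.
  exists s, ((a + b) / 2), b; split => //; last by lra.
  move=> Q oQ; have /andP[_ ->] := hs _ oQ; rewrite andbT leNgt; apply/negP => h.
  by apply: nQ0; exists Q; split => //; exact: ltW.
exists [seq T *m P | T <- t, P <- s], a, (b - e / 4 / (size t)%:R); split; last by lra.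
  by apply: orth_family_allpairs.
move=> Q oQ; rewrite avg_comp ler_pdivlMr// ler_pdivrMr//; apply/andP; split.
  rewrite -[X in a * X](_ : \sum_(T <- t) 1 = _); last first.
    by rewrite big_const_seq count_predT iter_addr_0.
  rewrite mulr_sumr big_seq [leRHS]big_seq; apply: ler_sum => T Tt; rewrite mulr1.
  by have /andP[] := hs _ (isorthM oQ (ht _ Tt)).
have [T Tt TQ] := tn _ (isorthM (isorthT oQ) oQ0).
rewrite (big_rem _ Tt)/=.
have h1 : avg f s (Q *m T) <= (a + b) / 2 + e / 4.
  apply: le_trans (_ : avg f s Q0 + e / 4 <= _); last by rewrite lerD2r.
  have [s0 os'] := os; rewrite /avg ler_pdivrMr ?ltr0n// mulrDl divfK ?pnatr_eq0 -?lt0n//.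
  apply: le_trans (_ : \sum_(P <- s) (f (Q0 *m P) + e / 4) <= _); last first.
    by rewrite big_split/= lerD2l big_const_seq count_predT iter_addr_0 mulr_natr.
  rewrite big_seq [leRHS]big_seq; apply: ler_sum => P Ps.
  have oP := os' _ Ps; have oT := ht _ Tt.
  apply: hr; [by do 2?apply: isorthM | exact: isorthM |].
  rewrite -mulmxBl; apply: le_lt_trans (norm_mulmxl_le _ oP) _.
  have -> : Q *m T - Q0 = Q *m (T - Q^T *m Q0).
    by rewrite mulmxBr mulmxA (oQ : _ *m _ = _) mul1mx.
  apply: le_lt_trans (_ : n.+1%:R * (n.+1%:R * `|T - Q^T *m Q0|) < _).
    by rewrite ler_wpM2l//; exact: norm_mulmxr_le.
  by rewrite mulrA mulrC -ltr_pdivlMr// mulr_gt0.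
have h2 : \sum_(P <- rem T t) avg f s (Q *m P) <= (size t).-1%:R * b.
  rewrite -(size_rem Tt); apply: le_trans (_ : \sum_(P <- rem T t) b <= _).
    rewrite big_seq [leRHS]big_seq; apply: ler_sum => P /mem_rem Pt.
    by have /andP[] := hs _ (isorthM oQ (ht _ Pt)).
  by rewrite big_const_seq count_predT iter_addr_0 mulr_natl.
rewrite mulrBl divfK ?gt_eqF//.
have -> : b * (size t)%:R = b + (size t).-1%:R * b.
  by rewrite -[in LHS](prednK t0) -natr1 mulrDr mulr1 addrC [b * _]mulrC.
lra.
Qed.

(** Iterates [osc_decrease], whose step [h] is the same for all families: the oscillation is kept
    below e + k h while k goes down to 0. *)
Lemma orth_mean n (f : 'M[R]_n -> R) e : orth_uniform f -> 0 < e ->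
  exists s c, orth_family s /\ forall Q, isorth Q -> `|avg f s Q - c| <= e.
Proof.
move=> uf e0; have [h h0 hh] := osc_decrease uf e0.
have [a [b hab]] := orth_uniform_bounded uf.
have : exists s a1 b1, [/\ orth_family s, forall Q, isorth Q -> a1 <= avg f s Q <= b1
    & b1 - a1 <= e + (Num.truncn ((b - a) / h)).+1%:R * h].
  exists [:: 1%:M], a, b; split.
  - by split => // P; rewrite inE => /eqP ->; exact: isorth1.
  - by move=> Q oQ; rewrite /avg big_seq1 mulmx1 divr1; exact: hab.
  - have := Num.Theory.truncnS_gt ((b - a) / h); rewrite ltr_pdivrMr//; lra.
move: (Num.truncn ((b - a) / h)).+1 => k; elim: k => [|k IH] [s [a' [b' [os hs hk]]]]; last first.
  have [ab|ab] := leP (b' - a') e.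
    apply: IH; exists s, a', b'; split => //.
    by have := mulr_ge0 (ler0n R k) (ltW h0); lra.
  have [s' [a'' [b'' [os' hs' hk']]]] := hh _ _ _ os hs ab.
  apply: IH; exists s', a'', b''; split => //.
  by move: hk; rewrite -natr1 mulrDl mul1r; lra.
exists s, a'; split => // Q oQ; have /andP[h1 h2] := hs _ oQ.
by rewrite ger0_norm ?subr_ge0//; lra.
Qed.

End orthogonal_mean.

(** * Approximation of the ball by zonotopes *)

Section zonotopes.
Context {R : realType}.

Lemma contN (T : topologicalType) (V : normedModType R) (f : T -> V) :
  continuous f -> continuous (fun t => - f t).
Proof. by move=> cf x; exact: cvgN (cf x). Qed.

Definition enorm n (x : 'rV[R]_n) : R := Num.sqrt (dot x x).

Lemma enorm_ge0 n (x : 'rV[R]_n) : 0 <= enorm x.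
Proof. exact: sqrtr_ge0. Qed.

Lemma sqr_enorm n (x : 'rV[R]_n) : enorm x ^+ 2 = dot x x.
Proof. by rewrite sqr_sqrtr// dot_ge0. Qed.

Lemma enorm_gt0 n (x : 'rV[R]_n) : x != 0 -> 0 < enorm x.
Proof.
move=> x0; rewrite sqrtr_gt0 lt_neqAle dot_ge0 andbT eq_sym.
by apply: contra_neq x0 => /dot_eq0.
Qed.

Lemma enormZ n a (x : 'rV[R]_n) : enorm (a *: x) = `|a| * enorm x.
Proof. by rewrite /enorm dotZl dotC dotZl mulrA -expr2 sqrtrM ?sqr_ge0// sqrtr_sqr. Qed.

Lemma dot_isorth n (x y : 'rV[R]_n) (Q : 'M[R]_n) : isorth Q ->
  dot (x *m Q) (y *m Q) = dot x y.
Proof. by move=> oQ; rewrite dot_mulmx -mulmxA (oQ : _ *m _ = _) mulmx1. Qed.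

Lemma enorm_isorth n (x : 'rV[R]_n) (Q : 'M[R]_n) : isorth Q -> enorm (x *m Q) = enorm x.
Proof. by move=> oQ; rewrite /enorm dot_isorth. Qed.

Lemma coord_le_enorm n (x : 'rV[R]_n) i : `|x 0 i| <= enorm x.
Proof.
rewrite -(ler_pXn2r (n := 2))// ?nnegrE ?enorm_ge0// sqr_enorm real_normK ?num_real//.
by rewrite /dot (bigD1 i)//= expr2 lerDl sumr_ge0// => j _; rewrite -expr2 sqr_ge0.
Qed.

Lemma cauchy_schwarz n (x y : 'rV[R]_n) : dot x y <= enorm x * enorm y.
Proof.
case: n x y => [|n] x y.
  by rewrite /dot big_ord0 mulr_ge0 ?enorm_ge0.
have [Q [oQ xQ]] := householder x.
rewrite -(dot_isorth _ _ oQ) xQ -/(enorm x) dotC dot_cons mulrC -(enorm_isorth y oQ).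
by apply: ler_wpM2l; [exact: enorm_ge0 | exact: le_trans (ler_norm _) (coord_le_enorm _ _)].
Qed.

Lemma ballP n (x : 'rV[R]_n) : @euclidean_ball R n x <-> enorm x <= 1.
Proof.
rewrite /euclidean_ball/= /enorm /dot.
by under eq_bigr do rewrite expr2.
Qed.

(** The segments are centred, unlike those of [zsum], so that the support function is half the sum
    of the |<u, w>|; the two versions differ by the translation in [zsum_zonotope]. *)
Fixpoint zonotope n (us : seq 'rV[R]_n) : set 'rV[R]_n :=
  if us is u :: us' then
    (fun p : R * 'rV[R]_n => p.1 *: u + p.2) @` (`[-2^-1, 2^-1]%classic `*` zonotope us')
  else [set 0].

Lemma zonotope_cons n (u : 'rV[R]_n) us z : zonotope (u :: us) z <->
  exists t y, [/\ -2^-1 <= t <= 2^-1, zonotope us y & z = t *: u + y].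
Proof.
split.
  by move=> [[t y] [/=]]; rewrite in_itv/= => t1 zy <-; exists t, y.
by move=> [t [y [t1 zy ->]]]; exists (t, y) => //; split => //=; rewrite in_itv.
Qed.

Lemma cbody_zonotope n (us : seq 'rV[R]_n) : cbody (zonotope us).
Proof.
elim: us => [|u us [cZ vZ]].
  split; first exact: compact_set1.
  by move=> x y a b -> -> _ _ _ /=; rewrite !scaler0 addr0.
split.
  apply: compact_image; last by apply: compact_setX => //; exact: segment_compact.
  apply: contD; last exact: cont_snd.
  by apply: contZ; [exact: cont_fst | exact: cont_cst].
move=> x y a b /zonotope_cons[s [x' [/andP[s1 s2] Zx ->]]].
move=> /zonotope_cons[t [y' [/andP[t1 t2] Zy ->]]] a0 b0 ab.
apply/zonotope_cons; exists (a * s + b * t), (a *: x' + b *: y'); split.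
- by apply/andP; split; nra.
- exact: vZ.
- by rewrite !scalerDr !scalerA scalerDl addrACA.
Qed.

Lemma zonotope_map n p (A : 'M[R]_(n, p)) (l : R) us :
  zonotope [seq l *: (u *m A) | u <- us] = [set l *: (z *m A) | z in zonotope us].
Proof.
elim: us => [|u us IH].
  apply/seteqP; split => z.
    by move=> ->; exists 0 => //; rewrite mul0mx scaler0.
  by move=> [y -> <-]; rewrite mul0mx scaler0.
apply/seteqP; split => z.
  move=> /zonotope_cons[t [y [t1 + ->]]]; rewrite IH => -[y' Zy' <-].
  exists (t *: u + y'); first by apply/zonotope_cons; exists t, y'.
  by rewrite mulmxDl scalerDr -scalemxAl !scalerA mulrC.
move=> [_ /zonotope_cons[t [y [t1 Zy ->]]] <-]; apply/zonotope_cons.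
exists t, (l *: (y *m A)); split => //; first by rewrite IH; exists y.
by rewrite mulmxDl scalerDr -scalemxAl !scalerA mulrC.
Qed.

Lemma zsum_zonotope n (K : set 'rV[R]_n) us :
  zsum K us = [set v | exists x z, [/\ K x, zonotope us z &
    v = x + z + 2^-1 *: \sum_(u <- us) u]].
Proof.
elim: us K => [|u us IH] K.
  apply/seteqP; split => v /=.
    by move=> Kv; exists v, 0; rewrite big_nil scaler0 !addr0.
  by move=> [x [_ [Kx -> ->]]]; rewrite big_nil scaler0 !addr0.
rewrite /= IH big_cons; apply/seteqP; split => v.
  move=> [_ [z [/segP[x [t [Kx /andP[t0 t1] ->]]] Zz ->]]].
  exists x, ((t - 2^-1) *: u + z); split => //.
    by apply/zonotope_cons; exists (t - 2^-1), z; split => //; apply/andP; split; lra.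
  by move: (\sum_(_ <- us) _) => S; apply/rowP => i; rewrite !mxE; ring.
move=> [x [_ [Kx /zonotope_cons[t [z [/andP[t0 t1] Zz ->]]] ->]]].
exists (x + (t + 2^-1) *: u), z; split => //.
  by apply/segP; exists x, (t + 2^-1); split => //; apply/andP; split; lra.
by move: (\sum_(_ <- us) _) => S; apply/rowP => i; rewrite !mxE; ring.
Qed.

Lemma zonotope_dot_le n (us : seq 'rV[R]_n) z w : zonotope us z ->
  dot z w <= 2^-1 * \sum_(u <- us) `|dot u w|.
Proof.
elim: us z => [|u us IH] z.
  by move=> ->; rewrite big_nil mulr0 /dot big1// => i _; rewrite mxE mul0r.
move=> /zonotope_cons[t [y [t1 /IH h ->]]].
rewrite big_cons mulrDr dotDl dotZl lerD//.
apply: le_trans (ler_norm _) _; rewrite normrM ler_wpM2r//.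
by rewrite ler_norml.
Qed.

Lemma zonotope_dot_eq n (us : seq 'rV[R]_n) w :
  exists2 z, zonotope us z & dot z w = 2^-1 * \sum_(u <- us) `|dot u w|.
Proof.
elim: us => [|u us [z Zz e]].
  by exists 0 => //; rewrite big_nil mulr0 /dot big1// => i _; rewrite mxE mul0r.
rewrite big_cons mulrDr; have [h|h] := leP 0 (dot u w).
  exists (2^-1 *: u + z); last by rewrite dotDl dotZl e ger0_norm.
  by apply/zonotope_cons; exists 2^-1, z; split => //; apply/andP; split; lra.
exists (- 2^-1 *: u + z); last by rewrite dotDl dotZl e mulNr ltr0_norm// mulrN.
by apply/zonotope_cons; exists (- 2^-1), z; split => //; apply/andP; split; lra.
Qed.

Lemma dot_continuous n (T : topologicalType) (f g : T -> 'rV[R]_n) :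
  continuous f -> continuous g -> continuous (fun t => dot (f t) (g t)).
Proof.
move=> cf cg; apply: sum_continuous => i.
by apply: contM; [exact: (cont_comp cf (@cont_coord _ _ _ _ _))
                 |exact: (cont_comp cg (@cont_coord _ _ _ _ _))].
Qed.

Lemma dot_sqrDZ n (x y : 'rV[R]_n) a :
  dot (x + a *: y) (x + a *: y) = dot x x + 2 * a * dot y x + a * a * dot y y.
Proof.
rewrite dotDl dotZl [dot x (x + _)]dotC [dot y (x + _)]dotC !dotDl !dotZl [dot x y]dotC.
by ring.
Qed.

(* Separation of y from K by the hyperplane through the nearest point. *)
Lemma separation n (K : set 'rV[R]_n) y : cbody K -> K !=set0 -> ~ K y ->
  exists w, forall z, K z -> dot z w < dot y w.
Proof.
move=> [cK vK] K0 nKy.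
have cf : continuous (fun p : 'rV[R]_n => dot (y - p) (y - p)).
  have cs : continuous (fun p : 'rV[R]_n => y - p).
    by apply: contD; [exact: cont_cst | apply: contN; exact: cont_id].
  exact: dot_continuous.
have [p /set_mem Kp hp] := compact_EVT_min K0 cK (continuous_subspaceT cf).
exists (y - p) => z Kz.
have w0 : 0 < dot (y - p) (y - p).
  rewrite lt_neqAle dot_ge0 andbT eq_sym; apply/eqP => /dot_eq0/eqP.
  by rewrite subr_eq0 => /eqP yp; apply: nKy; rewrite yp.
set w := y - p in w0 *; set d := z - p.
have e1 : dot w w = dot y w - dot p w by rewrite {1}/w dotDl dotNl.
have e2 : dot d w = dot z w - dot p w by rewrite /d dotDl dotNl.
suff : dot d w <= 0 by lra.
rewrite leNgt; apply/negP => D0.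
(* Compares the distances from y to p and to the point p + t d of [K]. A suitable t contradicts <d,
   w> > 0; the case distinction below keeps it at most 1. *)
have key t : 0 <= t <= 1 -> 2 * t * dot d w <= t * t * dot d d.
  move=> /andP[t0 t1].
  have Kt : K (t *: z + (1 - t) *: p) by apply: vK => //; lra.
  have := hp _ (mem_set Kt).
  have -> : y - (t *: z + (1 - t) *: p) = w + (- t) *: d.
    by rewrite /w /d; apply/rowP => i; rewrite !mxE; ring.
  by rewrite dot_sqrDZ -/w; lra.
have dd : 0 < dot d d.
  rewrite lt_neqAle dot_ge0 andbT eq_sym; apply/eqP => /dot_eq0 d0.
  by move: D0; rewrite d0 /dot big1 ?ltxx// => i _; rewrite mxE mul0r.
have [h|h] := leP (dot d w) (dot d d).
  have := key (dot d w / dot d d).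
  rewrite divr_ge0 ?(ltW D0)//= ?(ltW dd)// ler_pdivrMr// mul1r h => /(_ isT).
  have -> : dot d w / dot d d * (dot d w / dot d d) * dot d d = dot d w / dot d d * dot d w.
    by field; rewrite gt_eqF.
  have : 0 < dot d w / dot d d * dot d w by rewrite mulr_gt0// divr_gt0.
  lra.
by have := key 1; rewrite ler01 lexx => /(_ isT); lra.
Qed.

(** Bounds on the support function become inclusions: a point of the smaller ball outside the
    zonotope could be separated from it, and a point of the zonotope is tested against itself. *)
Lemma zonotope_approx n (us : seq 'rV[R]_n) (d : R) : 0 <= d <= 1 ->
  (forall x, (1 - d) * enorm x <= 2^-1 * \sum_(u <- us) `|dot u x| <= (1 + d) * enorm x) ->
  (forall x, enorm x <= 1 -> zonotope us ((1 - d) *: x)) /\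
  (forall z, zonotope us z -> exists2 x, enorm x <= 1 & z = (1 + d) *: x).
Proof.
move=> /andP[d0 d1] h; split.
  move=> x x1; apply: contrapT => nZ.
  have Z0 : zonotope us !=set0 by have [z Zz _] := zonotope_dot_eq us 0; exists z.
  have [w hw] := separation (cbody_zonotope us) Z0 nZ.
  have [z Zz e] := zonotope_dot_eq us w.
  have := hw _ Zz; rewrite e dotZl => lt1.
  have /andP[h1 _] := h w.
  have h2 := cauchy_schwarz x w; have h3 := enorm_ge0 w.
  have : (1 - d) * dot x w <= (1 - d) * enorm w.
    apply: ler_wpM2l; first lra.
    apply: le_trans h2 _; rewrite -[leRHS]mul1r; exact: ler_wpM2r.
  lra.
move=> z Zz; have d1' : 1 + d != 0 by lra.
exists ((1 + d)^-1 *: z); last by rewrite scalerA divff// scale1r.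
rewrite enormZ ger0_norm ?invr_ge0; last lra.
rewrite mulrC ler_pdivrMr ?mul1r; last lra.
have := zonotope_dot_le z Zz; have /andP[_ h2] := h z; rewrite -sqr_enorm expr2.
have [->|z0] := eqVneq z 0; first by rewrite /enorm /dot big1 ?sqrtr0 => [|i _]; [lra | rewrite mxE mul0r].
move=> h1; rewrite -(ler_pM2r (enorm_gt0 z0)); exact: le_trans h1 h2.
Qed.

(** An almost constant average of |Q 0 0| means that the mean of |<w P, x>| is nearly proportional
    to the norm of x, for [w P] the first column of [P]. Suitably scaled, these columns generate a
    zonotope whose support function is nearly the norm. *)
Lemma ball_zonotope n (d : R) : 0 < d <= 1 -> exists us : seq 'rV[R]_n,
  (forall x, enorm x <= 1 -> zonotope us ((1 - d) *: x)) /\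
  (forall z, zonotope us z -> exists2 x, enorm x <= 1 & z = (1 + d) *: x).
Proof.
case: n => [|n] /andP[d0 d1].
  exists [::]; apply: zonotope_approx; first by rewrite ltW.
  move=> x; rewrite big_nil mulr0 (_ : enorm x = 0) ?mulr0 ?lexx//.
  by rewrite /enorm /dot big_ord0 sqrtr0.
pose f (Q : 'M[R]_n.+1) := `|Q 0 0|.
have uf : orth_uniform f.
  move=> e e0; exists e => // P Q oP oQ PQ; rewrite /f -lerBlDl.
  apply: le_trans (lerB_dist _ _) _; apply: le_trans (ltW PQ).
  by have := coord_le_norm (P - Q) 0 0; rewrite !mxE.
pose e := d / (2 * n.+1%:R).
have e0 : 0 < e by rewrite divr_gt0// mulr_gt0.
have [s [c [os hs]]] := orth_mean uf e0; have [s0 os'] := os.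
have N0 : 0 < (size s)%:R :> R by rewrite ltr0n.
pose w (P : 'M[R]_n.+1) : 'rV[R]_n.+1 := (col 0 P)^T.
have avgE Q : avg f s Q = (\sum_(P <- s) `|dot (w P) (row 0 Q)|) / (size s)%:R.
  rewrite /avg; congr (_ / _); apply: eq_bigr => P _; rewrite /f mxE dotC.
  by congr `|_|; apply: eq_bigr => i _; rewrite !mxE.
have hx x : `|(\sum_(P <- s) `|dot (w P) x|) / (size s)%:R - c * enorm x| <= e * enorm x.
  have [->|x0] := eqVneq x 0.
    have z u : dot u 0 = 0 :> R by rewrite /dot big1// => i _; rewrite mxE mulr0.
    by rewrite /enorm z sqrtr0 !mulr0 big1 => [|P _]; rewrite ?mul0r ?subrr ?normr0// z normr0.
  have xp := enorm_gt0 x0.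
  (* Provides the rotation whose first row is the normalized [x], at which the average is
     evaluated. *)
  have [H [oH]] := householder ((enorm x)^-1 *: x).
  rewrite -/(enorm _) enormZ gtr0_norm ?invr_gt0// mulVf ?gt_eqF// => xH.
  have r0 : row 0 H^T = (enorm x)^-1 *: x.
    have : (enorm x)^-1 *: x = cons_row 1 0 *m H^T.
      by rewrite -xH -mulmxA (oH : _ *m _ = _) mulmx1.
    move=> ->; rewrite rowE; congr (_ *m _); apply/rowP => i; rewrite mxE eqxx/=.
    case: (unliftP 0 i) => [j|] ->; last by rewrite cons_row0 eqxx.
    by rewrite cons_rowS mxE.
  have := hs _ (isorthT oH); rewrite avgE r0.
  under eq_bigr do rewrite dotC dotZl normrM dotC.
  rewrite -mulr_sumr gtr0_norm ?invr_gt0//.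
  set A := \sum_(P <- s) _ => h.
  have -> : A / (size s)%:R - c * enorm x = ((enorm x)^-1 * A / (size s)%:R - c) * enorm x.
    by field; rewrite !gt_eqF.
  by rewrite normrM (gtr0_norm xp) ler_wpM2r// ltW.
(* A lower bound on [c], which turns the absolute error e into the relative error d: a first column
   has norm 1, so its absolute entries sum to at least 1, while each of the n.+1 entries has mean at
   most c + e. *)
have ce : n.+1%:R * (c + e) >= 1.
  apply: le_trans (_ : \sum_(l < n.+1) (\sum_(P <- s) `|P l 0|) / (size s)%:R <= _).
    rewrite -mulr_suml exchange_big/= ler_pdivlMr// mul1r.
    rewrite -[leLHS](_ : \sum_(P <- s) 1 = _); last first.
      by rewrite big_const_seq count_predT iter_addr_0.
    rewrite big_seq [leRHS]big_seq; apply: ler_sum => P Ps.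
    have oP := isorthT (os' _ Ps).
    have : (P^T *m P^T^T) 0 0 = 1 by rewrite (oP : _ *m _ = _) mxE eqxx.
    rewrite mxE => <-; apply: ler_sum => l _; rewrite trmxK mxE.
    apply: le_trans (ler_norm _) _; rewrite normrM -[leRHS]mulr1.
    by apply: ler_wpM2l => //; exact: isorth_entry (os' _ Ps).
  apply: le_trans (_ : \sum_(l < n.+1) (c + e) <= _); last by rewrite sumr_const card_ord mulr_natl.
  apply: ler_sum => l _; have := hx (delta_mx 0 l).
  have d_l u : dot u (delta_mx 0 l) = u 0 l.
    rewrite /dot (bigD1 l)//= mxE !eqxx mulr1 big1 ?addr0// => i il.
    by rewrite mxE (negbTE il) andbF mulr0.
  rewrite /enorm d_l mxE !eqxx sqrtr1 !mulr1.
  under eq_bigr do rewrite d_l !mxE.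
  by rewrite ler_norml => /andP[_ ?]; lra.
have n0 : 0 < n.+1%:R :> R by rewrite ltr0n.
have eE : e * n.+1%:R = d / 2 by rewrite /e; field; rewrite addrC natr1 pnatr_eq0.
have c0 : 0 < c by nra.
have edc : e <= d * c by nra.
exists [seq (2 / ((size s)%:R * c)) *: w P | P <- s].
apply: zonotope_approx; first by rewrite ltW.
move=> x; rewrite big_map.
under eq_bigr do rewrite dotZl normrM.
rewrite -mulr_sumr [`|2 / _|]ger0_norm; last by rewrite divr_ge0// mulr_ge0// ltW.
have := hx x; set A := \sum_(P <- s) _; rewrite ler_norml => /andP[h1 h2].
have -> : 2^-1 * (2 / ((size s)%:R * c) * A) = (A / (size s)%:R) / c.
  by field; rewrite !gt_eqF.
have x0 := enorm_ge0 x; have edx := ler_wpM2r x0 edc.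
by rewrite ler_pdivlMr// ler_pdivrMr//; apply/andP; split; lra.
Qed.

End zonotopes.

(** * Steiner polynomials *)

Section steiner_coefficients.
Context {R : realType}.

Definition eball n : set 'rV[R]_n := [set x | enorm x <= 1].

Lemma eballE n : @euclidean_ball R n = @eball n.
Proof. by apply/seteqP; split => x /ballP. Qed.

Lemma enormD n (x y : 'rV[R]_n) : enorm (x + y) <= enorm x + enorm y.
Proof.
rewrite -(ler_pXn2r (n := 2))// ?nnegrE ?addr_ge0 ?enorm_ge0//.
rewrite sqr_enorm sqrrD !sqr_enorm -[y in x + y]scale1r dot_sqrDZ !mul1r mulr1.
have := cauchy_schwarz x y; rewrite (dotC y) mulr2n; lra.
Qed.

Lemma enorm_continuous n : continuous (@enorm R n).
Proof.
apply: (cont_comp (dot_continuous (@cont_id _) (@cont_id _))).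
exact: sqrt_continuous.
Qed.

Lemma cbody_ball n : cbody (@eball n).
Proof.
split.
  apply: bounded_closed_compact; last first.
    apply: (@closed_preimage _ _ (@enorm R n) [set x | x <= 1]); last exact: closed_le.
    exact: enorm_continuous.
  exists 1; split; first exact: num_real.
  move=> M M1 x /= x1; apply: norm_le_coord => [|i j]; first by rewrite ltW// (lt_trans ltr01).
  by rewrite ord1; apply: le_trans (coord_le_enorm _ _) _; apply: le_trans x1 (ltW M1).
move=> x y a b; rewrite /eball/= => x1 y1 a0 b0 ab; apply: le_trans (enormD _ _) _.
rewrite !enormZ !ger0_norm//; nra.
Qed.

Lemma compact_ball n : compact (@eball n). Proof. by case: (cbody_ball n). Qed.

Lemma image2_setX (T U V : Type) (f : T -> U -> V) A B :
  [set f x y | x in A & y in B] = (fun q => f q.1 q.2) @` (A `*` B).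
Proof.
apply/seteqP; split => v; first by move=> [x Ax [y By <-]]; exists (x, y).
by move=> [[x y] [/= Ax By] <-]; exists x => //; exists y.
Qed.

(** [P] places the ball: the identity gives the parallel bodies of Steiner's formula, F^T F the ball
    of the subspace with frame F inside R^n, and F^T that same ball in the coordinates of the
    subspace. *)
Definition ballsum n p (K : set 'rV[R]_p) (P : 'M[R]_(n, p)) (l : R) : set 'rV[R]_p :=
  [set x + l *: (u *m P) | x in K & u in @eball n].
Definition vsum n p (K : set 'rV[R]_p) (P : 'M[R]_(n, p)) (l : R) : R := volume (ballsum K P l).

Lemma compact_ballsum n p (K : set 'rV[R]_p) (P : 'M[R]_(n, p)) (l : R) :
  compact K -> compact (ballsum K P l).
Proof.
move=> cK; rewrite /ballsum image2_setX.
apply: compact_image; last by apply: compact_setX => //; exact: compact_ball.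
apply: contD; first exact: cont_fst.
apply: contZ; first exact: cont_cst.
by apply: cont_mulmx; [exact: cont_snd | exact: cont_cst].
Qed.

Lemma volume_le n (A B : set 'rV[R]_n) : compact A -> compact B -> A `<=` B ->
  volume A <= volume B.
Proof. by move=> cA cB AB; rewrite -lee_fin -!volumeE//; exact: le_vol. Qed.

Definition coefsum n j (K : set 'rV[R]_n) (us : seq 'rV[R]_n) : R :=
  \sum_(s <- subs us | size s == j) mixvol s K.

Lemma coefsum_ge0 n j (K : set 'rV[R]_n) us : cbody K -> 0 <= coefsum j K us.
Proof. by move=> bK; apply: sumr_ge0 => s _; exact: mixvol_ge0. Qed.

(** Homogeneity makes a sublist of length j a term of degree j, and [mixvol_size_gt] removes the
    degrees above p. *)
Lemma volume_zsum_poly p (K : set 'rV[R]_p) us (l : R) : cbody K -> 0 <= l ->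
  volume (zsum K [seq l *: u | u <- us]) = \sum_(j < p.+1) l ^+ j * coefsum j K us.
Proof.
move=> bK l0; rewrite volume_zsum subs_map big_map.
under [RHS]eq_bigr do rewrite /coefsum mulr_sumr big_mkcond.
rewrite exchange_big/=; apply: eq_bigr => s _.
rewrite mixvol_scale// ger0_norm//.
have [sp|sp] := leqP (size s) p.
  rewrite (bigD1 (inord (size s)))//= inordK// eqxx big1 ?addr0// => i /eqP ip.
  case: eqP => // e; case: ip; apply: val_inj; rewrite /= inordK//.
rewrite mixvol_size_gt// mulr0 big1// => i _; case: eqP => // e.
by rewrite mulr0.
Qed.

Lemma volume_translate n (A : set 'rV[R]_n) v : compact A ->
  volume [set x + v | x in A] = volume A.
Proof.
move=> cA; rewrite /volume -(vol_translate (- v) cA); congr (fine (vol _)).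
apply/seteqP; split => y /=.
  by move=> [x Ax <-]; rewrite addrK.
by move=> Ay; exists (y - v) => //; rewrite subrK.
Qed.

Lemma volume_zsum_zonotope p (K : set 'rV[R]_p) us : cbody K ->
  volume (zsum K us) = volume [set x + z | x in K & z in zonotope us].
Proof.
move=> [cK _].
rewrite -[RHS](volume_translate (2^-1 *: \sum_(u <- us) u)); last first.
  rewrite image2_setX.
  apply: compact_image; last by apply: compact_setX => //; case: (cbody_zonotope us).
  by apply: contD; [exact: cont_fst | exact: cont_snd].
congr volume; rewrite zsum_zonotope; apply/seteqP; split => v.
  move=> [x [z [Kx Zz ->]]]; exists (x + z) => //.
  by exists x => //; exists z.
by move=> [_ [x Kx [z Zz <-]] <-]; exists x, z.
Qed.

(** A zonotope within relative error 1 / (m + 2) of the ball; the shift by 2 keeps 1 - 1 / (m + 2)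
    positive. *)
Definition ballz n (m : nat) : seq 'rV[R]_n := xget [::] [set us : seq 'rV[R]_n |
  (forall x, enorm x <= 1 -> zonotope us ((1 - m.+2%:R^-1) *: x)) /\
  (forall z, zonotope us z -> exists2 x, enorm x <= 1 & z = (1 + m.+2%:R^-1) *: x)].

Lemma ballzP n m :
  (forall x, enorm x <= 1 -> zonotope (ballz n m) ((1 - m.+2%:R^-1) *: x)) /\
  (forall z, zonotope (ballz n m) z -> exists2 x, enorm x <= 1 & z = (1 + m.+2%:R^-1) *: x).
Proof.
rewrite /ballz; have [] := @ball_zonotope R n m.+2%:R^-1; last first.
  by move=> us h; case: xgetP => [vs _ [? ?]//|/(_ us)].
rewrite invr_gt0 ltr0n/= invf_le1 ?ltr0n//.
by rewrite ler1n.
Qed.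

Definition zvol n p (K : set 'rV[R]_p) (P : 'M[R]_(n, p)) m (l : R) : R :=
  \sum_(j < p.+1) l ^+ j * coefsum j K [seq u *m P | u <- ballz n m].

Lemma zvol_bounds n p (K : set 'rV[R]_p) (P : 'M[R]_(n, p)) m l : cbody K -> 0 <= l ->
  vsum K P (l * (1 - m.+2%:R^-1)) <= zvol K P m l <= vsum K P (l * (1 + m.+2%:R^-1)).
Proof.
move=> bK l0; have [cK _] := bK; have [h1 h2] := ballzP n m.
rewrite /zvol -volume_zsum_poly// -map_comp volume_zsum_zonotope// zonotope_map.
have cZ : compact [set x + z | x in K &
    z in [set l *: (z *m P) | z in zonotope (ballz n m)]].
  rewrite image2_setX; apply: compact_image; first by apply: contD; [exact: cont_fst | exact: cont_snd].
  apply: compact_setX => //; apply: compact_image; last by case: (cbody_zonotope (ballz n m)).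
  apply: contZ; first exact: cont_cst.
  by apply: cont_mulmx; [exact: cont_id | exact: cont_cst].
apply/andP; split; apply: volume_le => //; try exact: compact_ballsum.
  move=> _ [x Kx [u Bu <-]]; exists x => //.
  exists (l *: ((1 - m.+2%:R^-1) *: u *m P)); last by rewrite -scalemxAl scalerA.
  by exists ((1 - m.+2%:R^-1) *: u) => //; exact: h1.
move=> _ [x Kx [_ [z Zz <-] <-]]; exists x => //; have [u Bu ->] := h2 _ Zz.
by exists u => //; rewrite -scalemxAl scalerA.
Qed.

Lemma zvol_scale_le n p (K : set 'rV[R]_p) (P : 'M[R]_(n, p)) m l a : cbody K -> 0 <= l ->
  1 <= a -> zvol K P m (l * a) <= a ^+ p * zvol K P m l.
Proof.
move=> bK l0 a1; rewrite /zvol mulr_sumr; apply: ler_sum => j _.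
rewrite exprMn mulrAC -!mulrA [leRHS]mulrCA; apply: ler_wpM2l; first exact: exprn_ge0.
rewrite mulrC; apply: ler_wpM2r; first exact: coefsum_ge0.
by rewrite ler_weXn2l// -ltnS.
Qed.

(** The coefficients are nonnegative, so multiplying l by a >= 1 costs at most a^p. The relative
    error of the zonotope, which acts on l, thus becomes a factor on [vsum] that tends to 1. *)
Lemma zvol_squeeze n p (K : set 'rV[R]_p) (P : 'M[R]_(n, p)) m l : cbody K -> 0 <= l ->
  (1 - m.+2%:R^-1) ^+ p * vsum K P l <= zvol K P m l <= (1 + m.+2%:R^-1) ^+ p * vsum K P l.
Proof.
move=> bK l0; set d : R := m.+2%:R^-1.
have d0 : 0 < d by rewrite invr_gt0.
have d1 : d < 1 by rewrite invf_lt1 ?ltr0n// ltr1n.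
apply/andP; split.
  have dp : 0 < 1 - d by lra.
  rewrite mulrC -ler_pdivlMr ?exprn_gt0// -exprVn mulrC.
  apply: le_trans (_ : zvol K P m (l * (1 - d)^-1) <= _).
    have l1 : 0 <= l * (1 - d)^-1 by rewrite mulr_ge0// invr_ge0 ltW.
    have /andP[+ _] := zvol_bounds P m bK l1.
    by rewrite -/d mulfVK ?gt_eqF.
  by apply: zvol_scale_le => //; rewrite invf_ge1//; lra.
have dp : 0 < 1 + d by lra.
have le : l = l * (1 + d)^-1 * (1 + d) by rewrite mulfVK ?gt_eqF.
have l0' : 0 <= l * (1 + d)^-1 by rewrite mulr_ge0// invr_ge0 ltW.
have h1 : zvol K P m l <= (1 + d) ^+ p * zvol K P m (l * (1 + d)^-1).
  by rewrite {1}le; apply: zvol_scale_le => //; lra.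
apply: le_trans h1 _.
apply: ler_wpM2l; first by rewrite exprn_ge0// ltW.
have /andP[_ h] := zvol_bounds P m bK l0'.
by apply: le_trans h _; rewrite -/d mulfVK ?gt_eqF.
Qed.

Lemma zvol_cvg n p (K : set 'rV[R]_p) (P : 'M[R]_(n, p)) l : cbody K -> 0 <= l ->
  zvol K P m l @[m --> \oo] --> vsum K P l.
Proof.
move=> bK l0.
have h0 : (m.+2%:R^-1 : R) @[m --> \oo] --> (0 : R).
  by have := @cvg_harmonic R; rewrite -(cvg_shiftS _).
have cX (a : R^nat) : a m @[m --> \oo] --> (1 : R) ->
    (a m ^+ p * vsum K P l) @[m --> \oo] --> vsum K P l.
  move=> ca; rewrite -[X in _ --> X]mul1r -[X in X * _](expr1n _ p).
  by apply: cvgMl; apply: (@cvg_comp _ _ _ a (fun x => x ^+ p) _ _ _ ca); exact: exprn_continuous.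
apply: (@squeeze_cvgr _ _ _ _ (fun m => (1 - m.+2%:R^-1) ^+ p * vsum K P l)
  (fun m => (1 + m.+2%:R^-1) ^+ p * vsum K P l)).
- by near=> m; exact: zvol_squeeze.
- apply: cX; rewrite -[X in _ --> X]subr0; apply: cvgB => //; exact: cvg_cst.
- apply: cX; rewrite -[X in _ --> X]addr0; apply: cvgD => //; exact: cvg_cst.
Unshelve. all: by end_near. Qed.

Lemma cvgn_sum (I : Type) (r : seq I) (P : pred I) (u : I -> R^nat) (l : I -> R) :
  (forall i, P i -> u i m @[m --> \oo] --> l i) ->
  (\sum_(i <- r | P i) u i m) @[m --> \oo] --> \sum_(i <- r | P i) l i.
Proof.
move=> h; elim: r => [|i r IH].
  by under eq_fun do rewrite big_nil; rewrite big_nil; exact: cvg_cst.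
under eq_fun do rewrite big_cons; rewrite big_cons.
by case: ifPn => // Pi; apply: cvgD => //; exact: h.
Qed.

Lemma cvgn_ler (u v : R^nat) (a b : R) : u m @[m --> \oo] --> a ->
  v m @[m --> \oo] --> b -> (forall m, u m <= v m) -> a <= b.
Proof.
move=> ua vb uv; rewrite -(cvg_lim (@norm_hausdorff _ R^o) ua).
rewrite -(cvg_lim (@norm_hausdorff _ R^o) vb); apply: ler_lim.
- by apply/cvg_ex; exists a.
- by apply/cvg_ex; exists b.
- exact: nearW.
Qed.

Definition nodes p : 'M[R]_p.+1 := Vandermonde p.+1 (\row_i i%:R).

Lemma nodes_unit p : nodes p \in unitmx.
Proof.
rewrite unitmxE det_Vandermonde unitfE prodf_seq_neq0; apply/allP => i _ /=.
rewrite prodf_seq_neq0; apply/allP => j _ /=; apply/implyP => ij.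
by rewrite !mxE subr_eq0 eqr_nat gtn_eqF.
Qed.

(* [mv j K P] is the coefficient of l^j in |K + l B P|, obtained by interpolation
   at 0, 1, ..., p: it is C(p, j) times the mixed volume of p - j copies of K and
   j copies of B P, for B the unit ball of R^n. *)
Definition mv n p j (K : set 'rV[R]_p) (P : 'M[R]_(n, p)) : R :=
  \sum_(i < p.+1) vsum K P i%:R * invmx (nodes p) i (inord j).

Lemma interpolation p (a : nat -> R) j : (j <= p)%N ->
  \sum_(i < p.+1) (\sum_(l < p.+1) i%:R ^+ l * a l) * invmx (nodes p) i (inord j) = a j.
Proof.
move=> jp; pose v : 'rV[R]_p.+1 := \row_l a l.
have := congr1 (fun M : 'rV[R]_p.+1 => M 0 (inord j)) (mulmxK (nodes_unit p) v).
rewrite [X in _ = X -> _]mxE inordK// => <-.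
rewrite [RHS]mxE; apply: eq_bigr => i _; congr (_ * _); rewrite [RHS]mxE.
by apply: eq_bigr => l _; rewrite !mxE mulrC.
Qed.

(** Coefficients are fixed linear combinations of the values at 0, ..., p, so they converge with
    them. The comparisons of mixed volumes with segments pass to the ball through this limit. *)
Lemma coefsum_cvg n p j (K : set 'rV[R]_p) (P : 'M[R]_(n, p)) : cbody K -> (j <= p)%N ->
  coefsum j K [seq u *m P | u <- ballz n m] @[m --> \oo] --> mv j K P.
Proof.
move=> bK jp.
under eq_fun => m do
  rewrite -(interpolation (fun j => coefsum j K [seq u *m P | u <- ballz n m]) jp).
apply: cvgn_sum => i _; apply: cvgMl; exact: zvol_cvg.
Qed.

Lemma vsum_poly n p (K : set 'rV[R]_p) (P : 'M[R]_(n, p)) l : cbody K -> 0 <= l ->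
  vsum K P l = \sum_(j < p.+1) l ^+ j * mv j K P.
Proof.
move=> bK l0; rewrite -(cvg_lim (@norm_hausdorff _ R^o) (@zvol_cvg _ _ K P l bK l0)).
apply: cvg_lim; first exact: (@norm_hausdorff _ R^o).
apply: cvgn_sum => j _; apply: cvgMr; apply: coefsum_cvg => //.
by rewrite -ltnS.
Qed.

Lemma mv_unique n p (K : set 'rV[R]_p) (P : 'M[R]_(n, p)) (a : nat -> R) j :
  (forall l, 0 <= l -> vsum K P l = \sum_(j < p.+1) l ^+ j * a j) -> (j <= p)%N ->
  mv j K P = a j.
Proof.
move=> h jp; rewrite -[RHS](interpolation a jp).
by apply: eq_bigr => i _; rewrite h.
Qed.

Lemma mv_ge0 n p j (K : set 'rV[R]_p) (P : 'M[R]_(n, p)) : cbody K -> (j <= p)%N ->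
  0 <= mv j K P.
Proof.
move=> bK jp; apply: (cvgn_ler (u := fun=> 0) (@cvg_cst _ _ _ _ _) (@coefsum_cvg _ _ j K P bK jp)).
by move=> m; exact: coefsum_ge0.
Qed.

(** [quermassintegral] is picked by [get], so a solution of Steiner's formula is exhibited first,
    [mv] divided by the binomials; the chosen solution then has the same coefficients by
    interpolation. *)
Lemma mv_quermassintegral p (K : set 'rV[R]_p) j : cbody K -> (j <= p)%N ->
  mv j K (1%:M : 'M[R]_p) = 'C(p, j)%:R * quermassintegral K j.
Proof.
move=> bK jp; have [cK _] := bK.
have mE l : [set x + l *: u | x in K & u in @euclidean_ball R p] = ballsum K (1%:M : 'M[R]_p) l.
  rewrite eballE; apply/seteqP; split => v [x Kx [u Bu <-]].
    by exists x => //; exists u => //; rewrite mulmx1.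
  by exists x => //; exists u => //; rewrite mulmx1.
have ex : exists W, steiner_formula K W.
  exists (fun i => mv i K (1%:M : 'M[R]_p) / 'C(p, i)%:R) => l l0.
  rewrite mE volumeE; last exact: compact_ballsum.
  rewrite -/(vsum _ _ _) vsum_poly//; congr EFin; apply: eq_bigr => i _.
  rewrite [RHS]mulrC; congr (_ * _); rewrite mulrC divfK//.
  by rewrite pnatr_eq0 -lt0n bin_gt0 -ltnS.
have := getPex ex; rewrite -/(quermassintegral K) => h.
apply: (mv_unique (a := fun j => 'C(p, j)%:R * quermassintegral K j)) => // l l0.
have := h l l0; rewrite mE volumeE; last exact: compact_ballsum.
by move=> [e]; rewrite /vsum e; apply: eq_bigr => i _; rewrite mulrC.
Qed.

End steiner_coefficients.

(** * Mixed volumes with the ball of a subspace *)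

Section rotation_averages.
Context {R : realType}.

Lemma cvgn_mulr (u : R^nat) (a c : R) : u m @[m --> \oo] --> a ->
  u m * c @[m --> \oo] --> a * c.
Proof. by move=> ua; apply: cvgM => //; exact: cvg_cst. Qed.

Lemma cvgn_mull (u : R^nat) (a c : R) : u m @[m --> \oo] --> a ->
  c * u m @[m --> \oo] --> c * a.
Proof. by move=> ua; apply: cvgM => //; exact: cvg_cst. Qed.

Arguments cvgn_mulr {u a} c.
Arguments cvgn_mull {u a} c.

Lemma mv_image n n' p j (K : set 'rV[R]_p) (P : 'M[R]_(n, p)) (P' : 'M[R]_(n', p)) :
  (forall u, eball u -> exists2 u', eball u' & u *m P = u' *m P') ->
  (forall u', eball u' -> exists2 u, eball u & u' *m P' = u *m P) ->
  mv j K P = mv j K P'.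
Proof.
move=> h h'; apply: eq_bigr => i _; congr (_ * _); rewrite /vsum; congr volume.
apply/seteqP; split => v [x Kx [u Bu <-]]; exists x => //.
  by have [u' Bu' ->] := h u Bu; exists u'.
by have [u' Bu' ->] := h' u Bu; exists u'.
Qed.

Lemma enorm_coisometry m n (F : 'M[R]_(m, n)) (y : 'rV[R]_m) : F *m F^T = 1%:M ->
  enorm (y *m F) = enorm y.
Proof. by move=> FF; rewrite /enorm dot_mulmx -mulmxA FF mulmx1. Qed.

Lemma enorm_coisometryT m n (F : 'M[R]_(m, n)) (x : 'rV[R]_n) : F *m F^T = 1%:M ->
  enorm (x *m F^T) <= enorm x.
Proof.
move=> FF; have [->|z0] := eqVneq (x *m F^T) 0.
  by rewrite /enorm [dot 0 0]big1 ?sqrtr0 ?sqrtr_ge0// => i _; rewrite mxE mul0r.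
have zp := enorm_gt0 z0; rewrite -(ler_pM2r zp) -expr2 sqr_enorm dot_mulmx trmxK.
by apply: le_trans (cauchy_schwarz _ _) _; rewrite enorm_coisometry.
Qed.

(** F^T maps the ball of R^n onto that of R^m: it does not increase norms, and [F] provides
    preimages of the same norm. *)
Lemma mv_coisometry m n j (F : 'M[R]_(m, n)) (L : set 'rV[R]_m) : F *m F^T = 1%:M ->
  mv j L F^T = mv j L (1%:M : 'M[R]_m).
Proof.
move=> FF; apply: mv_image => u Bu; rewrite /eball/=.
  exists (u *m F^T); last by rewrite mulmx1.
  exact: le_trans (enorm_coisometryT _ FF) Bu.
exists (u *m F); first by rewrite /eball/= enorm_coisometry.
by rewrite mulmx1 -mulmxA FF mulmx1.
Qed.

Lemma mv_isorth n p j (K : set 'rV[R]_p) (P : 'M[R]_(n, p)) (Q : 'M[R]_n) : isorth Q ->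
  mv j K (Q *m P) = mv j K P.
Proof.
move=> oQ; apply: mv_image => u Bu.
  by exists (u *m Q); rewrite ?mulmxA// /eball/= enorm_isorth.
exists (u *m Q^T); first by rewrite /eball/= enorm_isorth//; exact: isorthT.
by rewrite mulmxA -(mulmxA u) (mulmx1C (oQ : _ *m _ = _)) mulmx1.
Qed.

Lemma eball0 n : @eball R n 0.
Proof. by rewrite /eball/= /enorm /dot big1 ?sqrtr0// => i _; rewrite mxE mul0r. Qed.

Lemma mv_eball p j : (j <= p)%N -> mv j (@eball R p) (1%:M : 'M[R]_p) = 'C(p, j)%:R * omega p.
Proof.
move=> jp; apply: (mv_unique (a := fun j => 'C(p, j)%:R * omega p)) => // l l0.
have l1 : 0 < 1 + l by lra.
rewrite /vsum (_ : ballsum _ _ _ = [set (1 + l) *: x | x in @eball R p]).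
  rewrite /volume vol_scale; [|exact: ltW|exact: compact_ball|by exists 0; exact: eball0].
  rewrite volumeE; last exact: compact_ball.
  rewrite -EFinM/= exprDn mulr_suml; apply: eq_bigr => i _.
  by rewrite expr1n mul1r /omega eballE -[_ *+ _]mulr_natr -mulrA.
apply/seteqP; split => v.
  move=> [x Bx [u Bu <-]]; exists ((1 + l)^-1 *: (x + l *: u)); last first.
    by rewrite scalerA divff ?gt_eqF// scale1r mulmx1.
  have [_ vB] := @cbody_ball R p; rewrite scalerDr scalerA; apply: vB => //.
  - by rewrite invr_ge0 ltW.
  - by rewrite mulr_ge0// invr_ge0 ltW.
  - by field; rewrite gt_eqF.
by move=> [x Bx <-]; exists x => //; exists x => //; rewrite mulmx1 scalerDl scale1r.
Qed.

Lemma proj_tail_eball n : proj_tail (@eball R n.+1) = @eball R n.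
Proof.
apply/seteqP; split => y.
  move=> [v Bv <-]; move: Bv; rewrite /eball/= => /(le_trans _); apply.
  rewrite /enorm ler_wsqrtr// /dot big_ord_recl; under eq_bigr do rewrite !mxE.
  by rewrite lerDr -expr2 sqr_ge0.
move=> By; exists (cons_row 0 y); last exact: tail_cons.
rewrite /eball/= /enorm /dot big_ord_recl cons_row0 mul0r add0r.
by under eq_bigr do rewrite !cons_rowS.
Qed.

Lemma mixvol_stdrows_eball j m : mixvol (@stdrows R (j + m) j) (@eball R (j + m)) = omega m.
Proof.
elim: j => [|j IH]; first by rewrite /= /omega eballE.
rewrite (stdrowsS (j + m) j) (mixvol_cons _ _ (@cbody_ball R (j + m).+1)).
by rewrite normr1 mul1r (mapK (@tail_cons R _ 0)) proj_tail_eball IH.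
Qed.

Lemma mixvol_pad_stdrows_eball j m k :
  mixvol (map (pad k) (@stdrows R (j + m) j)) (@eball R (j + m + k)) = omega (m + k).
Proof.
elim: j => [|j IH]; first by rewrite /= /omega eballE.
rewrite (stdrowsS (j + m) j) map_cons pad_cons pad0.
rewrite (mixvol_cons _ _ (@cbody_ball R (j + m + k).+1)) normr1 mul1r.
rewrite -(map_comp (pad k) (cons_row 0)).
rewrite -(map_comp (@tail R (j + m + k)) (pad k \o cons_row 0)).
rewrite (_ : map _ _ = map (pad k) (@stdrows R (j + m) j)); first by rewrite proj_tail_eball IH.
by apply: eq_map => x /=; rewrite pad_cons tail_cons.
Qed.

Lemma eball_isorth n (Q : 'M[R]_n) : isorth Q -> [set y | eball (y *m Q)] = @eball R n.
Proof. by move=> oQ; apply/seteqP; split => y; rewrite /eball/= enorm_isorth. Qed.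

Lemma mixvol_isorth_eball n (Q : 'M[R]_n) us : isorth Q ->
  mixvol [seq u *m Q | u <- us] (@eball R n) = mixvol us (@eball R n).
Proof.
by move=> oQ; rewrite -(mixvol_isometry erefl us oQ (@cbody_ball R n)) eball_isorth.
Qed.

(** The factor of [mixvol_canonical] is the same for the ball as for any [K], and the ball ignores
    the rotation; so the value for the ball determines the factor, whatever the segments. *)
Lemma mixvol_canonical_eball j m (X : seq 'rV[R]_(j + m)) : size X = j ->
  exists c (Q : 'M[R]_(j + m)), [/\ 0 <= c, isorth Q,
    forall k, mixvol (map (pad k) X) (@eball R (j + m + k)) = c * omega (m + k),
    mixvol X (@eball R (j + m)) = c * omega m &
    forall K, cbody K ->
      mixvol X K = c * mixvol [seq x *m Q | x <- @stdrows R (j + m) j] K].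
Proof.
move=> sX; have [c [Q [c0 oQ hQ]]] := mixvol_canonical X; rewrite sX in hQ.
have hK K : cbody K -> mixvol X K = c * mixvol [seq x *m Q | x <- @stdrows R (j + m) j] K.
  move=> bK; have [K' bK' e] := mixvol_pad0 X bK.
  by rewrite !e hQ// (map_comp (pad 0) (fun x => x *m Q)).
exists c, Q; split => //.
- move=> k; rewrite hQ; last exact: cbody_ball.
  rewrite -(mixvol_pad_stdrows_eball j); congr (_ * _).
  have oQ' : isorth (block_mx Q 0 0 1%:M : 'M[R]_(j + m + k)).
    by apply: isorth_block => //; exact: isorth1.
  rewrite -[RHS](mixvol_isorth_eball _ oQ'); congr mixvol.
  rewrite -(map_comp (fun y => y *m block_mx Q 0 0 1%:M) (pad k)).
  by apply: eq_map => x /=; rewrite pad_mul.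
- by rewrite hK ?mixvol_isorth_eball ?mixvol_stdrows_eball//; exact: cbody_ball.
Qed.

(** Projecting along j directions leaves a ball of dimension m + k in the whole space and m in the
    subspace, for all segments alike. With n = j + m + k, the ratio is the part omega_(n-j) /
    omega_(n-k-j) of [alpha]. *)
Lemma mixvol_frame_eball n j m k (e : n = (j + m + k)%N) (F : 'M[R]_(j + m, n))
    (X : seq 'rV[R]_(j + m)) : size X = j -> F *m F^T = 1%:M ->
  mixvol [seq x *m F | x <- X] (@eball R n) * omega m =
  mixvol X (@eball R (j + m)) * omega (m + k).
Proof.
subst n => sX FF; have [Q oQ FQ] := frame_completion FF.
have -> : [seq x *m F | x <- X] = [seq y *m Q | y <- map (pad k) X].
  by rewrite -map_comp; apply: eq_map => x /=; rewrite FQ mulmxA mul_mx_row mulmx1 mulmx0.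
rewrite mixvol_isorth_eball//.
have [c [_ [_ _ -> -> _]]] := mixvol_canonical_eball sX.
by rewrite mulrAC.
Qed.

Lemma coefsum_map n p j (K : set 'rV[R]_p) (A : 'M[R]_(n, p)) us :
  coefsum j K [seq u *m A | u <- us] =
  \sum_(s <- subs us | size s == j) mixvol [seq u *m A | u <- s] K.
Proof.
rewrite /coefsum subs_map big_map; apply: eq_bigl => s.
by rewrite size_map.
Qed.

Lemma map_mulmxA n m p (A : 'M[R]_(n, m)) (B : 'M[R]_(m, p)) (us : seq 'rV[R]_n) :
  [seq x *m B | x <- [seq u *m A | u <- us]] = [seq u *m (A *m B) | u <- us].
Proof. by rewrite -map_comp; apply: eq_map => x /=; rewrite mulmxA. Qed.

Lemma mv_frame_eball n j m k (e : n = (j + m + k)%N) (F : 'M[R]_(j + m, n)) :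
  F *m F^T = 1%:M ->
  mv j (@eball R n) (F^T *m F) * omega m = 'C(j + m, j)%:R * omega (j + m) * omega (m + k).
Proof.
move=> FF; have jn : (j <= n)%N by rewrite e -addnA leq_addr.
have jm : (j <= j + m)%N by rewrite leq_addr.
rewrite -mv_eball// -(mv_coisometry j (@eball R (j + m)) FF).
have c1 := @coefsum_cvg _ _ _ j (@eball R n) (F^T *m F) (@cbody_ball R n) jn.
have c2 := @coefsum_cvg _ _ _ j (@eball R (j + m)) F^T (@cbody_ball R _) jm.
have {}c1 := cvgn_mulr (omega m) c1; have {}c2 := cvgn_mulr (omega (m + k)) c2.
rewrite -(cvg_lim (@norm_hausdorff _ R^o) c1) -(cvg_lim (@norm_hausdorff _ R^o) c2).
congr (lim (_ @ \oo)); apply/funext => i.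
rewrite !coefsum_map !mulr_suml; apply: eq_bigr => s /eqP sj.
rewrite -map_mulmxA (mixvol_frame_eball e)// ?size_map//.
Qed.

Lemma mv_slice_bounds n j m k (e : n = (j + m + k)%N) (F : 'M[R]_(j + m, n))
    (K : set 'rV[R]_n) :
  F *m F^T = 1%:M -> cbody K -> (forall x, K x -> K (- x)) ->
  let S := [set y | K (y *m F)] in cbody S ->
  mv j S (1%:M : 'M[R]_(j + m)) * volume K <=
    'C(m + k, k)%:R * (mv j K (F^T *m F) * volume S) /\
  mv j K (F^T *m F) * volume S <=
    'C(n, k)%:R * (volume K * mv j S (1%:M : 'M[R]_(j + m))).
Proof.
move=> FF bK sK S bS; have jn : (j <= n)%N by rewrite e -addnA leq_addr.
have jm : (j <= j + m)%N by rewrite leq_addr.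
rewrite -(mv_coisometry j S FF).
have c1 := @coefsum_cvg _ _ _ j K (F^T *m F) bK jn.
have c2 := @coefsum_cvg _ _ _ j S F^T bS jm.
have h us := fun sj => mixvol_slice_bounds e (X := us) sj FF bK sK.
split.
  apply: (cvgn_ler (cvgn_mulr (volume K) c2) (cvgn_mull _ (cvgn_mulr (volume S) c1))) => i.
  rewrite !coefsum_map !mulr_suml mulr_sumr; apply: ler_sum => s /eqP sj.
  have [|+ _] := h [seq u *m F^T | u <- s]; first by rewrite size_map.
  by rewrite map_mulmxA.
apply: (cvgn_ler (cvgn_mulr (volume S) c1) (cvgn_mull _ (cvgn_mull (volume K) c2))) => i.
rewrite !coefsum_map !mulr_suml !mulr_sumr; apply: ler_sum => s /eqP sj.
have [|_] := h [seq u *m F^T | u <- s]; first by rewrite size_map.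
by rewrite map_mulmxA.
Qed.

Definition inner_radius n (K : set 'rV[R]_n) r := 0 < r /\ forall x, enorm x <= r -> K x.

Lemma volume_gt0 n (K : set 'rV[R]_n) r : compact K -> inner_radius K r -> 0 < volume K.
Proof.
move=> cK [r0 hr]; rewrite -lte_fin -volumeE//.
(* Half the side of a cube inside the ball of radius r; n.+1 bounds the square root of n and is
   positive also for n = 0. *)
pose d := r / n.+1%:R; have d0 : 0 < d by rewrite divr_gt0.
apply: (@lt_le_trans _ _ (vol (@box R n d))).
  by rewrite vol_box ?ltW// lte_fin exprn_gt0// pmulrn_lgt0.
apply: le_vol => x hx; apply: hr.
rewrite -(ler_pXn2r (n := 2))// ?nnegrE ?enorm_ge0 ?(ltW r0)// sqr_enorm.
have xd i : x 0 i * x 0 i <= d ^+ 2.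
  have := hx i; rewrite /= in_itv/= -ler_norml => h.
  by rewrite -expr2 -real_normK ?num_real// ler_pXn2r// ?nnegrE ltW.
have h : dot x x <= \sum_(i < n) d ^+ 2 by apply: ler_sum => i _; exact: xd.
rewrite sumr_const card_ord in h. apply: (le_trans h).
rewrite -[leLHS]mulr_natl /d expr_div_n.
rewrite mulrCA -[leRHS]mulr1; apply: ler_wpM2l; first by rewrite sqr_ge0.
rewrite ler_pdivrMr ?exprn_gt0// mul1r -natrX ler_nat.
by rewrite (leq_trans (leqnSn n))// -{1}(expn1 n.+1) leq_pexp2l.
Qed.

Lemma omega_gt0 n : 0 < omega n :> R.
Proof.
rewrite /omega eballE; apply: (@volume_gt0 _ _ 1); first exact: compact_ball.
by split.
Qed.

End rotation_averages.

Arguments cvgn_mulr {R u a} c.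
Arguments cvgn_mull {R u a} c.

(** * Continuity under rotations and averages over them *)

Section continuity.
Context {R : realType}.

Lemma enorm_le_coord n (v : 'rV[R]_n) M : 0 <= M -> (forall i, `|v 0 i| <= M) ->
  enorm v <= n.+1%:R * M.
Proof.
move=> M0 h; rewrite -(ler_pXn2r (n := 2))// ?nnegrE ?enorm_ge0 ?mulr_ge0//.
rewrite sqr_enorm exprMn.
have hd : dot v v <= \sum_(i < n) M ^+ 2.
  by apply: ler_sum => i _; rewrite -expr2 -real_normK ?num_real// ler_pXn2r ?nnegrE.
rewrite sumr_const card_ord in hd; apply: (le_trans hd).
rewrite -[leLHS]mulr_natl; apply: ler_wpM2r; first exact: sqr_ge0.
by rewrite -natrX ler_nat (leq_trans (leqnSn n))// -{1}(expn1 n.+1) leq_pexp2l.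
Qed.

Definition mxconst n p : R := p.+1%:R * n.+1%:R.

Lemma mxconst_gt0 n p : 0 < mxconst n p. Proof. by rewrite mulr_gt0. Qed.

Lemma enorm_mulmx_le n p (y : 'rV[R]_n) (A : 'M[R]_(n, p)) :
  enorm (y *m A) <= mxconst n p * (`|A| * enorm y).
Proof.
rewrite /mxconst -mulrA; apply: enorm_le_coord => [|i].
  by rewrite !mulr_ge0// enorm_ge0.
rewrite mxE; apply: le_trans (ler_norm_sum _ _ _) _.
have h : \sum_(k < n) `|y 0 k * A k i| <= \sum_(k < n) `|A| * enorm y.
  apply: ler_sum => k _; rewrite normrM mulrC.
  by apply: ler_pM => //; [exact: coord_le_norm | exact: coord_le_enorm].
rewrite sumr_const card_ord -[leRHS]mulr_natl in h; apply: (le_trans h).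
by apply: ler_wpM2r; [rewrite mulr_ge0// enorm_ge0 | rewrite ler_nat].
Qed.

Lemma outer_radius n (K : set 'rV[R]_n) : compact K ->
  exists2 r, 0 < r & forall x, K x -> enorm x <= r.
Proof.
move=> /compact_box[M M0 KM]; exists (n.+1%:R * M + 1); first by rewrite ltr_wpDl// mulr_ge0.
move=> x /KM hx; apply: le_trans (_ : n.+1%:R * M <= _); last by rewrite lerDl.
by apply: enorm_le_coord => // i; rewrite ler_norml; have := hx i; rewrite /= in_itv.
Qed.

(** A chord bound for the convex function (1 + t)^p on [0, 1]; it turns a dilation factor into an
    error linear in t. *)
Lemma exprD1_le (t : R) p : 0 <= t <= 1 -> (1 + t) ^+ p <= 1 + t * 2 ^+ p.
Proof.
move=> /andP[t0 t1].
have h : (1 + t) ^+ p <= 1 + t * (2 ^+ p - 1).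
  elim: p => [|p IH]; first by rewrite !expr0 subrr mulr0 addr0.
  rewrite !exprS.
  have q1 : 1 <= 2 ^+ p :> R by rewrite exprn_ege1// ler1n.
  apply: le_trans (_ : (1 + t) * (1 + t * (2 ^+ p - 1)) <= _).
    by apply: ler_wpM2l => //; rewrite addr_ge0.
  move: (2 ^+ p) q1 => q q1.
  have tt : t * t <= t by rewrite -[leRHS]mulr1; exact: ler_wpM2l.
  have : t * t * (q - 1) <= t * (q - 1) by apply: ler_wpM2r => //; lra.
  by lra.
apply: le_trans h _; rewrite lerD2l; apply: ler_wpM2l => //; lra.
Qed.

(* K + t K = (1 + t) K by convexity, and a ball of radius t r fits in t K. *)
Lemma thicken n (K : set 'rV[R]_n) r t x z : cbody K -> inner_radius K r -> 0 < t ->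
  K x -> enorm z <= t * r -> K ((1 + t)^-1 *: (x + z)).
Proof.
move=> [_ vK] [r0 hr] t0 Kx zt.
have Kz : K (t^-1 *: z).
  by apply: hr; rewrite enormZ gtr0_norm ?invr_gt0// mulrC ler_pdivrMr// mulrC.
have -> : (1 + t)^-1 *: (x + z) = (1 + t)^-1 *: x + ((1 + t)^-1 * t) *: (t^-1 *: z).
  by rewrite scalerDr scalerA -mulrA divff ?mulr1// gt_eqF.
have t1 : 0 < 1 + t by lra.
apply: vK => //; first by rewrite invr_ge0 ltW.
- by rewrite mulr_ge0 ?invr_ge0// ltW.
- by field; rewrite gt_eqF.
Qed.

Fixpoint drops j m : set 'rV[R]_(j + m) -> set 'rV[R]_m :=
  if j is j'.+1 then fun K => @drops j' m (proj_tail (K : set 'rV[R]_(j' + m).+1))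
  else id.

Lemma cbody_drops j m (K : set 'rV[R]_(j + m)) : cbody K -> cbody (drops K).
Proof. by elim: j K => //= j IH K bK; apply: IH; exact: cbody_proj_tail. Qed.

Lemma mixvol_drops j m (K : set 'rV[R]_(j + m)) : cbody K ->
  mixvol (@stdrows R (j + m) j) K = volume (drops K).
Proof.
elim: j K => [//|j IH] K bK; rewrite (stdrowsS (j + m) j) (mixvol_cons _ _ bK).
by rewrite normr1 mul1r (mapK (@tail_cons R _ 0)) IH//; exact: cbody_proj_tail.
Qed.

Lemma drops_scale_sub j m (K L : set 'rV[R]_(j + m)) s : s != 0 ->
  (forall x, K x -> L (s^-1 *: x)) -> forall y, drops K y -> drops L (s^-1 *: y).
Proof.
move=> s0; elim: j K L => [//|j IH] K L KL y /=.
apply: IH => x [v Kv <-]; exists (s^-1 *: v); first exact: KL.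
by rewrite tailZ.
Qed.

Lemma mixvol_stdrows_le j m (K L : set 'rV[R]_(j + m)) s : 0 < s -> cbody K -> cbody L -> L 0 ->
  (forall x, K x -> L (s^-1 *: x)) ->
  mixvol (@stdrows R (j + m) j) K <= s ^+ m * mixvol (@stdrows R (j + m) j) L.
Proof.
move=> s0 bK bL L0 KL; rewrite !mixvol_drops//.
have [cdK _] := cbody_drops bK; have [cdL _] := cbody_drops bL.
have dL0 : drops L !=set0.
  exists 0; elim: j L {bK bL KL cdK cdL K} L0 => [//|j IH] L L0 /=.
  by apply: IH; exists 0 => //; exact: tail0.
rewrite -lee_fin EFinM -!volumeE// -vol_scale//; last exact: ltW.
apply: le_vol => y Ky.
exists (s^-1 *: y); first by apply: drops_scale_sub Ky => //; rewrite gt_eqF.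
by rewrite scalerA divff ?scale1r// gt_eqF.
Qed.

(** For close [P] and [Q], the body rotated by one lies in a slight dilate of the body rotated by
    the other, because [K] contains a ball around the origin; the dilation 1 + t costs a factor (1 +
    t)^m. *)
Lemma mixvol_orth_uniform j m (K : set 'rV[R]_(j + m)) r : cbody K -> inner_radius K r ->
  orth_uniform (fun Q => mixvol [seq x *m Q | x <- @stdrows R (j + m) j] K).
Proof.
move=> bK rK; have [r0 hr] := rK; have [cK _] := bK.
have [B B0 hB] := outer_radius cK.
have fE Q : isorth Q -> mixvol [seq x *m Q | x <- @stdrows R (j + m) j] K =
    mixvol (@stdrows R (j + m) j) [set y | K (y *m Q)].
  by move=> oQ; rewrite mixvol_isometry.
have K0 : K 0 by apply: hr; rewrite /enorm /dot big1 ?sqrtr0 ?ltW// => i _; rewrite mxE mul0r.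
pose E := mixvol (@stdrows R (j + m) j) K.
pose M := (B / r) ^+ m * E.
have E0 : 0 <= E by exact: mixvol_ge0.
have Br : 0 < B / r by rewrite divr_gt0.
have M0 : 0 <= M by rewrite mulr_ge0// exprn_ge0// ltW.
have hM Q : isorth Q -> mixvol (@stdrows R (j + m) j) [set y | K (y *m Q)] <= M.
  move=> oQ; apply: mixvol_stdrows_le => //; first exact: cbody_rotate.
  move=> x /= /hB; rewrite enorm_isorth// => xB; apply: hr.
  rewrite enormZ gtr0_norm ?invr_gt0// invf_div mulrAC ler_pdivrMr//.
  by apply: ler_wpM2l => //; exact: ltW.
move=> e e0.
(* Makes t 2^m [M] at most e, where [M] bounds the mixed volumes of all rotated bodies; the added 1
   keeps the denominator positive. *)
pose t := Num.min 1 (e / (2 ^+ m * M + 1)).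
have D0 : 0 < 2 ^+ m * M + 1 by rewrite ltr_wpDl// mulr_ge0// exprn_ge0.
have t0 : 0 < t by rewrite lt_min ltr01 divr_gt0.
have t1 : t <= 1 by rewrite ge_min lexx.
have te : t * (2 ^+ m * M) <= e.
  apply: le_trans (_ : t * (2 ^+ m * M + 1) <= _); first by rewrite ler_wpM2l ?lerDl// ltW.
  by rewrite -ler_pdivlMr// ge_min lexx orbT.
pose C := mxconst (j + m) (j + m).
have C0 : 0 < C by exact: mxconst_gt0.
exists (t * r / (C * B)); first by rewrite divr_gt0 ?mulr_gt0.
move=> P Q oP oQ PQ; rewrite !fE//.
apply: le_trans (_ : (1 + t) ^+ m * mixvol (@stdrows R (j + m) j) [set y | K (y *m Q)] <= _).
  apply: mixvol_stdrows_le.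
  - by lra.
  - exact: cbody_rotate.
  - exact: cbody_rotate.
  - by rewrite /= mul0mx.
  move=> x Kx /=; rewrite -scalemxAl.
  have -> : x *m Q = x *m P + x *m (Q - P) by rewrite -mulmxDr addrC subrK.
  apply: (thicken bK rK) => //; apply: le_trans (enorm_mulmx_le _ _) _.
  have xB : enorm x <= B by have := hB _ Kx; rewrite enorm_isorth.
  rewrite distrC in PQ; rewrite -/C.
  rewrite ltr_pdivlMr ?mulr_gt0// in PQ.
  apply: le_trans (_ : C * (`|Q - P| * B) <= _).
    by apply: ler_wpM2l; [exact: ltW | exact: ler_wpM2l].
  by rewrite mulrCA; exact: ltW.
have f0 : 0 <= mixvol (@stdrows R (j + m) j) [set y | K (y *m Q)].
  by apply: mixvol_ge0; exact: cbody_rotate.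
have fM := hM Q oQ.
apply: le_trans (_ : (1 + t * 2 ^+ m) * mixvol (@stdrows R (j + m) j) [set y | K (y *m Q)] <= _).
  by apply: ler_wpM2r => //; apply: exprD1_le; rewrite ltW.
rewrite mulrDl mul1r lerD2l -mulrA; apply: le_trans te.
apply: ler_wpM2l; first exact: ltW.
by apply: ler_wpM2l => //; exact: exprn_ge0.
Qed.

(** For each list of j segments, [K] and the ball carry the same factor, so the error is
    proportional to the value for the ball. It therefore survives sums over sublists and the limit
    towards the ball placed by [P], and the same [s] and [c] serve all [P]. *)
Lemma mv_mean n j (K : set 'rV[R]_n) r e : (j <= n)%N -> cbody K -> inner_radius K r -> 0 < e ->
  exists s c, orth_family s /\ forall n' (P : 'M[R]_(n', n)),
    `|(\sum_(Q <- s) mv j K (P *m Q)) / (size s)%:R - c * mv j (@eball R n) P|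
      <= e * mv j (@eball R n) P.
Proof.
move=> jn; have [m nE] : exists m, n = (j + m)%N by exists (n - j)%N; rewrite subnKC.
subst n => bK rK e0.
pose f Q := mixvol [seq x *m Q | x <- @stdrows R (j + m) j] K.
have w0 := @omega_gt0 R m.
(* The ball has the value omega m on canonical segments, whence this tolerance and the constant c /
   omega m. *)
have ew0 : 0 < e * omega m by rewrite mulr_gt0.
have [s [c [os hs]]] := orth_mean (mixvol_orth_uniform bK rK) ew0.
have [s0 os'] := os.
exists s, (c / omega m); split => // n' P.
have mean (X : seq 'rV[R]_(j + m)) : size X = j ->
    `|(\sum_(Q <- s) mixvol [seq x *m Q | x <- X] K) / (size s)%:R -
      c / omega m * mixvol X (@eball R (j + m))| <= e * mixvol X (@eball R (j + m)).
  move=> sX; have [a [S [a0 oS _ -> hX]]] := mixvol_canonical_eball sX.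
  have -> : \sum_(Q <- s) mixvol [seq x *m Q | x <- X] K = a * \sum_(Q <- s) f (S *m Q).
    rewrite mulr_sumr big_seq [RHS]big_seq; apply: eq_bigr => Q Qs.
    rewrite -(mixvol_isometry erefl X (os' _ Qs) bK) hX; last by apply: cbody_rotate => //; exact: os'.
    by rewrite mixvol_isometry//; [rewrite map_mulmxA | exact: os'].
  have -> : a * (\sum_(Q <- s) f (S *m Q)) / (size s)%:R - c / omega m * (a * omega m) =
      a * (avg f s S - c).
    by rewrite /avg; field; rewrite pnatr_eq0 -lt0n s0 gt_eqF.
  rewrite normrM ger0_norm// mulrCA; apply: ler_wpM2l => //.
  exact: hs.
have cQ Q : coefsum j K [seq u *m (P *m Q) | u <- ballz n' i] @[i --> \oo] --> mv j K (P *m Q).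
  exact: coefsum_cvg.
have cB : coefsum j (@eball R (j + m)) [seq u *m P | u <- ballz n' i] @[i --> \oo] -->
    mv j (@eball R (j + m)) P.
  by apply: coefsum_cvg => //; exact: cbody_ball.
have c1 := cvgn_mulr (size s)%:R^-1 (cvgn_sum (r := s) (P := xpredT) (fun Q _ => cQ Q)).
have c2 := cvg_norm (cvgB c1 (cvgn_mull (c / omega m) cB)).
have c3 := cvgn_mull e cB.
apply: (cvgn_ler (c2 _ _) c3) => i.
rewrite !fctE coefsum_map !mulr_sumr /=.
under eq_bigr do rewrite coefsum_map.
rewrite exchange_big/= mulr_suml -sumrB.
apply: le_trans (ler_norm_sum _ _ _) _; apply: ler_sum => x /eqP xj.
have -> : \sum_(Q <- s) mixvol [seq u *m (P *m Q) | u <- x] K =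
    \sum_(Q <- s) mixvol [seq y *m Q | y <- [seq u *m P | u <- x]] K.
  by apply: eq_bigr => Q _; rewrite map_mulmxA.
by apply: mean; rewrite size_map.
Qed.

(** Replacing [P] by [P'] moves a point of the sum by at most t r, which [thicken] absorbs in a
    dilation by 1 + t. *)
Lemma vsum_le n p (K : set 'rV[R]_p) r (P P' : 'M[R]_(n, p)) l t : cbody K ->
  inner_radius K r -> 0 <= l -> 0 < t -> l * (mxconst n p * `|P' - P|) <= t * r ->
  vsum K P' l <= (1 + t) ^+ p * vsum K P l.
Proof.
move=> bK rK l0 t0 h; have [cK _] := bK; have [r0 hr] := rK.
have t1 : 0 < 1 + t by lra.
have K0 : K 0 by apply: hr; rewrite /enorm /dot big1 ?sqrtr0 ?ltW// => i _; rewrite mxE mul0r.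
have c1 : compact (ballsum K P l) by exact: compact_ballsum.
have c2 : compact (ballsum K P' l) by exact: compact_ballsum.
have ne : ballsum K P l !=set0.
  by exists 0; exists 0 => //; exists 0; [exact: eball0 | rewrite mul0mx scaler0 addr0].
rewrite /vsum -lee_fin EFinM -!volumeE// -vol_scale//; last exact: ltW.
apply: le_vol => _ [x Kx [u Bu <-]].
exists ((1 + t)^-1 *: (x + l *: (u *m P'))); last first.
  by rewrite scalerA divff ?scale1r// gt_eqF.
exists ((1 + t)^-1 *: (x + l *: (u *m (P' - P)))).
  apply: (thicken bK rK) => //; rewrite enormZ ger0_norm//.
  apply: le_trans h; apply: ler_wpM2l => //; apply: le_trans (enorm_mulmx_le _ _) _.
  apply: ler_wpM2l; first exact/ltW/mxconst_gt0.
  by rewrite -[leRHS]mulr1; apply: ler_wpM2l.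
exists ((1 + t)^-1 *: u).
  rewrite /eball/= enormZ gtr0_norm ?invr_gt0// mulrC ler_pdivrMr// mul1r.
  by apply: le_trans Bu _; rewrite lerDl ltW.
rewrite -scalemxAl scalerA mulrC -scalerA -scalerDr; congr (_ *: _).
by rewrite -addrA -scalerDr -mulmxDr subrK.
Qed.

(** [vsum_le] in both directions. Through [mv_continuous], this makes the integrands on the
    Grassmannian Borel measurable. *)
Lemma vsum_continuous n p (K : set 'rV[R]_p) r l : cbody K -> inner_radius K r -> 0 <= l ->
  continuous (fun P : 'M[R]_(n, p) => vsum K P l).
Proof.
move=> bK rK l0 P; have [r0 _] := rK.
apply/(@cvgrPdist_le _ _ _ _ (nbhs_filter P)) => e e0.
pose V := vsum K P l; have V0 : 0 <= V by exact: volume_ge0.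
pose q : R := 2 ^+ p; have q0 : 1 <= q by rewrite exprn_ege1// ler1n.
have qV : 0 < q * (q * V) + 1 by rewrite ltr_wpDl// !mulr_ge0//; lra.
pose t := Num.min 1 (e / (q * (q * V) + 1)).
have t0 : 0 < t by rewrite lt_min ltr01 divr_gt0.
have t1 : t <= 1 by rewrite ge_min lexx.
have te : t * (q * (q * V)) <= e.
  apply: le_trans (_ : t * (q * (q * V) + 1) <= _); first by rewrite ler_wpM2l ?lerDl// ltW.
  by rewrite -ler_pdivlMr// ge_min lexx orbT.
pose C := mxconst n p; have C0 : 0 < C by exact: mxconst_gt0.
have d0 : 0 < t * r / ((l + 1) * C) by rewrite divr_gt0 ?mulr_gt0// ltr_wpDl.
apply/nbhs_ballP; exists (t * r / ((l + 1) * C)) => // P'; rewrite -ball_normE /= => PP'.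
have hl : l * (C * `|P - P'|) <= t * r.
  rewrite ltr_pdivlMr ?mulr_gt0// ?ltr_wpDl// in PP'.
  apply: le_trans (ltW PP'); rewrite mulrA mulrC; apply: ler_wpM2l => //.
  by apply: ler_wpM2r; [exact: ltW | rewrite lerDl].
have h1 := vsum_le bK rK l0 t0 hl.
have h2 : vsum K P' l <= (1 + t) ^+ p * V.
  by apply: (vsum_le bK rK l0 t0); rewrite distrC.
have ht : (1 + t) ^+ p <= 1 + t * q by apply: exprD1_le; rewrite ltW.
have V'0 : 0 <= vsum K P' l by exact: volume_ge0.
have h3 := ler_wpM2r V0 ht; have h4 := ler_wpM2r V'0 ht.
have V'q : vsum K P' l <= q * V.
  apply: le_trans h2 _; apply: ler_wpM2r => //.
  by rewrite /q lerXn2r// ?nnegrE; lra.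
have h5 : t * q * V <= t * (q * (q * V)).
  rewrite -mulrA; apply: ler_wpM2l; first exact: ltW.
  by apply: ler_wpM2l; [lra | rewrite -[leLHS]mul1r; exact: ler_wpM2r].
have h6 : t * q * vsum K P' l <= t * (q * (q * V)).
  by rewrite -mulrA; apply: ler_wpM2l; [exact: ltW | apply: ler_wpM2l => //; lra].
rewrite ler_norml -/V; move: h1 h2 h3 h4 h5 h6; rewrite -/V !mulrDl !mul1r => *.
by apply/andP; split; lra.
Qed.

Lemma mv_continuous n p j (K : set 'rV[R]_p) r : cbody K -> inner_radius K r ->
  continuous (fun P : 'M[R]_(n, p) => mv j K P).
Proof.
move=> bK rK; apply: sum_continuous => i; apply: contM; last exact: cont_cst.
exact: (vsum_continuous bK rK).
Qed.

End continuity.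

(** * The Grassmannian *)

Section frames.
Context {R : realType}.

Lemma row_free_frame m n (U : 'M[R]_(m, n)) : U *m U^T = 1%:M -> row_free U.
Proof. by move=> UU; apply/row_freeP; exists U^T. Qed.

Lemma gram_schmidt m n (A : 'M[R]_(m, n)) : row_free A ->
  exists2 U : 'M[R]_(m, n), U *m U^T = 1%:M & (U == A)%MS.
Proof.
elim: m A => [|m IH] A fA.
  by exists A; [apply/matrixP => -[] | apply/eqmxP].
move: A fA; rewrite -[m.+1]/(1 + m)%N => A fA.
suff [U UU UA] : exists2 U : 'M[R]_(1 + m, n), U *m U^T = 1%:M & (U <= A)%MS.
  exists U => //; rewrite -(geq_leqif (mxrank_leqif_eq UA)).
  by rewrite (eqP fA) (eqP (row_free_frame UU)).
pose a : 'rV[R]_n := usubmx A; pose B : 'M[R]_(m, n) := dsubmx A.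
have AE : A = col_mx a B by rewrite vsubmxK.
have fB : row_free B.
  apply: inj_row_free => v vB.
  have : row_mx 0 v *m A = 0 :> 'rV[R]_n by rewrite AE mul_row_col mul0mx add0r.
  move/(congr1 (mulmx^~ (pinvmx A))); rewrite -(mulmxA _ A).
  rewrite mulmxVp// mulmx1 mul0mx -(row_mx0 _ 1 1 m) => /eq_row_mx[_ ->] //.
have [U UU /andP[UB BU]] := IH B fB.
(* The first row minus its projection on the span of the others; were it zero, the rows of [A] would
   be dependent. *)
pose w := a - a *m U^T *m U.
have w0 : w != 0.
  apply/eqP => /eqP; rewrite subr_eq0 => /eqP aU.
  have /submxP[D UD] := UB.
  have : row_mx 1%:M (- (a *m U^T *m D)) *m A = 0 :> 'rV[R]_n.
    by rewrite AE mul_row_col mul1mx mulNmx -[X in _ - X]mulmxA -UD -aU subrr.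
  move/(congr1 (mulmx^~ (pinvmx A))); rewrite -(mulmxA _ A).
  rewrite mulmxVp// mulmx1 mul0mx -(row_mx0 _ 1 1 m) => /eq_row_mx[/matrixP/(_ 0 0)].
  by rewrite !mxE eqxx => /eqP; rewrite oner_eq0.
have wU : w *m U^T = 0 by rewrite mulmxBl -(mulmxA _ U) UU mulmx1 subrr.
have Bi : (B <= A)%MS by apply/submxP; exists (row_mx 0 1%:M); rewrite AE mul_row_col mul0mx add0r mul1mx.
have ai : (a <= A)%MS by apply/submxP; exists (row_mx 1%:M 0); rewrite AE mul_row_col mul0mx addr0 mul1mx.
have UAs : (U <= A)%MS by apply: submx_trans UB Bi.
have wp := enorm_gt0 w0.
pose u := (enorm w)^-1 *: w.
exists (col_mx u U : 'M[R]_(1 + m, n)); last first.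
  rewrite col_mx_sub UAs andbT scalemx_sub// addmx_sub//.
  by rewrite eqmx_opp -mulmxA (submx_trans _ UAs)// mulmxA submxMl.
rewrite tr_col_mx mul_col_row UU.
have -> : u *m U^T = 0 by rewrite -scalemxAl wU scaler0.
have -> : U *m u^T = 0 by rewrite -[LHS]trmxK trmx_mul trmxK -scalemxAl wU scaler0 trmx0.
have -> : u *m u^T = 1%:M.
  rewrite mulmx_dot dotZl dotC dotZl -sqr_enorm mulrA -expr2 exprVn mulVf//.
  by rewrite expf_neq0// gt_eqF.
by rewrite -scalar_mx_block.
Qed.

Lemma vspace_frame m n (F : {vspace 'rV[R]_n}) : \dim F = m ->
  exists U : 'M[R]_(m, n), U *m U^T = 1%:M /\ forall x : 'rV[R]_n, (x \in F) = (x <= U)%MS.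
Proof.
move=> <-; pose A : 'M[R]_(\dim F, n) := \matrix_(i < \dim F) (vbasis F)`_i.
have AE (v : 'rV[R]_(\dim F)) : v *m A = \sum_(i < \dim F) v 0 i *: (vbasis F)`_i.
  by rewrite mulmx_sum_row; apply: eq_bigr => i _; rewrite rowK.
have fA : row_free A.
  apply: inj_row_free => v; rewrite AE => v0.
  apply/rowP => i; rewrite mxE.
  by have /freeP/(_ _ v0 i) := basis_free (vbasisP F).
have [U UU UA] := gram_schmidt fA; exists U; split => // x.
rewrite (eqmxP UA); apply/idP/submxP => [xF|[v ->]].
  exists (\row_i coord (vbasis F) i x); rewrite AE {1}(coord_vbasis xF).
  by apply: eq_bigr => i _; rewrite mxE.
rewrite AE; apply: memv_suml => i _; apply: memvZ; apply: vbasis_mem.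
by rewrite mem_nth// size_tuple.
Qed.

(** Each projection is unchanged when multiplied on the right by the other; transposing one of these
    identities and comparing with the other gives equality. *)
Lemma frame_proj_unique m n (U V : 'M[R]_(m, n)) : U *m U^T = 1%:M -> V *m V^T = 1%:M ->
  (U == V)%MS -> U^T *m U = V^T *m V.
Proof.
move=> UU VV /andP[/submxP[A UE] /submxP[B VE]].
have h1 : U *m (V^T *m V) = U by rewrite UE -mulmxA (mulmxA V) VV mul1mx.
have h2 : V *m (U^T *m U) = V by rewrite {1}VE -mulmxA (mulmxA U) UU mul1mx -VE.
have e1 : U^T *m U *m (V^T *m V) = U^T *m U by rewrite -mulmxA h1.
have e2 : V^T *m V *m (U^T *m U) = V^T *m V by rewrite -mulmxA h2.
have tr (W : 'M[R]_(m, n)) : (W^T *m W)^T = W^T *m W by rewrite trmx_mul trmxK.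
by rewrite -[LHS]tr -e1 trmx_mul !tr e2.
Qed.

End frames.

Section grassmannian_rotations.
Context {R : realType} {n k : nat}.
Local Notation G := (grassmannian R n k).

Lemma frameP (F : G) : frame F *m (frame F)^T = 1%:M /\
  forall x : 'rV[R]_n, (x \in val F) = (x <= frame F)%MS.
Proof.
exact: getPex (vspace_frame (eqP (valP F))).
Qed.

(** The image is taken only for orthogonal [Q], and [F] is kept otherwise: the dimension is then
    right for every [Q], which makes [rotF] total. *)
Lemma rotF_subproof (Q : 'M[R]_n) (F : G) : 
  \dim (if Q *m Q^T == 1%:M then linfun (mulmxr Q) @: val F else val F)%VS == (n - k)%N.
Proof.
case: (Q *m Q^T =P 1%:M) => [QQ|_]; last by case: F.
rewrite limg_dim_eq ?(eqP (valP F))//; apply/eqP; rewrite -subv0.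
suff /lker0P/eqP-> : injective (linfun (mulmxr Q : 'rV[R]_n -> 'rV[R]_n)) by exact: capvSr.
move=> x y; rewrite !lfunE/= => /(congr1 (mulmx^~ Q^T)).
by rewrite -!mulmxA QQ !mulmx1.
Qed.

Definition rotF (Q : 'M[R]_n) (F : G) : G :=
  exist (fun E : {vspace 'rV[R]_n} => is_true (\dim E == (n - k)%N)) _ (rotF_subproof Q F).

Lemma val_rotF Q (F : G) : isorth Q -> val (rotF Q F) = (linfun (mulmxr Q) @: val F)%VS.
Proof. by move=> oQ /=; rewrite (oQ : _ = _) eqxx. Qed.

Lemma mem_rotF Q (F : G) x : isorth Q -> (x \in val (rotF Q F)) = (x *m Q^T \in val F).
Proof.
move=> oQ; rewrite val_rotF//; apply/idP/idP => [/memv_imgP[y yF ->]|xF].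
  by rewrite lfunE/= -mulmxA (oQ : _ = _) mulmx1.
by apply/memv_imgP; exists (x *m Q^T) => //; rewrite lfunE/= -mulmxA (mulmx1C (oQ : _ = _)) mulmx1.
Qed.

Lemma rotFK Q : isorth Q -> cancel (rotF Q) (rotF Q^T).
Proof.
move=> oQ F; apply: val_inj; apply/vspaceP => x.
by rewrite !mem_rotF//; [rewrite trmxK -mulmxA (oQ : _ = _) mulmx1 | exact: isorthT].
Qed.

(** Invariance is stated with images of sets while a change of variables needs preimages; rotating
    by the transpose identifies the two. *)
Lemma rotate_preimage Q (A : set G) : isorth Q -> rotate Q^T A = rotF Q @^-1` A.
Proof.
move=> oQ; have oQT := isorthT oQ; apply/seteqP; split => F.
  move=> [E AE]; rewrite -val_rotF// => /val_inj ->.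
  by rewrite /preimage/= -{1}(trmxK Q) rotFK.
by move=> AF; exists (rotF Q F) => //; rewrite -val_rotF// rotFK.
Qed.

Lemma orthproj_rotF Q (F : G) : isorth Q -> orthproj (rotF Q F) = Q^T *m (orthproj F *m Q).
Proof.
move=> oQ; have [UU hU] := frameP (rotF Q F); have [VV hV] := frameP F.
have -> : Q^T *m (orthproj F *m Q) = (frame F *m Q)^T *m (frame F *m Q).
  by rewrite trmx_mul /orthproj !mulmxA.
apply: frame_proj_unique => //.
  by rewrite trmx_mul mulmxA -(mulmxA (frame F)) (oQ : _ = _) mulmx1.
have QV : (frame F *m Q *m Q^T) = frame F by rewrite -mulmxA (oQ : _ = _) mulmx1.
apply/andP; split; apply/row_subP => i.
  have : (row i (frame (rotF Q F)) <= frame (rotF Q F))%MS by exact: row_sub.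
  rewrite -hU mem_rotF// hV => /(submxMr Q).
  by rewrite -mulmxA (mulmx1C (oQ : _ = _)) mulmx1.
by rewrite -hU mem_rotF// hV row_mul -mulmxA (oQ : _ = _) mulmx1 row_sub.
Qed.

End grassmannian_rotations.

(** * Measurability and invariance on the Grassmannian *)

Section mean_over_grassmannian.
Context {R : realType} {n k : nat}.
Local Notation G := (grassmannian R n k).
Local Notation B := (borel_grassmannian R n k).

Lemma open_grassmannianP (A : set G) : open A <-> exists2 O : set 'M[R]_n, open O & orthproj @^-1` O = A.
Proof. by []. Qed.

Lemma measurable_orthproj (f : 'M[R]_n -> R) : continuous f ->
  measurable_fun [set: B] (fun F : B => f (orthproj (F : G))).
Proof.
move=> cf mD; apply: (measurability _ (RGenOInfty.measurableE R)) => //.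
move=> _ [_ [x ->] <-]; rewrite setTI; apply: sub_sigma_algebra.
apply/open_grassmannianP; exists (f @^-1` [set y | x < y]).
  by apply: open_comp => [y _|]; [exact: cf | exact: open_gt].
by apply/seteqP; split => F; rewrite /preimage/= in_itv/= andbT.
Qed.

Lemma measurable_rotF (Q : 'M[R]_n) : isorth Q -> measurable_fun [set: B] (rotF Q : B -> B).
Proof.
move=> oQ mD; apply: (@measurability _ _ B B setT (rotF Q) (@open G) erefl) => //.
move=> _ [_ [U oU <-] <-]; rewrite setTI; apply: sub_sigma_algebra.
apply/open_grassmannianP; exists ((fun P => Q^T *m (P *m Q)) @^-1` U).
  apply: open_comp => // y _; apply: cont_mulmx; first exact: cont_cst.
  by apply: cont_mulmx; [exact: cont_id | exact: cont_cst].
by apply/seteqP; split => F; rewrite /preimage/= orthproj_rotF.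
Qed.

Lemma integral_rotF (nu : probability B R) (Q : 'M[R]_n) (g : B -> \bar R) :
  rotation_invariant nu -> isorth Q -> measurable_fun setT g -> (forall F, 0 <= g F)%E ->
  (\int[nu]_F g (rotF Q F) = \int[nu]_F g F)%E.
Proof.
move=> nu_inv oQ mg g0; have mQ := measurable_rotF oQ.
rewrite -[LHS](@ge0_integral_pushforward _ _ _ _ R _ mQ nu setT g)//.
pose psi : {mfun B >-> B} := HB.pack (rotF Q : B -> B) (isMeasurableFun.Build _ _ _ _ _ mQ).
apply: (@eq_measure_integral _ _ _ _ nu (pushforward nu psi)) => A mA _.
have oQT := isorthT oQ.
transitivity (nu (rotate Q^T A)); last exact: nu_inv.
by rewrite (rotate_preimage A oQ).
Qed.

End mean_over_grassmannian.

(** For an interior point x0 and a small z, the points x0 + z and -(x0 - z) lie in [K] and have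
    midpoint z. Halving d passes from an open sup-norm ball to a closed Euclidean one. *)
Lemma symmetric_inner_radius (R : realType) n (K : set 'rV[R]_n) : convex_body K ->
  centrally_symmetric K -> exists r, inner_radius K r.
Proof.
move=> [_ vK [x0 /nbhs_ballP[d /= d0 hd]]] sK; exists (d / 2); split; first by rewrite divr_gt0.
move=> z zd.
have zn : `|z| < d.
  apply: (@le_lt_trans _ _ (d / 2)); last by lra.
  apply: norm_le_coord => [|i l]; first lra.
  by rewrite ord1; exact: le_trans (coord_le_enorm _ _) zd.
have h1 : K (x0 + z) by apply: hd; rewrite -ball_normE/= opprD addNKr normrN.
have h2 : K (x0 - z) by apply: hd; rewrite -ball_normE/= opprB addrC subrK.
have -> : z = 2^-1 *: (x0 + z) + 2^-1 *: (- (x0 - z)).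
  by apply/rowP => i; rewrite !mxE; lra.
apply: (convex_set_cvx vK) => //; [exact: sK | lra].
Qed.

Section sections.
Context {R : realType}.

Lemma mv_frame_eball_omega n p j k (F : 'M[R]_(p, n)) : (j <= p)%N -> n = (p + k)%N ->
  F *m F^T = 1%:M ->
  mv j (@eball R n) (F^T *m F) = 'C(p, j)%:R * (omega p * omega (n - j) / omega (p - j)).
Proof.
move=> jp; have [m pE] : exists m, p = (j + m)%N by exists (p - j)%N; rewrite subnKC.
subst p => nE FF; have h := mv_frame_eball nE FF.
have -> : (n - j = m + k)%N by rewrite nE -addnA addKn.
by rewrite addKn; apply: (mulIf (lt0r_neq0 (omega_gt0 m))); rewrite h; field; rewrite gt_eqF ?omega_gt0.
Qed.

Lemma quermassintegral_ge0 p j (K : set 'rV[R]_p) : (j <= p)%N -> cbody K ->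
  0 <= quermassintegral K j.
Proof.
move=> jp bK; have := mv_ge0 (1%:M : 'M[R]_p) bK jp.
by rewrite mv_quermassintegral// pmulr_rge0// ltr0n bin_gt0.
Qed.

(** [mv_slice_bounds] divided by both volumes: the volume of the section is now only in the ratio to
    be integrated, and the bounds are constant multiples of [mv]. The binomial in [c] converts
    between a Steiner coefficient and a quermassintegral. *)
Lemma quermassintegral_section n p j k (F : 'M[R]_(p, n)) (K : set 'rV[R]_n) r :
  (j <= p)%N -> n = (p + k)%N -> F *m F^T = 1%:M -> cbody K -> (forall x, K x -> K (- x)) ->
  inner_radius K r ->
  let S := [set y | K (y *m F)] in
  let c := 'C(p, j)%:R * volume K in
  [/\ 0 <= quermassintegral S j / volume S,
      quermassintegral S j / volume S <= 'C(n - j, k)%:R / c * mv j K (F^T *m F) &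
      'C(n, k)%:R^-1 / c * mv j K (F^T *m F) <= quermassintegral S j / volume S].
Proof.
move=> jp; have [m pE] : exists m, p = (j + m)%N by exists (p - j)%N; rewrite subnKC.
subst p => nE FF bK sK rK S c.
have bS : cbody S := cbody_preimage_mulmx FF bK.
have rS : inner_radius S r.
  by have [r0 hr] := rK; split => // y yr; apply: hr; rewrite enorm_coisometry.
have [[cK _] [cS _]] := (bK, bS).
have V0 := volume_gt0 cK rK; have v0 := volume_gt0 cS rS.
have [h1 h2] := mv_slice_bounds nE FF bK sK bS.
have -> : (n - j = m + k)%N by rewrite nE -addnA addKn.
rewrite mv_quermassintegral// in h1 h2.
have q0 : 0 < 'C(j + m, j)%:R :> R by rewrite ltr0n bin_gt0.
have q1 : 0 < 'C(n, k)%:R :> R by rewrite ltr0n bin_gt0 nE leq_addl.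
have c0 : 0 < c by rewrite mulr_gt0.
split; first by rewrite divr_ge0 ?(ltW v0)// quermassintegral_ge0.
  set g := mv j K _ in h1 *.
  have -> : 'C(m + k, k)%:R / c * g = 'C(m + k, k)%:R * (g * volume S) / c / volume S.
    by field; rewrite !gt_eqF.
  rewrite ler_pM2r ?invr_gt0// ler_pdivlMr// /c; lra.
set g := mv j K _ in h2 *.
have -> : 'C(n, k)%:R^-1 / c * g = g * volume S / ('C(n, k)%:R * c) / volume S.
  by field; rewrite !gt_eqF.
rewrite ler_pM2r ?invr_gt0// ler_pdivrMr ?mulr_gt0// /c; lra.
Qed.

End sections.

(** * Integral of the mixed volume over the Grassmannian *)

Section mean.
Context {R : realType} {n k : nat}.
Local Notation B := (borel_grassmannian R n k).
Variables (nu : probability B R) (nu_inv : rotation_invariant nu).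

(** By invariance, a finite average over rotations has the same integral as the function itself; by
    [mv_mean] it is nearly the constant a b, where [b] is the value for the ball, common to all
    subspaces. *)
Lemma integral_mv_orthproj j (K : set 'rV[R]_n) r : (k <= n)%N -> (j <= n - k)%N ->
  cbody K -> inner_radius K r ->
  (\int[nu]_(F in [set: B]) (mv j K (orthproj F))%:E =
   ('C(n - k, j)%:R * (alpha R n k j * quermassintegral K j))%:E)%E.
Proof.
move=> kn jp bK rK; have jn : (j <= n)%N by rewrite (leq_trans jp)// leq_subr.
set b : R := 'C(n - k, j)%:R * (omega (n - k) * omega (n - j) / omega (n - k - j)).
have hb (F : grassmannian R n k) : mv j (@eball R n) (orthproj F) = b.
  have [FF _] := frameP F; apply: (mv_frame_eball_omega (k := k)) => //.
  by rewrite subnK.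
have b0 : 0 < b by rewrite !mulr_gt0 ?invr_gt0 ?omega_gt0// ltr0n bin_gt0.
have w0 := @omega_gt0 R n.
set a := quermassintegral K j / omega n.
have -> : 'C(n - k, j)%:R * (alpha R n k j * quermassintegral K j) = a * b.
  rewrite /alpha /a /b; field.
  by rewrite !gt_eqF ?omega_gt0.
have a0 : 0 <= a by rewrite divr_ge0 ?(ltW w0)// quermassintegral_ge0.
set I := (\int[nu]_(F in _) _)%E.
pose f (Q : 'M[R]_n) (F : B) := (mv j K (orthproj F *m Q))%:E.
have mf Q : measurable_fun setT (f Q).
  apply/measurable_EFinP; apply: (@measurable_orthproj _ _ _ (fun P => mv j K (P *m Q))).
  apply: (@cont_comp _ _ _ (fun P : 'M[R]_n => P *m Q) (fun P : 'M[R]_n => mv j K P)).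
    by apply: cont_mulmx; [exact: cont_id | exact: cont_cst].
  exact: (mv_continuous bK rK).
have f0 Q F : (0 <= f Q F)%E by rewrite lee_fin mv_ge0.
have fI Q : isorth Q -> (\int[nu]_(F in [set: B]) f Q F = I)%E.
  (* The projection onto the rotated subspace is Q^T (orthproj F) Q, and its left factor Q^T only
     rotates the ball. *)
  move=> oQ; rewrite /I -[RHS](integral_rotF (g := fun F => (mv j K (orthproj F))%:E) nu_inv oQ).
  - apply: eq_integral => F _; by rewrite /f orthproj_rotF// (mv_isorth _ _ _ (isorthT oQ)).
  - by have := mf 1%:M; congr measurable_fun; apply/funext => F; rewrite /f mulmx1.
  - by move=> F; rewrite lee_fin mv_ge0.
have mean e : 0 < e -> exists2 s : seq 'M[R]_n, orth_family s &
    forall F : B, `|(\sum_(Q <- s) mv j K (orthproj F *m Q)) / (size s)%:R - a * b| <= e.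
  move=> e0; have e1 : 0 < e / 2 / b by rewrite !divr_gt0.
  have [s [c [os hs]]] := mv_mean jn bK rK e1.
  exists s => // F; have [s0 os'] := os.
  (* The identity stands for the whole space and gives |a - c| <= e / (2 b); replacing c by a in the
     estimate for [orthproj F] then costs the other half of e. *)
  have h1 := hs _ (1%:M : 'M[R]_n); have h2 := hs _ (orthproj F).
  have e1E : \sum_(Q <- s) mv j K (1%:M *m Q) = (size s)%:R * mv j K (1%:M : 'M[R]_n).
    rewrite (eq_big_seq (fun=> mv j K (1%:M : 'M[R]_n))) => [|Q /os' oQ].
      by rewrite big_const_seq count_predT iter_addr_0 mulr_natl.
    by rewrite mul1mx -[Q in LHS]mulmx1 mv_isorth.
  rewrite e1E mv_eball// mv_quermassintegral// mulrAC mulfV ?mul1r in h1; last first.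
    by rewrite pnatr_eq0 -lt0n.
  rewrite hb mulfVK ?gt_eqF// in h2.
  have C0 : 0 < 'C(n, j)%:R * omega n :> R by rewrite mulr_gt0// ltr0n bin_gt0.
  have e2 : 'C(n, j)%:R * quermassintegral K j - c * ('C(n, j)%:R * omega n) =
      (a - c) * ('C(n, j)%:R * omega n).
    by rewrite /a; field; rewrite gt_eqF.
  rewrite e2 normrM (gtr0_norm C0) ler_pM2r// in h1.
  have h3 : `|(a - c) * b| <= e / 2.
    by rewrite normrM (gtr0_norm b0) -ler_pdivlMr.
  move: h2 h3; rewrite !ler_norml => /andP[l1 l2] /andP[l3 l4].
  by apply/andP; split; lra.
have sumI s : orth_family s ->
    (\int[nu]_(F in [set: B]) (\sum_(Q <- s) mv j K (orthproj F *m Q))%:E = (size s)%:R%:E * I)%E.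
  move=> [_ os]; under eq_integral do rewrite -sumEFin.
  rewrite (ge0_integral_sum nu measurableT mf (fun Q F _ => f0 Q F)).
  rewrite (eq_big_seq (fun=> I)) => [|Q /os /fI //].
  elim: {os}s => [|Q s IH]; first by rewrite big_nil mul0e.
  have -> : size (Q :: s) = (size s).+1 by [].
  by rewrite big_cons IH -natr1 EFinD ge0_muleDl// mul1e addeC.
have cstI (c : R) : (\int[nu]_(F in [set: B]) c%:E = c%:E)%E.
  by rewrite (integral_cst nu measurableT c%:E) -[RHS]mule1; congr (_ * _)%E; exact: probability_setT.
(* [I] is an extended real, so each inequality is proved up to e, after multiplying by the size of
   the family. *)
apply/le_anti/andP; split; apply/lee_addgt0Pr => e e0.
  have [s os hs] := mean e e0; have [s0 _] := os.
  have N0 : 0 < (size s)%:R :> R by rewrite ltr0n.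
  rewrite -(@lee_pmul2l _ (size s)%:R%:E)//= -(sumI s os) -EFinD -EFinM -cstI.
  apply: ge0_le_integralT => F; first by rewrite lee_fin sumr_ge0// => Q _; rewrite mv_ge0.
  rewrite lee_fin mulrC -ler_pdivrMr//.
  by have := hs F; rewrite ler_norml => /andP[_]; lra.
have [s os hs] := mean e e0; have [s0 _] := os.
have N0 : 0 < (size s)%:R :> R by rewrite ltr0n.
rewrite -(@lee_pmul2l _ (size s)%:R%:E)//= -EFinM muleDr//; last first.
  by rewrite ge0_adde_def// inE ?lee_fin ?integral_ge0// ?ltW// => F _; rewrite lee_fin mv_ge0.
rewrite -(sumI s os) -[((size s)%:R * _)%:E]cstI -EFinM -[X in (_ <= _ + X)%E]cstI.
rewrite -ge0_integralD//=.
- apply: ge0_le_integralT => F; first by rewrite lee_fin mulr_ge0// mulr_ge0// ltW.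
  rewrite -EFinD lee_fin -(ler_pM2l (x := (size s)%:R^-1)) ?invr_gt0// mulKf ?gt_eqF//.
  rewrite mulrDr mulKf ?gt_eqF// [_^-1 * _]mulrC.
  by have := hs F; rewrite ler_norml => /andP[+ _]; lra.
- by move=> F _; rewrite lee_fin sumr_ge0// => Q _; rewrite mv_ge0.
- under eq_fun do rewrite -sumEFin; exact: emeasurable_sum.
- by move=> F _; rewrite lee_fin mulr_ge0// ltW.
Qed.

End mean.

Theorem theorem1p3 (R : realType) (n k j : nat)
    (hk : (k < n)%N) (hj : (j <= n - k - 1)%N)
    (K : set 'rV[R]_n) (K_body : convex_body K)
    (K_sym : centrally_symmetric K)
    (nu : probability (borel_grassmannian R n k) R)
    (nu_inv : rotation_invariant nu) :
  ((alpha R n k j * 'C(n, k)%:R^-1 * (quermassintegral K j / volume K))%:E <=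
     \int[nu]_(F in [set: borel_grassmannian R n k])
       (quermassintegral (slice K F) j / volume (slice K F))%:E)%E /\
  (\int[nu]_(F in [set: borel_grassmannian R n k])
       (quermassintegral (slice K F) j / volume (slice K F))%:E <=
   (alpha R n k j * 'C(n - j, k)%:R * (quermassintegral K j / volume K))%:E)%E.
Proof.
have [r rK] := symmetric_inner_radius K_body K_sym.
have [cK vK _] := K_body; have bK : cbody K := conj cK (convex_set_cvx vK).
have V0 := volume_gt0 cK rK.
have kn := ltnW hk; have jp : (j <= n - k)%N by rewrite (leq_trans hj)// leq_subr.
have jn : (j <= n)%N by rewrite (leq_trans jp)// leq_subr.
have C0 : 0 < 'C(n - k, j)%:R :> R by rewrite ltr0n bin_gt0.
have nE : n = (n - k + k)%N by rewrite subnK.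
have bounds (F : borel_grassmannian R n k) :=
  quermassintegral_section jp nE (proj1 (frameP F)) bK K_sym rK.
have g0 (F : borel_grassmannian R n k) : 0 <= mv j K (orthproj F) by rewrite mv_ge0.
have scale c : 0 <= c ->
    (\int[nu]_(F in [set: borel_grassmannian R n k]) (c * mv j K (orthproj F))%:E =
     (c * ('C(n - k, j)%:R * (alpha R n k j * quermassintegral K j)))%:E)%E.
  move=> c0; under eq_integral do rewrite EFinM.
  rewrite ge0_integralZl_EFin//.
  - by rewrite (integral_mv_orthproj nu_inv kn jp bK rK) EFinM.
  - by move=> F _; rewrite lee_fin.
  - apply/measurable_EFinP; apply: (@measurable_orthproj _ _ _ (fun P => mv j K P)).
    exact: (mv_continuous bK rK).
set c := 'C(n - k, j)%:R * volume K in bounds.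
have c0 : 0 < c by rewrite mulr_gt0.
split.
  (* The binomial C(n - k, j) of the integral of [mv] cancels the one in [c]. *)
  have -> : alpha R n k j * 'C(n, k)%:R^-1 * (quermassintegral K j / volume K) =
      'C(n, k)%:R^-1 / c * ('C(n - k, j)%:R * (alpha R n k j * quermassintegral K j)).
    by rewrite /c; field; rewrite !gt_eqF// ltr0n bin_gt0.
  have d0 : 0 <= 'C(n, k)%:R^-1 / c by rewrite divr_ge0 ?invr_ge0// ltW.
  (* The nonnegative integral is monotone for arbitrary functions, so this applies to the ratio
     directly, although it depends on F through the chosen [frame]. *)
  rewrite -scale//; apply: ge0_le_integralT => F; first by rewrite lee_fin mulr_ge0.
  by rewrite lee_fin; have [] := bounds F.
have -> : alpha R n k j * 'C(n - j, k)%:R * (quermassintegral K j / volume K) =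
    'C(n - j, k)%:R / c * ('C(n - k, j)%:R * (alpha R n k j * quermassintegral K j)).
  by rewrite /c; field; rewrite !gt_eqF.
have d0 : 0 <= 'C(n - j, k)%:R / c by rewrite divr_ge0// ltW.
rewrite -scale//; apply: ge0_le_integralT => F; rewrite lee_fin; by have [] := bounds F.
Qed.
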